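(* Let $\pi : (M, g_0) \rightarrow (N, g_N)$ be a Riemannian submersion with totally geodesic fibers. If there exists a non-trivial variation $\{ g_t, t \in (-\epsilon, \epsilon) \} \subset \mathrm{Riem}(M, \mathcal{V}, g_0)$ such that $\pi : (M, g_t) \rightarrow (N, g_N)$ is a Riemannian submersion with totally geodesic fibers for all $t \in (-\epsilon, \epsilon)$, then there exists a non-trivial vertical vector field $\xi$ on $M$ whose restriction to $(\mathcal{F}_{x} , g_0 \vert_{\mathcal{F}_{x}})$ is a Killing field for all $x \in N$. On the other hand, if on $(M, g_0)$ there exists a non-trivial bounded vertical vector field $\xi$ whose restriction to every fiber of $\pi$ (with the metric induced by $g_0$) is Killing, then there exists a non-trivial variation $\{ g_t, t \in (-\epsilon, \epsilon) \} \subset \mathrm{Riem}(M, \mathcal{V}, g_0)$ such that $\pi : (M, g_t) \rightarrow (N, g_N)$ is a Riemannian submersion with totally geodesic fibers for all $t \in (-\epsilon, \epsilon)$.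
   Context: Manifolds are smooth, connected and oriented; all functions and tensor fields are smooth. A Riemannian submersion $\pi:(M,g)\to(N,g_N)$ is a smooth map with $\operatorname{rank}\pi_*=\dim N$ and $g(X,Y)=g_N(\pi_*X,\pi_*Y)$ for all $X,Y$ that are $g$-orthogonal to $\ker\pi_*$. $\mathcal{V}=\ker\pi_*$ is the vertical distribution; vertical vector fields are those with values in $\mathcal{V}$; $\mathcal{F}_x=\pi^{-1}(\{x\})$ is the fiber over $x\in N$. $\mathrm{Riem}(M,\mathcal{V},g_0)$ is the set of Riemannian metrics $g$ on $M$ with $g(X,Y)=g_0(X,Y)$ for all vertical $X,Y$. A variation of $g_0$ is a one-parameter family $\{g_t, t\in(-\epsilon,\epsilon)\}\subset \mathrm{Riem}(M,\mathcal{V},g_0)$ depending smoothly on $t$, whose member at $t=0$ is $g_0$; it is non-trivial if $g_t\neq g_0$ for some $t$. A vector field is non-trivial if it is not everywhere zero, and bounded on $(M,g)$ if $g(X,X)$ is a bounded function. The fibers of $\pi:(M,g_t)\to(N,g_N)$ are totally geodesic if $h_t(X,Y)=0$ for all vertical $X,Y$, where $h_t(X,Y)=P_{\mathcal{H}}^t\nabla^t_XY$, $\nabla^t$ is the Levi-Civita connection of $g_t$ and $P_{\mathcal{H}}^t$ is the $g_t$-orthogonal projection onto the $g_t$-orthogonal complement $\mathcal{H}(t)$ of $\mathcal{V}$.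
   Formalization: The second assertion additionally assumes dim N > 0: if N is a point, every vector is vertical and Riem(M,V,g_0)={g_0}, so it fails, e.g. for M a circle with a rotation field. *)

(* Defs.v *)
From HB Require Import structures.
From mathcomp Require Import all_boot all_order all_algebra.
From mathcomp Require Import all_classical all_reals all_analysis.
Set Implicit Arguments.
Unset Strict Implicit.
Unset Printing Implicit Defensive.
Import Order.TTheory GRing.Theory Num.Theory numFieldNormedType.Exports.
Local Open Scope classical_set_scope.
Local Open Scope ring_scope.

(* C^oo on an open set U: all iterated directional derivatives exist and are
   continuous on U. For finite-dimensional E this is the usual notion. *)
Definition smooth_on (R : realType) (E F : normedModType R)
    (U : set E) (f : E -> F) : Prop :=
  forall (vs : seq E) (x : E), U x ->
    let h := foldr (fun v k => 'D_v k) f vs in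
    {for x, continuous h} /\ (forall v, derivable h x v).

(* A homeomorphism between open sets dom and cod; the values of the two maps
   outside dom and cod are irrelevant. *)
Record chart (R : realType) (T : topologicalType) (n : nat) := Chart {
  dom : set T;
  cod : set 'rV[R]_n;
  chart_map :> T -> 'rV[R]_n;
  chart_inv : 'rV[R]_n -> T;
  dom_open : open dom;
  cod_open : open cod;
  chart_map_cod : forall p, dom p -> cod (chart_map p);
  chart_inv_dom : forall y, cod y -> dom (chart_inv y);
  chart_mapK : forall p, dom p -> chart_inv (chart_map p) = p;
  chart_invK : forall y, cod y -> chart_map (chart_inv y) = y;
  chart_map_continuous : {within dom, continuous chart_map};
  chart_inv_continuous : {within cod, continuous chart_inv}
}.

Definition overlap (R : realType) (T : topologicalType) (n : nat)
    (c d : chart R T n) : set 'rV[R]_n :=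
  [set y | cod c y /\ dom d (chart_inv c y)].

(* Smooth connected oriented n-manifolds; the orientation is encoded by the
   atlas, all of whose transition maps have positive Jacobian determinant. *)
Record manifold (R : realType) (n : nat) := Manifold {
  points :> topologicalType;
  atlas : set (chart R points n);
  points_hausdorff : hausdorff_space points;
  points_second_countable : @second_countable points;
  points_connected : connected [set: points];
  atlas_cover : forall p, exists2 c, atlas c & dom c p;
  atlas_smooth : forall c d, atlas c -> atlas d ->
    smooth_on (overlap c d) (d \o chart_inv c);
  atlas_oriented : forall c d, atlas c -> atlas d ->
    forall y, overlap c d y -> 0 < \det (jacobian (d \o chart_inv c) y)
}.

Definition smooth_fun (R : realType) (n : nat) (M : manifold R n) :
    set (M -> R) :=
  [set f : M -> R | forall c, atlas c ->
    smooth_on (cod c) (fun y => f (chart_inv c y) : R^o)].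
Arguments smooth_fun {R n} M.

Definition smooth_map (R : realType) (m n : nat) (M : manifold R m)
    (N : manifold R n) (pi : M -> N) : Prop :=
  continuous pi /\
  forall c d, atlas c -> atlas d ->
    smooth_on [set y | cod c y /\ dom d (pi (chart_inv c y))]
              (d \o pi \o chart_inv c).

(* Tangent vectors at p are the derivations at p of the algebra C of smooth
   functions. They are represented by functions on all of T -> R that vanish
   outside C, so that two tangent vectors are equal iff they agree on C. The
   notions up to [killing] only depend on C; they are used both for manifolds
   and for the fibers of a submersion. *)
Notation tvec R T := ((T -> R) -> R).
Notation vfield R T := (T -> tvec R T).
Notation mtensor R T := (T -> tvec R T -> tvec R T -> R).

Definition tangent (R : realType) (T : Type) (C : set (T -> R)) (p : T) :
    set (tvec R T) :=
  [set v | [/\ forall f, ~ C f -> v f = 0,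
      forall (a : R) f h, C f -> C h ->
        v (fun q => a * f q + h q) = a * v f + v h
    & forall f h, C f -> C h ->
        v (fun q => f q * h q) = v f * h p + f p * v h]].

Definition vector_field (R : realType) (T : Type) (C : set (T -> R)) :
    set (vfield R T) :=
  [set X | (forall p, tangent C p (X p)) /\
           forall f, C f -> C (fun p => X p f)].

Definition riemannian_metric (R : realType) (T : Type) (C : set (T -> R)) :
    set (mtensor R T) :=
  [set g | [/\ forall p u v, tangent C p u -> tangent C p v ->
        g p u v = g p v u,
      forall p (a : R) u v w,
        tangent C p u -> tangent C p v -> tangent C p w ->
        g p (a *: u + v) w = a * g p u w + g p v w,
      forall p v, tangent C p v -> v <> 0 -> 0 < g p v v
    & forall X Y, vector_field C X -> vector_field C Y ->
        C (fun p => g p (X p) (Y p))]].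

(* When X and Y are vector fields this vanishes outside C, as required of
   tangent vectors: if f is not in C then Y _ f and X _ f are identically 0. *)
Definition lie_bracket (R : realType) (T : Type) (X Y : vfield R T) :
    vfield R T :=
  fun p f => X p (fun q => Y q f) - Y p (fun q => X q f).

Definition levi_civita (R : realType) (T : Type) (C : set (T -> R))
    (g : mtensor R T) (nabla : vfield R T -> vfield R T -> vfield R T) : Prop :=
  [/\ (* affine connection *)
    [/\ forall X Y, vector_field C X -> vector_field C Y ->
        vector_field C (nabla X Y),
      forall f X Y Z, C f ->
        vector_field C X -> vector_field C Y -> vector_field C Z ->
        forall p, nabla (fun q => f q *: X q + Y q) Z p
                  = f p *: nabla X Z p + nabla Y Z p,
      forall X Y Z,
        vector_field C X -> vector_field C Y -> vector_field C Z ->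
        forall p, nabla X (fun q => Y q + Z q) p = nabla X Y p + nabla X Z p
    & forall f X Y, C f -> vector_field C X -> vector_field C Y ->
        forall p, nabla X (fun q => f q *: Y q) p
                  = X p f *: Y p + f p *: nabla X Y p],
    (* torsion-free *)
    forall X Y, vector_field C X -> vector_field C Y ->
      forall p, nabla X Y p - nabla Y X p = lie_bracket X Y p
  & (* metric *)
    forall X Y Z, vector_field C X -> vector_field C Y -> vector_field C Z ->
      forall p, X p (fun q => g q (Y q) (Z q))
                = g p (nabla X Y p) (Z p) + g p (Y p) (nabla X Z p)].

(* The Lie derivative of g along Z vanishes. *)
Definition killing (R : realType) (T : Type) (C : set (T -> R))
    (g : mtensor R T) (Z : vfield R T) : Prop :=
  vector_field C Z /\
  forall X Y, vector_field C X -> vector_field C Y ->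
    forall p, Z p (fun q => g q (X q) (Y q))
              = g p (lie_bracket Z X p) (Y p) + g p (X p) (lie_bracket Z Y p).

(* The differential of phi : T -> T', independent of the base point in this
   representation of tangent vectors. *)
Definition differential (R : realType) (T T' : Type) (C' : set (T' -> R))
    (phi : T -> T') (v : tvec R T) : tvec R T' :=
  fun h => if `[< C' h >] then v (h \o phi) else 0.

(* r vectors at p are mapped by the differential of phi to a basis of its
   image. *)
Definition has_rank (R : realType) (T T' : Type)
    (C : set (T -> R)) (C' : set (T' -> R)) (phi : T -> T') (p : T) (r : nat) :
    Prop :=
  exists e : 'I_r -> tvec R T,
  [/\ forall i, tangent C p (e i),
      forall a : 'I_r -> R,
        \sum_(i < r) a i *: differential C' phi (e i) = 0 -> forall i, a i = 0
    & forall v, tangent C p v -> exists a : 'I_r -> R,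
        differential C' phi v = \sum_(i < r) a i *: differential C' phi (e i)].

Section Submersions.
Variables (R : realType) (m n : nat) (M : manifold R m) (N : manifold R n).
Variable pi : M -> N.

Notation TM := (tangent (smooth_fun M)).
Notation dpi := (differential (smooth_fun N) pi).

Definition vertical (p : M) : set (tvec R M) :=
  [set v | TM p v /\ dpi v = 0].

Definition horizontal (g : mtensor R M) (p : M) : set (tvec R M) :=
  [set v | TM p v /\ forall w, vertical p w -> g p v w = 0].

Definition vertical_field : set (vfield R M) :=
  [set X | vector_field (smooth_fun M) X /\ forall p, vertical p (X p)].

Definition riemannian_submersion (g : mtensor R M) (gN : mtensor R N) : Prop :=
  [/\ smooth_map pi,
      forall p, has_rank (smooth_fun M) (smooth_fun N) pi p n
    & forall p v w, horizontal g p v -> horizontal g p w ->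
        g p v w = gN (pi p) (dpi v) (dpi w)].

(* w is the g-orthogonal projection of v onto the horizontal space at p. *)
Definition horizontal_part (g : mtensor R M) (p : M) (v w : tvec R M) : Prop :=
  horizontal g p w /\ vertical p (v - w).

(* h(X, Y), the horizontal part of the Levi-Civita derivative of Y along X, is 0
   for all vertical X and Y. *)
Definition totally_geodesic_fibers (g : mtensor R M) : Prop :=
  exists2 nabla, levi_civita (smooth_fun M) g nabla
  & forall X Y, vertical_field X -> vertical_field Y ->
      forall p, horizontal_part g p (nabla X Y p) 0.

Definition same_metric (g g' : mtensor R M) : Prop :=
  forall p v w, TM p v -> TM p w -> g p v w = g' p v w.

Definition Riem (g0 : mtensor R M) : set (mtensor R M) :=
  [set g | riemannian_metric (smooth_fun M) g /\
    forall p v w, vertical p v -> vertical p w -> g p v w = g0 p v w].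

(* Smoothness in t is joint: (t, p) |-> g_t(X, Y)(p) is smooth on the product
   of ]-eps, eps[ and M. *)
Definition metric_variation (g0 : mtensor R M) (eps : R) (g : R -> mtensor R M) :
    Prop :=
  [/\ 0 < eps,
      forall t, - eps < t < eps -> Riem g0 (g t),
      forall X Y, vector_field (smooth_fun M) X ->
        vector_field (smooth_fun M) Y ->
        forall c, atlas c ->
          smooth_on [set ty : R^o * 'rV[R]_m | - eps < ty.1 < eps /\ cod c ty.2]
            (fun ty : R^o * 'rV[R]_m =>
               let p := chart_inv c ty.2 in g ty.1 p (X p) (Y p) : R^o)
    & same_metric (g 0) g0].

Definition nontrivial_variation (g0 : mtensor R M) (eps : R)
    (g : R -> mtensor R M) : Prop :=
  metric_variation g0 eps g /\
  exists2 t, - eps < t < eps & ~ same_metric (g t) g0.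

Definition nontrivial_field (X : vfield R M) : Prop := exists p, X p <> 0.

Definition bounded_field (g : mtensor R M) (X : vfield R M) : Prop :=
  [bounded (g p (X p) (X p) : R^o) | p in [set: M]].

Definition fiber (x : N) : Type := {p : M | pi p = x}.

(* The smooth functions of the embedded submanifold fiber x: those that are
   locally restrictions of smooth functions on M. *)
Definition fiber_smooth_fun (x : N) : set (fiber x -> R) :=
  [set f : fiber x -> R | forall z : fiber x,
    exists2 F : M -> R, smooth_fun M F &
      \forall q \near (sval z : M),
        forall z' : fiber x, sval z' = q -> f z' = F q].

Definition fiber_push (x : N) (v : tvec R (fiber x)) : tvec R M :=
  differential (smooth_fun M) (fun z : fiber x => sval z : M) v.

Definition fiber_metric (g : mtensor R M) (x : N) : mtensor R (fiber x) :=
  fun z v w => g (sval z) (fiber_push v) (fiber_push w).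

(* The restriction eta of X to the fiber over x is Killing for the induced
   metric. *)
Definition killing_on_fiber (g : mtensor R M) (X : vfield R M) (x : N) : Prop :=
  exists2 eta : vfield R (fiber x),
    (forall z, fiber_push (eta z) = X (sval z))
  & killing (@fiber_smooth_fun x) (fiber_metric g (x := x)) eta.

End Submersions.

(* Main.v *)
(* For a function h on N let Z be the gradient of h o pi with respect to g. It is
   horizontal, projects to the gradient of h on N, and for vertical X, Y the Levi-Civita
   connection satisfies g(nabla_X Y, Z) = - Hess(h o pi)(X, Y) = - (L_Z g)(X, Y) / 2.
   Hence the fibers are totally geodesic iff L_Z g vanishes on vertical fields for all h.
   For vertical X, Y the bracket [Z, X] is vertical, so only the restriction of g to
   vertical vectors, common to all metrics of Riem(M, V, g0), enters L_Z g (X, Y).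

   Given two such metrics g0 and g, the difference of the gradients of h o pi is therefore
   vertical and Killing on the fibers. If it vanished for all h, then g = g0, because
   these gradients span the horizontal spaces.

   Conversely, let xi be vertical and Killing on the fibers, and phi = f o pi with f a
   function on N such that d phi <> 0 at some point where xi <> 0. Pull g0 back by the
   unipotent automorphism v |-> v + t (v phi) xi of TM. This changes neither g0 on
   vertical vectors nor the induced metric on N, and replaces the gradient Z by
   Z - t (Z phi) xi, where Z phi is constant on the fibers.

   The restriction of xi to a fiber makes sense because a vertical vector annihilates the
   functions vanishing on the fiber; this is the only use of an implicit function
   argument. *)

Require Import Defs.
From HB Require Import structures.
From mathcomp Require Import all_boot all_order all_algebra.
From mathcomp Require Import all_classical all_reals all_analysis.
From mathcomp Require Import ring lra.
Import Order.TTheory GRing.Theory Num.Theory numFieldNormedType.Exports.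
Set Implicit Arguments.
Unset Strict Implicit.
Unset Printing Implicit Defensive.
Local Open Scope classical_set_scope.
Local Open Scope ring_scope.

(** * Smooth maps between normed spaces *)

(** A non-trivial variation may have vanishing derivative at [t = 0], so the Killing field is a
    finite difference of gradients, for [g0] and for one member of the variation different from it,
    and not an infinitesimal variation. In the converse the automorphism is unipotent because xi phi
    = 0, so its inverse has the same form with [- t].

    Two features of the setting shape the rest. Tangent vectors are derivations of the algebra of
    global smooth functions: local arguments pass through cutoffs, and Hadamard's lemma identifies
    derivations at a point with directional derivatives in a chart. Fibers carry no atlas: a field
    on a fiber is handled through local extensions to vertical fields on [M], and a vertical vector
    acts on a fiber function through any local extension. Independence of the extension needs only
    points of the fiber at distance o(s) from a straight line, and a contraction provides them.

    Totally geodesic fibers presuppose a Levi-Civita connection, so one is built for the sheared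
    metrics from Koszul's formula. Local solutions glue because they are unique; no partition of
    unity occurs. *)

Fixpoint class_C (R : realType) (E F : normedModType R) (k : nat)
    (U : set E) (f : E -> F) : Prop :=
  (forall x, U x -> {for x, continuous f}) /\
  if k is k'.+1 then
    (forall x v, U x -> derivable f x v) /\
    forall v, class_C k' U ('D_v f)
  else True.

Section ClassC.
Variables (R : realType) (E F : normedModType R).
Implicit Types (U : set E) (f g : E -> F).

Lemma class_C_continuous k U f x :
  class_C k U f -> U x -> {for x, continuous f}.
Proof. by case: k => [|k] [cf _] Ux; exact: cf. Qed.

Lemma class_CW k U f : class_C k.+1 U f -> class_C k U f.
Proof.
elim: k f => [|k IH] f [cf [df Df]]; first by split.
by split=> //; split=> // v; apply: IH.
Qed.

Lemma class_CS1 k U f : class_C k.+1 U f -> class_C 1 U f.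
Proof. by elim: k => // k IH /class_CW. Qed.

(** Counting derivatives instead of listing their directions turns the closure properties below into
    inductions on [k]. *)
Lemma smooth_onP U f : smooth_on U f <-> forall k, class_C k U f.
Proof.
split=> [sf k|Cf vs].
  elim: k f sf => [|k IH] f sf; first by split=> // x /(sf [::])[].
  split=> [x /(sf [::])[]//|]; split=> [x v /(sf [::])[]//|v].
  (* The derivative of the fold that is taken first is the one along the last vector of the list,
     hence [rcons] here and the induction from the right below. *)
  by apply: IH => vs x Ux; have := sf (rcons vs v) x Ux; rewrite foldr_rcons.
elim/last_ind: vs f Cf => [|vs v IH] f Cf x Ux /=.
  by have [c [d _]] := Cf 1%N; split=> [|v]; [exact: c|exact: d].
by rewrite foldr_rcons; apply: IH => // k; have [_ [_ D]] := Cf k.+1; exact: D.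
Qed.

Lemma smooth_on_derivable U f x v : smooth_on U f -> U x -> derivable f x v.
Proof. by move=> sf Ux; case: (sf [::] x Ux). Qed.

Lemma smooth_on_continuous U f x : smooth_on U f -> U x -> {for x, continuous f}.
Proof. by move=> sf Ux; case: (sf [::] x Ux). Qed.

Lemma smooth_on_derive U f v : smooth_on U f -> smooth_on U ('D_v f).
Proof.
by move=> /smooth_onP sf; apply/smooth_onP => k; have [_ [_ D]] := sf k.+1; exact: D.
Qed.

Lemma class_C_eq k U f g :
  open U -> (forall x, U x -> f x = g x) -> class_C k U f -> class_C k U g.
Proof.
move=> oU; elim: k f g => [|k IH] f g fg [cf Cf].
  split=> // x Ux; have nfg : {near x, f =1 g}.
    by near=> y; apply: fg; near: y; exact: open_nbhs_nbhs.
  rewrite /prop_for/continuous_at -(fg x Ux).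
  by apply: cvg_trans (cf x Ux); apply: near_eq_cvg.
have nfg x : U x -> {near x, f =1 g}.
  by move=> Ux; near=> y; apply: fg; near: y; exact: open_nbhs_nbhs.
split=> [x Ux|].
  rewrite /prop_for/continuous_at -(fg x Ux).
  by apply: cvg_trans (cf x Ux); apply: near_eq_cvg; exact: nfg.
case: Cf => df Df; split=> [x v Ux|v].
  by apply: near_eq_derivable (df x v Ux); exact: nfg.
by apply: IH (Df v) => x Ux; apply: near_eq_derive; exact: nfg.
Unshelve. all: by end_near. Qed.

Lemma class_C_cst k U (a : F) : class_C k U (cst a).
Proof.
elim: k a => [|k IH] a; split=> //; try by move=> x _; exact: cvg_cst.
split=> [x v _|v]; first exact: derivable_cst.
suff -> : 'D_v (cst a : E -> F) = cst 0 by exact: IH.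
by apply/funext => x; rewrite derive_cst.
Qed.

Lemma class_CD k U f g : open U -> class_C k U f -> class_C k U g ->
  class_C k U (fun x => f x + g x).
Proof.
move=> oU; elim: k f g => [|k IH] f g [cf Cf] [cg Cg]; split=> //.
- by move=> x Ux; apply: continuousD; [exact: cf|exact: cg].
- by move=> x Ux; apply: continuousD; [exact: cf|exact: cg].
case: Cf Cg => df Df [dg Dg]; split=> [x v Ux|v].
  by apply: derivableD; [exact: df|exact: dg].
apply: (@class_C_eq _ _ (fun x => 'D_v f x + 'D_v g x)) => //.
  by move=> x Ux; rewrite -deriveD//; [exact: df|exact: dg].
by apply: IH; [exact: Df|exact: Dg].
Qed.

Lemma smooth_on_sub U (V : set E) f : V `<=` U -> smooth_on U f -> smooth_on V f.
Proof. by move=> VU sf vs x /VU; exact: sf. Qed.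

Lemma smooth_on_eq U f g :
  open U -> (forall x, U x -> f x = g x) -> smooth_on U f -> smooth_on U g.
Proof.
by move=> oU fg /smooth_onP sf; apply/smooth_onP => k; exact: class_C_eq (sf k).
Qed.

(** Continuity and derivability in [smooth_on] are those of the whole space at a point of the set,
    not relative to the set; hence [V] may be any set containing [x]. *)
Lemma smooth_on_loc U f :
  (forall x, U x -> exists2 V, V x & smooth_on V f) -> smooth_on U f.
Proof. by move=> H vs x /H[V Vx sV]; exact: sV. Qed.

Lemma smooth_on_cst U (a : F) : smooth_on U (cst a).
Proof. by apply/smooth_onP => k; exact: class_C_cst. Qed.

Lemma smooth_onD U f g : open U -> smooth_on U f -> smooth_on U g ->
  smooth_on U (fun x => f x + g x).
Proof.
by move=> oU /smooth_onP sf /smooth_onP sg; apply/smooth_onP => k; exact: class_CD.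
Qed.

End ClassC.

Section ClassCReal.
Variables (R : realType) (E : normedModType R).
Implicit Types (U : set E) (f g : E -> R^o).

Lemma class_CM k U f g : open U -> class_C k U f -> class_C k U g ->
  class_C k U (fun x => f x * g x : R^o).
Proof.
move=> oU; elim: k f g => [|k IH] f g Cf Cg; split=> //.
- move=> x Ux; apply: continuousM; [exact: class_C_continuous Cf Ux|exact: class_C_continuous Cg Ux].
- move=> x Ux; apply: continuousM; [exact: class_C_continuous Cf Ux|exact: class_C_continuous Cg Ux].
have [_ [df Df]] := Cf; have [_ [dg Dg]] := Cg.
split=> [x v Ux|v]; first by apply: derivableM; [exact: df|exact: dg].
apply: (@class_C_eq _ _ _ _ _ (fun x => f x * 'D_v g x + g x * 'D_v f x : R^o)) => //.
  by move=> x Ux; rewrite deriveM//; [exact: df|exact: dg].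
by apply: class_CD => //; apply: IH; [exact: class_CW|exact: Dg|exact: class_CW|exact: Df].
Qed.

Lemma class_CV k U f : open U -> (forall x, U x -> f x != 0) -> class_C k U f ->
  class_C k U (fun x => (f x)^-1 : R^o).
Proof.
move=> oU f0; elim: k => [|k IH] Cf; split=> //.
- by move=> x Ux; apply: cvgV; [exact: f0|exact: class_C_continuous Cf Ux].
- by move=> x Ux; apply: cvgV; [exact: f0|exact: class_C_continuous Cf Ux].
have [_ [df Df]] := Cf.
split=> [x v Ux|v]; first by apply: derivableV; [exact: f0|exact: df].
(* The derivative [- (f x)^-2 * 'D_v f x] involves the reciprocal itself at one order less. *)
have CV := IH (class_CW Cf).
apply: (@class_C_eq _ _ _ _ _
  (fun x => -1 * ((f x)^-1 * (f x)^-1) * 'D_v f x : R^o)) => //.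
  move=> x Ux; rewrite deriveV; [|exact: f0|exact: df].
  by rewrite mulN1r -exprVn expr2.
apply: class_CM => //; last exact: Df.
by apply: class_CM => //; [exact: class_C_cst|exact: class_CM].
Qed.

Lemma smooth_onM U f g : open U -> smooth_on U f -> smooth_on U g ->
  smooth_on U (fun x => f x * g x : R^o).
Proof.
by move=> oU /smooth_onP sf /smooth_onP sg; apply/smooth_onP => k; exact: class_CM.
Qed.

Lemma smooth_onV U f : open U -> (forall x, U x -> f x != 0) -> smooth_on U f ->
  smooth_on U (fun x => (f x)^-1 : R^o).
Proof.
by move=> oU f0 /smooth_onP sf; apply/smooth_onP => k; exact: class_CV.
Qed.

Lemma smooth_on_prod (I : Type) (r : seq I) U (f : I -> E -> R^o) : open U ->
  (forall i, smooth_on U (f i)) -> smooth_on U (fun x => \prod_(i <- r) f i x : R^o).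
Proof.
move=> oU sf; elim: r => [|i r IH].
  apply: (@smooth_on_eq _ _ _ _ (cst (1 : R^o))) => //; last exact: smooth_on_cst.
  by move=> x _; rewrite big_nil.
apply: (@smooth_on_eq _ _ _ _ (fun x => f i x * \prod_(j <- r) f j x : R^o)).
- exact: oU.
- by move=> x _; rewrite big_cons.
- exact: smooth_onM oU (sf i) IH.
Qed.

End ClassCReal.

(** * One-variable calculus along a line *)

Section Line.
Variables (R : realType) (E : normedModType R).
Implicit Types (f : E -> R^o) (x v : E).

Lemma derive_line f x v (s : R) :
  'D_1 (fun h : R => f (h *: v + x) : R^o) s = 'D_v f (s *: v + x) /\
  (derivable (fun h : R => f (h *: v + x) : R^o) s 1 <-> derivable f (s *: v + x) v).
Proof.
rewrite /derive /derivable /=.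
have -> : (fun h : R => h^-1 *: (f ((h *: 1 + s) *: v + x) - f (s *: v + x)) : R^o)
  = (fun h : R => h^-1 *: (f (h *: v + (s *: v + x)) - f (s *: v + x)) : R^o).
  apply/funext => h; congr (_ *: (f _ - _)).
  by rewrite [_ *: 1]mulr1 scalerDl addrA.
by split.
Qed.

(** Only derivability along [v] is assumed, so no linear differential is at hand: the step [h] along
    [c *: v] is the step [h * c] along [v]. *)
Lemma derive_scale f x v (c : R) : derivable f x v -> 'D_(c *: v) f x = c * 'D_v f x.
Proof.
have [->|c0] := eqVneq c 0; first by rewrite scale0r derive0 mul0r.
move=> dv; apply: cvg_lim => //; apply/cvgrPdist_le => /= e e0.
have ec0 : 0 < e / `|c| by rewrite divr_gt0// normr_gt0.
have /cvgrPdist_le /(_ _ ec0) [/= d d0 H] := dv.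
exists (d / `|c|); first by rewrite /= divr_gt0// normr_gt0.
move=> h /=; rewrite sub0r normrN => hd h0.
have := H (h * c); rewrite /= sub0r normrN normrM mulf_neq0//.
rewrite -ltr_pdivlMr ?normr_gt0// => /(_ hd isT).
rewrite -scalerA ler_pdivlMr ?normr_gt0// mulrC -normrM mulrBr.
rewrite [X in c * 'D_v f x - X](_ : _ = h^-1 *: (f (h *: (c *: v) + x) - f x))//.
rewrite -[(h * c)^-1 *: _]/((h * c)^-1 * _) -[h^-1 *: _]/(h^-1 * _).
by rewrite invfM mulrA [c * _]mulrCA divff// mulr1.
Qed.

Lemma MVT_line f x v :
  (forall s, 0 <= s <= 1 -> derivable f (s *: v + x) v) ->
  exists2 s, 0 <= s <= 1 & f (v + x) - f x = 'D_v f (s *: v + x).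
Proof.
move=> df; set phi := fun h : R => f (h *: v + x) : R^o.
have dphi s : 0 <= s <= 1 -> derivable phi s 1.
  by move=> /df dfs; apply/(derive_line f x v s).2.
have [||s s01] := @MVT_segment R phi (fun s => 'D_1 phi s) 0 1 ler01.
- move=> s; rewrite in_itv /= => /andP[s0 s1].
  by apply: derivableP; apply: dphi; rewrite !ltW.
- apply: derivable_within_continuous => s; rewrite in_itv /=; exact: dphi.
rewrite /phi scale1r scale0r add0r subr0 mulr1 => ->.
by exists s; [move: s01; rewrite in_itv|rewrite (derive_line f x v s).1].
Qed.

End Line.

(** * Strict differentiability from continuous partial derivatives *)

Section Strict.
Variables (R : realType) (n : nat).
Implicit Types (f : 'rV[R]_n -> R^o) (x v y : 'rV[R]_n) (U : set 'rV[R]_n).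

Lemma ltr_convex (s a b u : R) : 0 <= s <= 1 -> a < u -> b < u -> s * (a - b) + b < u.
Proof. by move=> /andP[s0 s1] au bu; case: (lerP a b) => ab; nra. Qed.

Lemma ball_convex (a b y0 : R) (s d : R) : 0 <= s <= 1 ->
  ball y0 d a -> ball y0 d b -> ball y0 d (s * (a - b) + b).
Proof.
move=> s01; rewrite -ball_normE /ball_ /= !ltr_norml => /andP[a1 a2] /andP[b1 b2].
have := @ltr_convex s a b (y0 + d) s01; have := @ltr_convex s (- a) (- b) (d - y0) s01.
have -> : s * (- a - - b) + - b = - (s * (a - b) + b) by ring.
set w := s * (a - b) + b; move=> H1 H2.
have h1 : - w < d - y0 by apply: H1; lra.
have h2 : w < y0 + d by apply: H2; lra.
by apply/andP; split; lra.
Qed.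

(* Telescoping from [b] to [a] one coordinate at a time. *)
Lemma strict_diff U f y0 : open U -> U y0 -> class_C 1 U f -> forall e : R, 0 < e ->
  exists2 d : R, 0 < d & forall a b, ball y0 d a -> ball y0 d b ->
    `|f a - f b - \sum_i (a - b) 0 i * 'D_(delta_mx 0 i) f y0| <= e * `|a - b|.
Proof.
move=> oU Uy0 [_ [df Df]] e e0.
(* The tolerance is shared among the [n] coordinates; the successor keeps the quotient positive when
   [n = 0]. *)
have en0 : 0 < e / n.+1%:R by rewrite divr_gt0.
have : \forall z \near y0, U z /\
    forall i, `|'D_(delta_mx 0 i) f y0 - 'D_(delta_mx 0 i) f z| <= e / n.+1%:R.
  near=> z; split; first by near: z; exact: open_nbhs_nbhs.
  near: z; apply: filter_forall => i.
  have [c _] := Df (delta_mx 0 i); have /cvgrPdist_le := c y0 Uy0.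
  by move/(_ _ en0).
move=> /nbhs_ballP[d /= d0 H]; exists d => // a b ya yb.
pose z k : 'rV[R]_n := \row_j (if (j < k)%N then a 0 j else b 0 j).
have z0 : z 0%N = b by apply/rowP => j; rewrite mxE.
have zn : z n = a by apply/rowP => j; rewrite mxE ltn_ord.
have -> : f a - f b = \sum_(k < n) (f (z k.+1) - f (z k)).
  by rewrite -{1}zn -z0 -(big_mkord xpredT (fun k => f (z k.+1) - f (z k))) telescope_sumr.
rewrite -sumrB; apply: le_trans (ler_norm_sum _ _ _) _.
apply: (@le_trans _ _ (\sum_(k < n) (e / n.+1%:R * `|a - b|))); last first.
  rewrite sumr_const card_ord -[X in X <= _]mulr_natr mulrAC ler_wpM2r//.
  by rewrite -mulrA ler_piMr ?(ltW e0)// mulrC ler_pdivrMr// mul1r ler_nat.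
apply: ler_sum => k _.
set c := (a - b) 0 k.
have zk : z k.+1 = c *: delta_mx 0 k + z k.
  apply/rowP => j; rewrite !mxE ltnS eqxx /=; case: (ltngtP j k) => jk.
  - by rewrite (_ : (j == k) = false) ?mulr0 ?add0r//; apply/negbTE; rewrite neq_ltn jk.
  - by rewrite (_ : (j == k) = false) ?mulr0 ?add0r//; apply/negbTE; rewrite neq_ltn jk orbT.
  - by rewrite (val_inj jk) eqxx mulr1 /c !mxE subrK.
have bz s : 0 <= s <= 1 -> ball y0 d (s *: (c *: delta_mx 0 k) + z k).
  move=> s01; split=> // i j; rewrite !ord1 !mxE eqxx /=.
  case: eqVneq => [->|jk].
    rewrite ltnn /= mulr1 /c !mxE; apply: ball_convex s01 _ _; [exact: ya.2|exact: yb.2].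
  by rewrite !mulr0 add0r; case: ifP => _; [exact: ya.2|exact: yb.2].
rewrite zk; have [|s s01 ->] := @MVT_line R _ f (z k) (c *: delta_mx 0 k).
  by move=> s /bz/H[Us _]; exact: df.
have [Us Ds] := H _ (bz _ s01).
rewrite (derive_scale c (df _ (delta_mx 0 k) Us)).
rewrite (_ : `|_ - _| = `|c * ('D_(delta_mx 0 k) f (s *: (c *: delta_mx 0 k) + z k) -
   'D_(delta_mx 0 k) f y0)|); last by congr (`|_|); rewrite [RHS]mulrBr.
rewrite normrM mulrC ler_pM//.
  by rewrite distrC; exact: Ds.
rewrite [leRHS]/Num.norm/= mx_normrE.
by apply: le_trans (le_bigmax _ _ (0, k)); rewrite /= /c.
Unshelve. all: by end_near. Qed.

End Strict.

Section ChainRule.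
Variables (R : realType) (E : normedModType R) (n : nat).
Implicit Types (g : E -> 'rV[R]_n) (f : 'rV[R]_n -> R^o).

(** The inner map has a derivative along one direction only. Strict differentiability of [f] at
    [g x] replaces increments of [f] by the linear form [L] applied to increments of [g], and the
    difference quotient of [g] does the rest. *)
Lemma chain_rule (V : set 'rV[R]_n) f g x v : open V -> V (g x) -> class_C 1 V f ->
  derivable g x v ->
  is_derive x v (f \o g : E -> R^o)
    (\sum_i ('D_v g x) 0 i * 'D_(delta_mx 0 i) f (g x)).
Proof.
move=> oV Vgx Cf dg.
suff H : (h^-1 *: ((f \o g) (h *: v + x) - (f \o g) x) : R^o) @[h --> 0^'] -->
    (\sum_i ('D_v g x) 0 i * 'D_(delta_mx 0 i) f (g x) : R^o).
  by split; [apply/cvg_ex; eexists; exact: H|exact: cvg_lim H].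
apply/cvgrPdist_le => /= e e0.
pose D := 'D_v g x; pose L (w : 'rV[R]_n) := \sum_i w 0 i * 'D_(delta_mx 0 i) f (g x).
pose K := \sum_i `|'D_(delta_mx 0 i) f (g x)|.
have LB w w' : L w - L w' = L (w - w').
  by rewrite -sumrB; apply: eq_bigr => i _; rewrite !mxE [RHS]mulrBl.
have LK w : `|L w| <= K * `|w|.
  apply: le_trans (ler_norm_sum _ _ _) _; rewrite mulr_suml; apply: ler_sum => i _.
  rewrite normrM mulrC ler_wpM2l// [leRHS]/Num.norm/= mx_normrE.
  by apply: le_trans (le_bigmax _ _ (0, i)).
have LZ h w : L (h *: w) = h * L w.
  by rewrite mulr_sumr; apply: eq_bigr => i _; rewrite !mxE [RHS]mulrA.
have K0 : 0 <= K by apply: sumr_ge0.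
have D1 : 0 < `|D| + 1 by rewrite ltr_wpDl.
have e'0 : 0 < e / 2 / (`|D| + 1) by rewrite !divr_gt0.
have [d d0 Hd] := strict_diff oV Vgx Cf e'0.
(* The bound 1 keeps the difference quotient [q] of norm at most [|D| + 1], which controls the error
   of [f]; the other bound makes [L (D - q)] at most [e / 2]. *)
have m0 : 0 < Num.min 1 (e / 2 / (K + 1)).
  by rewrite lt_min ltr01 !divr_gt0// ltr_wpDl.
have gc : {for 0, continuous (fun h : R => g (h *: v + x))}.
  exact/differentiable_continuous/derivable1_diffP/(derivable1P _ _ _).1.
have {gc} nb : \forall h \near 0^', ball (g x) d (g (h *: v + x)).
  apply: cvg_within; move: gc; rewrite /prop_for/continuous_at scale0r add0r.
  by move/(_ (ball (g x) d)); apply; exact: nbhsx_ballx.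
have nD : \forall h \near 0^', `|D - h^-1 *: (g (h *: v + x) - g x)| <=
    Num.min 1 (e / 2 / (K + 1)).
  have /cvgrPdist_le := dg; exact.
near=> h.
have h0 : h != 0 by near: h; exact: nbhs_dnbhs_neq.
have bh : ball (g x) d (g (h *: v + x)) by near: h.
have : `|D - h^-1 *: (g (h *: v + x) - g x)| <= Num.min 1 (e / 2 / (K + 1)).
  by near: h; exact: nD.
pose q := h^-1 *: (g (h *: v + x) - g x); rewrite -/q le_min => /andP[Dq1 Dq2].
have := Hd _ _ bh (ballxx _ d0); rewrite -/(L (g (h *: v + x) - g x)) => He.
have -> : \sum_i ('D_v g x) 0 i * 'D_(delta_mx 0 i) f (g x) = L D by [].
set A := f (g (h *: v + x)) - f (g x) in He.
have -> : L D - h^-1 *: A = L (D - q) - h^-1 * (A - L (g (h *: v + x) - g x)).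
  by rewrite -(LB D q) /q LZ -[h^-1 *: A]/(h^-1 * A); ring.
apply: le_trans (ler_normB _ _) _; rewrite [leRHS]splitr; apply: lerD.
  apply: le_trans (LK _) _; apply: (@le_trans _ _ ((K + 1) * `|D - q|)).
    by rewrite ler_wpM2r// lerDl.
  by rewrite mulrC -ler_pdivlMr// ltr_wpDl.
rewrite normrM; apply: (@le_trans _ _ (e / 2 / (`|D| + 1) * `|q|)).
  by rewrite /q normrZ mulrCA ler_wpM2l.
rewrite -ler_pdivlMl// invf_div divfK//; last by rewrite gt_eqF// divr_gt0.
by rewrite -lerBlDl; apply: le_trans Dq1; rewrite distrC; exact: lerB_dist.
Unshelve. all: by end_near. Qed.

End ChainRule.

Section Coordinates.
Variables (R : realType) (E : normedModType R).
Implicit Types (U : set E).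

Lemma class_C_sum (I : Type) (r : seq I) k U (f : I -> E -> R^o) : open U ->
  (forall i, class_C k U (f i)) -> class_C k U (fun x => \sum_(i <- r) f i x : R^o).
Proof.
move=> oU sf; elim: r => [|i r IH].
  rewrite (_ : (fun _ => _) = cst 0); first exact: class_C_cst.
  by apply/funext => x; rewrite big_nil.
rewrite (_ : (fun _ => _) = fun x => f i x + \sum_(j <- r) f j x).
  exact: class_CD oU (sf i) IH.
by apply/funext => x; rewrite big_cons.
Qed.

Lemma derivable_coord n (g : E -> 'rV[R]_n) x v i : derivable g x v ->
  derivable (fun y => g y 0 i : R^o) x v.
Proof. by move=> /derivable_mxP; apply. Qed.

Lemma derive_coord n (g : E -> 'rV[R]_n) x v i : derivable g x v ->
  'D_v (fun y => g y 0 i : R^o) x = ('D_v g x) 0 i.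
Proof. by move=> /derive_mx ->; rewrite mxE. Qed.

Lemma class_C_coord n k U (g : E -> 'rV[R]_n) i : open U ->
  class_C k U g -> class_C k U (fun x => g x 0 i : R^o).
Proof.
move=> oU; elim: k g => [|k IH] g [cg Cg]; split=> //.
- move=> x Ux; apply: (@continuous_comp _ _ _ g (fun M : 'rV[R]_n => M 0 i : R^o)).
    exact: cg.
  exact: coord_continuous.
- move=> x Ux; apply: (@continuous_comp _ _ _ g (fun M : 'rV[R]_n => M 0 i : R^o)).
    exact: cg.
  exact: coord_continuous.
case: Cg => dg Dg; split=> [x v Ux|v]; first by apply: derivable_coord; exact: dg.
apply: (class_C_eq oU _ (IH _ (Dg v))) => x Ux.
by rewrite derive_coord//; exact: dg.
Qed.

Lemma class_C_comp n k U (V : set 'rV[R]_n) (g : E -> 'rV[R]_n) (f : 'rV[R]_n -> R^o) :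
  open U -> open V -> (forall x, U x -> V (g x)) ->
  class_C k U g -> class_C k V f -> class_C k U (f \o g).
Proof.
move=> oU oV UV; elim: k f g UV => [|k IH] f g UV Cg Cf; split=> //.
- move=> x Ux; apply: continuous_comp; first exact: class_C_continuous Cg Ux.
  exact: class_C_continuous Cf (UV _ Ux).
- move=> x Ux; apply: continuous_comp; first exact: class_C_continuous Cg Ux.
  exact: class_C_continuous Cf (UV _ Ux).
have Cf1 := class_CS1 Cf.
have cr x v : U x -> _ := fun Ux => chain_rule oV (UV x Ux) Cf1 ((proj1 (proj2 Cg)) x v Ux).
split=> [x v Ux|v]; first by have [] := cr x v Ux.
have C' : class_C k U (fun x =>
    \sum_i ('D_v g x) 0 i * 'D_(delta_mx 0 i) f (g x) : R^o).
  apply: class_C_sum => // i; apply: class_CM => //.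
    by apply: class_C_coord => //; exact: Cg.2.2.
  exact: (IH ('D_(delta_mx 0 i) f) g UV (class_CW Cg) (Cf.2.2 _)).
by apply: (class_C_eq oU _ C') => x Ux; have [_ ->] := cr x v Ux.
Qed.

Lemma smooth_on_coord n U (g : E -> 'rV[R]_n) i : open U ->
  smooth_on U g -> smooth_on U (fun x => g x 0 i : R^o).
Proof. by move=> oU /smooth_onP sg; apply/smooth_onP => k; exact: class_C_coord. Qed.

Lemma smooth_on_comp n U (V : set 'rV[R]_n) (g : E -> 'rV[R]_n) (f : 'rV[R]_n -> R^o) :
  open U -> open V -> (forall x, U x -> V (g x)) ->
  smooth_on U g -> smooth_on V f -> smooth_on U (f \o g).
Proof.
move=> oU oV UV /smooth_onP sg /smooth_onP sf; apply/smooth_onP => k.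
exact: (class_C_comp oU oV UV (sg k) (sf k)).
Qed.

Lemma smooth_on_chain n (V : set 'rV[R]_n) (f : 'rV[R]_n -> R^o) (g : E -> 'rV[R]_n) x v :
  open V -> V (g x) -> smooth_on V f -> derivable g x v ->
  'D_v (f \o g : E -> R^o) x = \sum_i ('D_v g x) 0 i * 'D_(delta_mx 0 i) f (g x).
Proof.
by move=> oV Vg /smooth_onP sf dg; have [_ ->] := chain_rule oV Vg (sf 1%N) dg.
Qed.

End Coordinates.

Lemma smooth_on_linear (R : realType) n (l : 'I_n) (U : set 'rV[R]_n) :
  open U -> smooth_on U (fun y => y 0 l : R^o).
Proof.
move=> oU; apply/smooth_onP; case=> [|k]; split=> //.
- by move=> x _; exact: coord_continuous.
- by move=> x _; exact: coord_continuous.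
have dl x v : is_derive x v (fun y : 'rV[R]_n => y 0 l : R^o) (v 0 l).
  by split; [apply: derivable_coord|rewrite derive_coord// derive_id].
split=> [x v _|v]; first by have [] := dl x v.
apply: (@class_C_eq _ _ _ _ _ (cst (v 0 l : R^o))) => //; last exact: class_C_cst.
by move=> x _; have [_ ->] := dl x v.
Qed.

Lemma derive_coordE (R : realType) n (l : 'I_n) (x v : 'rV[R]_n) :
  'D_v (fun y : 'rV[R]_n => y 0 l : R^o) x = v 0 l.
Proof. by rewrite derive_coord// derive_id. Qed.

(** * Bump functions and Hadamard's lemma *)

Lemma is_derive_outer (R : realType) (E : normedModType R) (phi : R -> R) (u : E -> R^o)
    x v (a : R) :
  is_derive (u x : R) 1 phi a -> derivable u x v ->
  is_derive x v (fun y => phi (u y) : R^o) (a * 'D_v u x : R).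
Proof.
move=> dphi du; pose w (h : R) : R := u (h *: v + x).
have w0 : w 0 = u x by rewrite /w scale0r add0r.
have [e1 e2] := derive_line u x v 0.
have [e3 e4] := derive_line (fun y => phi (u y) : R^o) x v 0.
move: e1 e2 e3 e4; rewrite !scale0r !add0r => e1 e2 e3 e4.
have dw : derivable (w : R -> R^o) 0 1 by apply/e2.
have dw' : is_derive (0 : R) 1 w ('D_v u x : R) by split; [exact: dw|exact: e1].
rewrite -w0 in dphi; have [d1 d2] := is_derive1_comp dphi dw'.
by split; [apply/e4; exact: d1|rewrite -e3; exact: d2].
Qed.

(** * Functions flat at the origin and cutoffs *)

Section Flat.
Variable R : realType.

(** For a bump only [k = 0], that is exp(-1/x), is needed; the powers of 1/x make the family stable
    under differentiation, up to linear combinations. *)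
Definition flat (k : nat) (x : R) : R :=
  if 0 < x then x^-1 ^+ k * expR (- x^-1) else 0.

Lemma flat_ge0 k x : 0 <= flat k x.
Proof.
rewrite /flat; case: ifP => // x0.
by rewrite mulr_ge0 ?expR_ge0// exprn_ge0// invr_ge0 ltW.
Qed.

Lemma flat_gt0 x : 0 < x -> 0 < flat 0 x.
Proof. by move=> x0; rewrite /flat x0 expr0 mul1r expR_gt0. Qed.

(** The exponential of 1/x exceeds the term of degree [k.+1] of its series. This linear bound gives
    the derivative 0 at the origin. *)
Lemma flat_le (k : nat) (x : R) : flat k x <= k.+1`!%:R * `|x|.
Proof.
rewrite /flat; case: ifPn => [x0|_]; last by rewrite mulr_ge0.
have ix0 : 0 <= x^-1 by rewrite invr_ge0 ltW.
rewrite expRN ler_pdivrMr ?expR_gt0// (gtr0_norm x0) -mulrA -ler_pdivrMl// ?ltr0n ?fact_gt0//.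
have H := expR_ge1Dxn k ix0.
apply: (@le_trans _ _ (x * (x^-1 ^+ k.+1 / k.+1`!%:R))); last first.
  by rewrite ler_pM2l//; apply: le_trans H; rewrite lerDr.
by rewrite exprS mulrC -!mulrA mulVKf ?gt_eqF.
Qed.

Lemma is_derive_flat (k : nat) (x : R) :
  is_derive x 1 (flat k) (flat k.+2 x - k%:R * flat k.+1 x).
Proof.
case: (ltrgtP 0 x) => [x0|x0|<-].
- apply: (@near_eq_is_derive R R R (fun y => y^-1 ^+ k * expR (- y^-1))).
    near=> y; rewrite /flat ifT//; near: y; exact: lt_nbhsr.
  have xn0 : x != 0 by rewrite gt_eqF.
  have d1 : is_derive x 1 (fun y : R => y^-1) (- x ^- 2).
    apply: is_derive_eq; first exact: is_deriveV.
    by rewrite [_ *: _]mulr1.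
  have d2 : is_derive x 1 (fun y : R => expR (- y^-1)) (expR (- x^-1) * x ^- 2).
    have := @is_derive1_comp _ expR (fun y : R => - y^-1) x _ _ (is_derive_expR _).
    by apply; apply: is_derive_eq; rewrite opprK.
  have e : (fun y : R => y^-1 ^+ k * expR (- y^-1)) =
      (fun y : R => y^-1) ^+ k * (fun y : R => expR (- y^-1)).
    by apply/funext => y; rewrite exprfctE.
  rewrite e; apply: (is_derive_eq (is_deriveM (is_deriveX k d1) d2)).
  clear e; rewrite /flat x0 exprfctE /GRing.scale /= -exprVn; set z := x^-1.
  by case: k => [|k]; rewrite ?exprS /=; ring.
- apply: (@near_eq_is_derive R R R (cst 0)).
    near=> y; rewrite /flat ifF//; apply/negbTE; rewrite -leNgt; apply/ltW.
    by near: y; exact: lt_nbhsl.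
  rewrite /flat ltNge (ltW x0) /= mulr0 subr0; exact: is_derive_cst.
- have f0 j : flat j 0 = 0 by rewrite /flat ltxx.
  rewrite !f0 mulr0 subr0.
  suff H : (h^-1 *: (flat k (h *: 1 + 0) - flat k 0) : R) @[h --> 0^'] --> (0 : R).
    by split; [apply/cvg_ex; eexists; exact: H|exact: cvg_lim H].
  apply/cvgrPdist_le => /= e e0.
  exists (e / k.+2`!%:R); first by rewrite /= divr_gt0// ltr0n fact_gt0.
  move=> h /=; rewrite sub0r normrN => he h0.
  rewrite f0 subr0 addr0 sub0r normrN [h *: 1]mulr1.
  (* At 0 the difference quotient belongs to the family again, so the linear bound makes it tend to
     0. *)
  have -> : h^-1 *: flat k h = flat k.+1 h.
    rewrite /flat; case: ifP => _; last by rewrite scaler0.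
    by rewrite exprS -mulrA.
  rewrite ger0_norm ?flat_ge0//; apply: le_trans (flat_le _ _) _.
  by rewrite mulrC -ler_pdivlMr ?ltr0n ?fact_gt0// ltW.
Unshelve. all: by end_near. Qed.

Lemma class_C_flat (E : normedModType R) (U : set E) (u : E -> R^o) j k :
  open U -> class_C j U u -> class_C j U (fun x => flat k (u x) : R^o).
Proof.
move=> oU; elim: j k => [|j IH] k Cu; split=> //.
- move=> x Ux; apply: continuous_comp; first exact: class_C_continuous Cu Ux.
  by apply/differentiable_continuous/derivable1_diffP; have [] := is_derive_flat k (u x).
- move=> x Ux; apply: continuous_comp; first exact: class_C_continuous Cu Ux.
  by apply/differentiable_continuous/derivable1_diffP; have [] := is_derive_flat k (u x).
have d x v (Ux : U x) := is_derive_outer (is_derive_flat k (u x)) (Cu.2.1 x v Ux).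
split=> [x v Ux|v]; first by have [] := d x v Ux.
have Cuj := class_CW Cu.
have C' : class_C j U (fun x => (flat k.+2 (u x) + (- k%:R) * flat k.+1 (u x)) * 'D_v u x : R^o).
  apply: class_CM => //; last exact: Cu.2.2.
  apply: class_CD => //; first exact: IH.
  apply: class_CM => //; [exact: class_C_cst|exact: IH].
by apply: (class_C_eq oU _ C') => x Ux; have [_ ->] := d x v Ux; rewrite mulNr.
Qed.

Lemma smooth_on_flat (E : normedModType R) (U : set E) (u : E -> R^o) k :
  open U -> smooth_on U u -> smooth_on U (fun x => flat k (u x) : R^o).
Proof. by move=> oU /smooth_onP su; apply/smooth_onP => j; exact: class_C_flat. Qed.

End Flat.

(** Balls of row vectors are cubes, so a product of one-variable cutoffs [p / (p + q)] is adapted to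
    them. The numerator [p] vanishes where the squared distance [u] is at least [r * r], and [q]
    where it is at most [(r / 2) ^ 2]; the two never vanish together. *)
Lemma smooth_bump (R : realType) (n : nat) (y0 : 'rV[R]_n) (r : R) : 0 < r ->
  exists b : 'rV[R]_n -> R^o, [/\ smooth_on setT b, (forall y, 0 <= b y <= 1),
    (forall y, ball y0 (r / 2) y -> b y = 1) & (forall y, b y != 0 -> ball y0 r y)].
Proof.
move=> r0; pose u i (y : 'rV[R]_n) : R^o := (y 0 i - y0 0 i) * (y 0 i - y0 0 i).
pose p i (y : 'rV[R]_n) : R^o := flat 0 (r * r + -1 * u i y).
pose q i (y : 'rV[R]_n) : R^o := flat 0 (u i y + - (r / 2 * (r / 2))).
have pq i y : 0 < p i y + q i y.
  case: (ltP (u i y) (r * r)) => h; last first.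
    rewrite ltr_wpDl ?flat_ge0// flat_gt0//; nra.
  by rewrite ltr_pwDl ?flat_ge0// flat_gt0//; lra.
have oT := @openT 'rV[R]_n.
have su i : smooth_on setT (u i).
  have s1 : smooth_on setT (fun y : 'rV[R]_n => y 0 i + - y0 0 i : R^o).
    by apply: smooth_onD => //; [exact: smooth_on_linear|exact: smooth_on_cst].
  exact: smooth_onM.
have sp i : smooth_on setT (p i).
  apply: smooth_on_flat => //; apply: smooth_onD => //; first exact: smooth_on_cst.
  by apply: smooth_onM => //; exact: smooth_on_cst.
have sq i : smooth_on setT (q i).
  by apply: smooth_on_flat => //; apply: smooth_onD => //; exact: smooth_on_cst.
pose s i (y : 'rV[R]_n) : R^o := p i y * (p i y + q i y)^-1.
have ss i : smooth_on setT (s i).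
  apply: smooth_onM => //; apply: smooth_onV => //; last exact: smooth_onD.
  by move=> y _; rewrite gt_eqF.
have s0 i y : 0 <= s i y by rewrite mulr_ge0 ?flat_ge0// invr_ge0 ltW.
exists (fun y => \prod_i s i y); split.
- exact: smooth_on_prod.
- move=> y; rewrite prodr_ge0//= prodr_ile1// => i _; rewrite s0/=.
  by rewrite ler_pdivrMr// mul1r lerDl flat_ge0.
- move=> y yr; rewrite big1// => i _.
  have : `|y0 0 i - y 0 i| < r / 2 by have := yr.2 0 i; rewrite -ball_normE.
  rewrite ltr_norml => /andP[h1 h2].
  have qi : q i y = 0.
    rewrite /q /flat ifF//; apply/negbTE; rewrite -leNgt /u; nra.
  by rewrite /s qi addr0 divff// gt_eqF//; have := pq i y; rewrite qi addr0.
- move=> y bn; split=> // i j; rewrite ord1 -ball_normE /ball_ /=.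
  have : s j y != 0.
    by apply: contra bn => /eqP sj; rewrite (bigD1 j)//= sj mul0r.
  rewrite /s mulf_eq0 negb_or => /andP[pj _].
  have : 0 < r * r + -1 * u j y.
    by move: pj; rewrite /p /flat; case: ifP => //; rewrite eqxx.
  rewrite /u ltr_norml => h; apply/andP; split; nra.
Qed.

(** * Averages over the unit interval *)

Section Mean.
Variable R : realType.
Implicit Types u w : R -> R.

Definition mean u : R := \int[@lebesgue_measure R]_(t in `[0, 1]) u t.

Lemma mean_integrable u : continuous u ->
  (@lebesgue_measure R).-integrable `[0, 1] (EFin \o u).
Proof.
move=> cu; apply: continuous_compact_integrable; first exact: segment_compact.
exact: continuous_subspaceT.
Qed.

Lemma meanB u w : continuous u -> continuous w ->
  mean u - mean w = mean (fun t => u t - w t).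
Proof. by move=> cu cw; rewrite /mean RintegralB//; exact: mean_integrable. Qed.

Lemma meanD u w : continuous u -> continuous w ->
  mean (fun t => u t + w t) = mean u + mean w.
Proof. by move=> cu cw; rewrite /mean RintegralD//; exact: mean_integrable. Qed.

Lemma meanZ (a : R) u : continuous u -> mean (fun t => a * u t) = a * mean u.
Proof. by move=> cu; rewrite /mean RintegralZl//; exact: mean_integrable. Qed.

Lemma mean_sum n (a : 'I_n -> R -> R) : (forall i, continuous (a i)) ->
  mean (fun t => \sum_i a i t) = \sum_i mean (a i).
Proof.
move=> ca; pose P (f : R -> R) (x : R) := continuous f /\ mean f = x.
suff : P (fun t => \sum_i a i t) (\sum_i mean (a i)) by case.
elim: (index_enum _) => [|i r [IH1 IH2]].
  rewrite big_nil (_ : (fun _ => _) = cst 0); last first.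
    by apply/funext => t; rewrite big_nil.
  by split; [exact: cst_continuous|rewrite /mean Rintegral_cst// mul0r].
rewrite big_cons (_ : (fun _ => _) = fun t => a i t + \sum_(j <- r) a j t); last first.
  by apply/funext => t; rewrite big_cons.
split; last by rewrite meanD// IH2.
by move=> t; apply: continuousD; [exact: ca|exact: IH1].
Qed.

Lemma mean_le u (e : R) : continuous u -> (forall t, 0 <= t <= 1 -> `|u t| <= e) ->
  `|mean u| <= e.
Proof.
move=> cu ue; have iu := mean_integrable cu.
apply: le_trans (le_normr_Rintegral _ iu) _ => //.
have -> : e = \int[@lebesgue_measure R]_(t in `[0, 1]) (cst e t).
  rewrite Rintegral_cst//= lebesgue_measure_itv /= lte01 /=.
  by rewrite subr0 mulr1.
apply: le_Rintegral => //.
- by apply: mean_integrable => t; apply: continuous_comp; [exact: cu|exact: norm_continuous].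
- by apply: mean_integrable => t; exact: cst_continuous.
Qed.

Lemma mean_FTC (F u : R -> R) : continuous u -> (forall t : R, is_derive t 1 F (u t)) ->
  mean u = F 1 - F 0.
Proof.
move=> cu dF; rewrite /mean /Rintegral.
rewrite (@continuous_FTC2 _ u F)//.
- exact: continuous_subspaceT.
- have cF t : {for t, continuous F}.
    by apply/differentiable_continuous/derivable1_diffP; have [] := dF t.
  split; first by move=> t _; have [] := dF t.
  - by apply: cvg_at_right_filter; exact: cF.
  - by apply: cvg_at_left_filter; exact: cF.
- by move=> t _; rewrite derive1E; have [_ ->] := dF t.
Qed.

End Mean.

(** * Averages along homotheties and Hadamard's lemma *)

Section Hadamard.
Variables (R : realType) (n : nat) (y0 : 'rV[R]_n).
Implicit Types (h : 'rV[R]_n -> R^o) (y v : 'rV[R]_n).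

Let P (t : R) y := t *: (y - y0) + y0.

Lemma homothety_continuous h t y : continuous h ->
  {for (t, y), continuous (fun z : R * 'rV[R]_n => h (z.1 *: (z.2 - y0) + y0))}.
Proof.
move=> ch; apply: continuous_comp; last exact: ch.
apply: cvgD; last exact: cvg_cst.
apply: cvgZ; first exact: cvg_fst.
by apply: cvgB; [exact: cvg_snd|exact: cvg_cst].
Qed.

(** Joint continuity in [t] and [y] gives a neighborhood of [y] for each [t]; compactness of the
    unit interval makes it independent of [t]. *)
Lemma homothety_unif h y (e : R) : continuous h -> 0 < e ->
  \forall y' \near y, forall t, 0 <= t <= 1 -> `|h (P t y) - h (P t y')| <= e.
Proof.
move=> ch e0.
have /compact_near_coveringP := @segment_compact R 0 1.
move=> /(_ _ (nbhs y) (fun y' t => `|h (P t y) - h (P t y')| <= e) _) NC.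
apply: (filterS _ (NC _)) => [y' H t t01|t _]; first by apply: H; rewrite /= in_itv.
have e20 : 0 < e / 2 by rewrite divr_gt0.
have /cvgrPdist_le /(_ _ e20) [[A B] /= [nA nB] AB] := homothety_continuous (t := t) (y := y) ch.
exists (A, B) => //= -[t' y'] [/= At' By'].
have h1 := AB (t', y') (conj At' By').
have h2 := AB (t', y) (conj At' (nbhs_singleton nB)).
move: h1 h2; rewrite /= -!/(P _ _) => h1 h2.
rewrite -(subrKA (h (P t y))) (splitr e); apply: le_trans (ler_normD _ _) _.
by apply: lerD => //; rewrite distrC.
Qed.

(** Differentiation under the integral produces a factor [t] each time; the weight [t ^+ k] absorbs
    it, so that the family is stable under derivatives. *)
Definition homothety_mean k h y : R^o := mean (fun t => t ^+ k * h (P t y)).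

Lemma homothety_integrand_continuous k h y : continuous h ->
  continuous (fun t : R => t ^+ k * h (P t y) : R).
Proof.
move=> ch t; apply: cvgM; first exact: exprn_continuous.
apply: continuous_comp; last exact: ch.
by apply: cvgD; [apply: cvgZr_tmp; exact: cvg_id|exact: cvg_cst].
Qed.

Lemma homothety_mean_continuous k h : continuous h -> continuous (homothety_mean k h).
Proof.
move=> ch y; apply/(@cvgrPdist_le _ R^o _ (nbhs y) (nbhs_filter y)) => e e0.
apply: filterS (homothety_unif y ch e0) => y' H; rewrite /homothety_mean meanB; last 2 first.
- exact: homothety_integrand_continuous.
- exact: homothety_integrand_continuous.
apply: mean_le.
  by move=> t; apply: cvgB; exact: homothety_integrand_continuous.
move=> t t01; rewrite -mulrBr normrM; apply: (@le_trans _ _ (1 * e)); last by rewrite mul1r.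
apply: ler_pM => //; last exact: H.
by move/andP: t01 => [t0 t1]; rewrite ger0_norm ?exprn_ge0// exprn_ile1.
Qed.

(** Differentiation under the integral sign: by the mean value theorem the difference quotient of
    the integrand is its derivative at a nearby point, and [homothety_unif] bounds the discrepancy
    uniformly in [t]. *)
Lemma homothety_mean_derive k h y v : class_C 1 setT h ->
  is_derive y v (homothety_mean k h) (homothety_mean k.+1 ('D_v h) y).
Proof.
move=> [ch [dh Dh]].
have {}ch : continuous h by move=> x; exact: ch.
have cD : continuous ('D_v h) by move=> x; exact: (Dh v).1.
suff H : (s^-1 *: (homothety_mean k h (s *: v + y) - homothety_mean k h y) : R^o) @[s --> 0^'] -->
    (homothety_mean k.+1 ('D_v h) y : R^o).
  by split; [apply/cvg_ex; eexists; exact: H|exact: cvg_lim H].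
apply/cvgrPdist_le => e e0.
have /nbhs_ballP[d /= d0 Hd] := homothety_unif y cD e0.
have v10 : 0 < `|v| + 1 by rewrite ltr_wpDl.
(* Keeps every intermediate point [(c * s) *: v + y] in the ball of radius [d]; the summand 1 covers
   [v = 0]. *)
exists (d / (`|v| + 1)); first by rewrite /= divr_gt0.
move=> s /=; rewrite sub0r normrN ltr_pdivlMr// => sd s0.
rewrite /homothety_mean meanB; last 2 first.
- exact: homothety_integrand_continuous.
- exact: homothety_integrand_continuous.
rewrite -[_ *: mean _]/(_ * mean _) -meanZ; last first.
  by move=> t; apply: cvgB; exact: homothety_integrand_continuous.
rewrite meanB; last 2 first.
- exact: (@homothety_integrand_continuous k.+1 ('D_v h) y cD).
- move=> t; apply: cvgM; first exact: cvg_cst.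
  by apply: cvgB; exact: homothety_integrand_continuous.
apply: mean_le.
  move=> t; apply: cvgB; first exact: (@homothety_integrand_continuous k.+1 ('D_v h) y cD).
  apply: cvgM; first exact: cvg_cst.
  by apply: cvgB; exact: homothety_integrand_continuous.
move=> t t01; rewrite -mulrBr.
have -> : P t (s *: v + y) = (t * s) *: v + P t y.
  by rewrite /P -addrA scalerDr addrA scalerA.
have [|c c01 ->] := @MVT_line R _ h (P t y) ((t * s) *: v).
  by move=> c _; exact: dh.
rewrite derive_scale; last exact: dh.
have -> : c *: ((t * s) *: v) + P t y = P t ((c * s) *: v + y).
  rewrite /P -(addrA (_ *: v)) (scalerDr t ((c * s) *: v)) addrA !scalerA.
  by congr (_ *: _ + _ + _); ring.
rewrite (_ : _ - _ = t ^+ k.+1 * ('D_v h (P t y) - 'D_v h (P t ((c * s) *: v + y)))); last first.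
  by rewrite exprS; field.
rewrite normrM; apply: (@le_trans _ _ (1 * e)); last by rewrite mul1r.
apply: ler_pM => //.
  by move/andP: t01 => [t0 t1]; rewrite ger0_norm ?exprn_ge0// exprn_ile1.
apply: Hd => //; rewrite -ball_normE /ball_ /= opprD addrCA subrr addr0 normrN normrZ normrM.
case/andP: c01 => c0 c1; rewrite (ger0_norm c0).
have v0 := normr_ge0 v; have a0 := normr_ge0 s.
apply: le_lt_trans sd; rewrite -mulrA; apply: (@le_trans _ _ (1 * (`|s| * `|v|))).
  by rewrite ler_wpM2r// mulr_ge0.
by rewrite mul1r ler_wpM2l// lerDl.
Qed.

Lemma smooth_on_homothety_mean k h : smooth_on setT h -> smooth_on setT (homothety_mean k h).
Proof.
move=> /smooth_onP sh; apply/smooth_onP => j.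
elim: j k h sh => [|j IH] k h sh; split=> //.
- by move=> x _; apply: homothety_mean_continuous => z; exact: (sh 0%N).1.
- by move=> x _; apply: homothety_mean_continuous => z; exact: (sh 0%N).1.
have d x v := @homothety_mean_derive k h x v (sh 1%N).
split=> [x v _|v]; first by have [] := d x v.
have -> : 'D_v (homothety_mean k h) = homothety_mean k.+1 ('D_v h).
  by apply/funext => x; have [_ ->] := d x v.
by apply: IH => i; have [_ [_ D]] := sh i.+1; exact: D.
Qed.

(** The function [g i] is the mean of the i-th partial derivative over the segment from [y0] to [y];
    the identity is the fundamental theorem of calculus along that segment. *)
Lemma hadamard h : smooth_on setT h -> exists g : 'I_n -> 'rV[R]_n -> R^o,
  [/\ forall i, smooth_on setT (g i), forall i, g i y0 = 'D_(delta_mx 0 i) h y0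
    & forall y, h y = h y0 + \sum_i (y 0 i - y0 0 i) * g i y].
Proof.
move=> sh; exists (fun i => homothety_mean 0 ('D_(delta_mx 0 i) h)).
have sD i := smooth_on_derive (delta_mx 0 i) sh.
have cD i : continuous ('D_(delta_mx 0 i) h) by move=> z; exact: smooth_on_continuous (sD i) _.
split=> [i|i|y]; first exact: (smooth_on_homothety_mean 0 (sD i)).
  rewrite /homothety_mean (_ : (fun _ => _) = cst ('D_(delta_mx 0 i) h y0 : R)).
    rewrite /mean Rintegral_cst//= lebesgue_measure_itv /= lte01 /=.
    by rewrite subr0 mulr1.
  by apply/funext => t /=; rewrite /P subrr scaler0 add0r expr0 mul1r.
pose a i (t : R) : R := (y 0 i - y0 0 i) * (t ^+ 0 * 'D_(delta_mx 0 i) h (P t y)).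
have ca i : continuous (a i).
  move=> t; apply: cvgM; first exact: cvg_cst.
  exact: (@homothety_integrand_continuous 0 _ y (cD i)).
have -> : \sum_i (y 0 i - y0 0 i) * homothety_mean 0 ('D_(delta_mx 0 i) h) y =
    mean (fun t => \sum_i a i t).
  rewrite mean_sum//; apply: eq_bigr => i _.
  by rewrite /homothety_mean -meanZ//; exact: (@homothety_integrand_continuous 0 _ y (cD i)).
have -> : mean (fun t => \sum_i a i t) = h (P 1 y) - h (P 0 y).
  apply: (@mean_FTC _ (fun t => h (P t y))).
    move=> t; pose Q (f : R -> R) := {for t, continuous f}.
    suff : Q (fun t => \sum_i a i t) by [].
    elim: (index_enum _) => [|i r IH].
      rewrite (_ : (fun _ => _) = cst 0); first exact: cst_continuous.
      by apply/funext => s; rewrite big_nil.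
    rewrite (_ : (fun _ => _) = fun t => a i t + \sum_(j <- r) a j t).
      by apply: continuousD; [exact: ca|exact: IH].
    by apply/funext => s; rewrite big_cons.
  move=> t; have [e1 e2] := derive_line h y0 (y - y0) t.
  split; first by apply/e2; exact: smooth_on_derivable sh _.
  have /= := @smooth_on_chain R _ n setT h id (P t y) (y - y0) openT I sh (@derivable_id _ _ _ _).
  rewrite e1 derive_id => ->.
  by apply: eq_bigr => i _; rewrite /a expr0 mul1r !mxE.
by rewrite /P scale1r subrK scale0r add0r addrC subrK.
Qed.

End Hadamard.

(** * Level sets of submersions of vector spaces *)

(** Presents row vectors as a complete normed module, the setting of the Banach fixed point
    theorem. *)
HB.instance Definition _ (R : realType) (m n : nat) :=
  Complete.copy 'M[R]_(m, n) 'M[R]_(m, n).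

Lemma half_lipschitz_fixed_point (R : realType) (n : nat) (U : set 'rV[R]_n)
    (phi : 'rV[R]_n -> 'rV[R]_n) (base : 'rV[R]_n) :
  closed U -> U base -> (forall x, U x -> U (phi x)) ->
  (forall x y, U x -> U y -> `|phi x - phi y| <= 2^-1 * `|x - y|) ->
  exists2 p, U p & phi p = p.
Proof.
move=> cU Ub UU lip.
have [|//|p Up pE] := @banach_fixed_point R 'rV[R]_n U (mkfun UU) _ cU; last by exists p.
  exists (2^-1%:nng); split; first by rewrite /= invf_lt1// ltr1n.
  by case=> x y [/= Ux Uy]; exact: lip.
by exists base.
Qed.

(** The chain rule with the identity as inner map: linearity in the direction comes from continuity
    of the partial derivatives. *)
Lemma derive_dirE (R : realType) (m : nat) (U : set 'rV[R]_m) (f : 'rV[R]_m -> R^o) y v :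
  open U -> U y -> smooth_on U f ->
  'D_v f y = \sum_i v 0 i * 'D_(delta_mx 0 i) f y.
Proof.
move=> oU Uy sf.
have := @smooth_on_chain R 'rV[R]_m m U f id y v oU Uy sf (@derivable_id _ _ _ _).
by rewrite derive_id.
Qed.

Lemma derive_dirZ (R : realType) (m : nat) (U : set 'rV[R]_m) (f : 'rV[R]_m -> R^o) y v (a : R) u :
  open U -> U y -> smooth_on U f ->
  'D_(a *: v + u) f y = a * 'D_v f y + 'D_u f y.
Proof.
move=> oU Uy sf; rewrite !(derive_dirE _ oU Uy sf) mulr_sumr -big_split /=.
by apply: eq_bigr => i _; rewrite !mxE mulrDl mulrA.
Qed.

Lemma strict_diff_row (R : realType) (m n : nat) (U : set 'rV[R]_m)
    (f : 'rV[R]_m -> 'rV[R]_n) y0 (e : R) : open U -> U y0 -> smooth_on U f -> 0 < e ->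
  exists2 d : R, 0 < d & forall a b, ball y0 d a -> ball y0 d b ->
    `|f a - f b - 'D_(a - b) f y0| <= e * `|a - b|.
Proof.
move=> oU Uy0 sf e0.
have sfi i : smooth_on U (fun y => f y 0 i : R^o) by exact: smooth_on_coord.
have : forall i : 'I_n, exists d : {posnum R}, forall a b, ball y0 d%:num a -> ball y0 d%:num b ->
    `|f a 0 i - f b 0 i - ('D_(a - b) f y0) 0 i| <= e * `|a - b|.
  move=> i; have [d d0 Hd] := strict_diff oU Uy0 ((smooth_onP _ _).1 (sfi i) 1%N) e0.
  exists (PosNum d0) => a b ya yb; have := Hd a b ya yb.
  rewrite -(derive_dirE _ oU Uy0 (sfi i)) derive_coord//.
  exact: smooth_on_derivable sf Uy0.
move=> /choice[d Hd].
have : \forall z \near y0, forall i, ball y0 (d i)%:num z.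
  apply: (@filter_forall _ _ (fun i z => ball y0 (d i)%:num z) _ (nbhs_filter y0)) => i.
  exact: nbhsx_ballx.
move=> /nbhs_ballP[d' /= d'0 Hd']; exists d' => // a b ya yb.
rewrite [leLHS]/Num.norm/= mx_normrE bigmax_le//; first by rewrite mulr_ge0// ltW.
by move=> -[i j] _; rewrite ord1 !mxE /=; apply: Hd; exact: Hd'.
Qed.

(** * The level set through a point where the differential is surjective *)

Section KernelOfSubmersion.
Variables (R : realType) (m n : nat) (U : set 'rV[R]_m) (y0 : 'rV[R]_m).
Variables (f : 'rV[R]_m -> 'rV[R]_n) (B : 'M[R]_(n, m)).
Hypotheses (oU : open U) (Uy0 : U y0) (sf : smooth_on U f).
(** The rows of [B] span a complement of the kernel of the differential at [y0], along which points
    are corrected back to the level set. *)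
Hypothesis fB : forall u : 'rV[R]_n, 'D_(u *m B) f y0 = u.

Lemma derive_dir_rowZ (a : R) v u :
  'D_(a *: v + u) f y0 = a *: 'D_v f y0 + 'D_u f y0.
Proof.
have df w : derivable f y0 w by exact: smooth_on_derivable sf Uy0.
apply/rowP => i; rewrite -(derive_coord i (df (a *: v + u))).
rewrite (derive_dirZ _ _ _ oU Uy0 (smooth_on_coord i oU sf)).
by rewrite (derive_coord i (df v)) (derive_coord i (df u)) [RHS]mxE [X in _ = X + _]mxE.
Qed.

Lemma mulmxB_le : exists2 K : R, 0 < K & forall u : 'rV[R]_n, `|u *m B| <= K * `|u|.
Proof.
pose K := \sum_(i < n) `|row i B|; have K0 : 0 <= K by apply: sumr_ge0.
exists (K + 1); first by rewrite ltr_wpDl.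
move=> u; apply: (@le_trans _ _ (K * `|u|)); last by rewrite ler_wpM2r// lerDl.
rewrite mulmx_sum_row; apply: le_trans (ler_norm_sum _ _ _) _.
rewrite mulr_suml; apply: ler_sum => i _; rewrite normrZ mulrC ler_wpM2l//.
by rewrite [leRHS]/Num.norm/= mx_normrE; apply: le_trans (le_bigmax _ _ (0, i)).
Qed.

(* Solves [f (y0 + s w + u B) = f y0] for [u = o(s)] by a contraction. *)
Lemma level_curve (w : 'rV[R]_m) (e : R) : 'D_w f y0 = 0 -> 0 < e ->
  exists2 d : R, 0 < d & forall s : R, `|s| < d ->
    exists2 u : 'rV[R]_n, `|u| <= e * `|s| & f (s *: w + u *m B + y0) = f y0.
Proof.
move=> fw e0; have [K K0 KB] := mulmxB_le.
(* Multiplied by the bound [K] of [B], this accuracy yields the contraction ratio 1/2. *)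
have k0 : 0 < (2 * K)^-1 by rewrite invr_gt0 mulr_gt0.
have w10 : 0 < `|w| + 1 by rewrite ltr_wpDl.
have e'0 : 0 < e / 2 / (`|w| + 1) by rewrite !divr_gt0.
have [d1 d10 H1] := strict_diff_row oU Uy0 sf k0.
have [d2 d20 H2] := strict_diff_row oU Uy0 sf e'0.
pose d := Num.min d1 d2; have d0 : 0 < d by rewrite lt_min d10.
have c0 : 0 < `|w| + 1 + K * e by rewrite addr_gt0// mulr_gt0.
exists (d / (`|w| + 1 + K * e)); first by rewrite divr_gt0.
move=> s; rewrite ltr_pdivlMr// => sd.
have s0 := normr_ge0 s; have w0 := normr_ge0 w.
pose a (u : 'rV[R]_n) := s *: w + u *m B + y0.
pose V := [set u : 'rV[R]_n | `|u| <= e * `|s|].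
have es : 0 <= e * `|s| by rewrite mulr_ge0// ltW.
have aV u : V u -> `|a u - y0| < d.
  rewrite /V /= => uV; rewrite /a addrK; apply: le_lt_trans sd.
  apply: le_trans (ler_normD _ _) _; rewrite normrZ.
  have uB := KB u; have : K * `|u| <= K * (e * `|s|) by rewrite ler_wpM2l// ltW.
  nra.
have a1 u : V u -> ball y0 d1 (a u).
  by move=> /aV; rewrite -ball_normE /ball_ /= distrC => /lt_le_trans; apply; rewrite ge_min lexx.
have a2 u : V u -> ball y0 d2 (a u).
  by move=> /aV; rewrite -ball_normE /ball_ /= distrC => /lt_le_trans; apply; rewrite ge_min lexx orbT.
(* Newton iteration with the derivative frozen at [y0]: by [fB], the derivative of [f (a u)] in [u]
   is close to the identity, so [phi] is nearly constant, and its fixed points solve the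
   equation. *)
pose phi u := u - (f (a u) - f y0).
have V0 : V 0 by rewrite /V /= normr0.
have phi_lip u u' : V u -> V u' -> `|phi u - phi u'| <= 2^-1 * `|u - u'|.
  move=> Vu Vu'; have := H1 _ _ (a1 _ Vu) (a1 _ Vu').
  have -> : a u - a u' = (u - u') *m B.
    by rewrite /a mulmxBl opprD addrACA subrr addr0 opprD addrACA subrr add0r.
  rewrite fB => Hf.
  have -> : phi u - phi u' = - (f (a u) - f (a u') - (u - u')).
    by rewrite /phi; apply/rowP => j; rewrite !mxE; ring.
  rewrite normrN; apply: le_trans Hf _; rewrite invfM -mulrA ler_wpM2l//.
  by rewrite ler_pdivrMl.
(* Here the direction [w] lies in the kernel. With ratio 1/2, this half of the radius is what makes
   [phi] map the ball [V] of radius [e * |s|] to itself. *)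
have phi0 : `|phi 0| <= e / 2 * `|s|.
  have ball0 : ball y0 d2 y0 by exact: ballxx.
  have := H2 _ _ (a2 _ V0) ball0.
  have -> : a 0 - y0 = s *: w + 0 by rewrite /a mul0mx addrK.
  rewrite derive_dir_rowZ fw scaler0 add0r derive0 subr0 addr0 => h.
  rewrite /phi sub0r normrN; apply: le_trans h _.
  rewrite normrZ mulrCA mulrC; apply: ler_wpM2r => //.
  by rewrite mulrAC ler_pdivrMr// ler_wpM2l ?lerDl// divr_ge0// ltW.
have [||u Vu phiu] := @half_lipschitz_fixed_point _ _ V phi 0 _ V0 _ phi_lip.
- apply: (closed_comp (f := fun u : 'rV[R]_n => `|u|) (D := [set x | x <= e * `|s|])).
    by move=> u _; exact: norm_continuous.
  exact: closed_le.
- move=> u Vu; have := phi_lip _ _ Vu V0; rewrite subr0 => h; rewrite /V /=.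
  have -> : phi u = (phi u - phi 0) + phi 0 by rewrite subrK.
  apply: le_trans (ler_normD _ _) _; move: (Vu); rewrite /V /=; nra.
exists u; first exact: Vu.
move: phiu => /eqP; rewrite /phi -subr_eq0 addrAC subrr add0r oppr_eq0 subr_eq0.
by move=> /eqP.
Qed.

(** At the points [s *: w + u *m B + y0] of the level set, with [u] of order o(s), [F] vanishes;
    hence [s] times the derivative of [F] along [w] is o(s). Such points for small [s] suffice, no
    smooth curve is constructed. *)
Lemma derive_kernel_eq0 (F : 'rV[R]_m -> R^o) (w : 'rV[R]_m) :
  smooth_on U F -> 'D_w f y0 = 0 ->
  (\forall y \near y0, f y = f y0 -> F y = 0) -> 'D_w F y0 = 0.
Proof.
move=> sF fw /nbhs_ballP[r /= r0 Fr].
have [K K0 KB] := mulmxB_le.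
pose L (v : 'rV[R]_m) : R := \sum_i v 0 i * 'D_(delta_mx 0 i) F y0.
pose KF : R := \sum_i `|'D_(delta_mx 0 i) F y0|.
have KF0 : 0 <= KF by apply: sumr_ge0.
have LK v : `|L v| <= KF * `|v|.
  apply: le_trans (ler_norm_sum _ _ _) _; rewrite mulr_suml; apply: ler_sum => i _.
  rewrite normrM mulrC ler_wpM2l// [leRHS]/Num.norm/= mx_normrE.
  by apply: le_trans (le_bigmax _ _ (0, i)).
have LD s v u : L (s *: v + u) = s * L v + L u.
  rewrite /L mulr_sumr -big_split /=; apply: eq_bigr => i _.
  by rewrite !mxE mulrDl mulrA.
rewrite (derive_dirE _ oU Uy0 sF) -/(L w); apply/eqP; rewrite -normr_le0.
apply/ler_addgt0Pl => e e0; rewrite addr0.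
(* Gathers the two errors: [|w| + K] bounds the displacement divided by [s], and [KF * K] the effect
   of the correction [u *m B] on [L]. The result is [|L w| <= eta * c <= e]. *)
pose c := `|w| + 1 + K + KF * K.
have c0 : 0 < c.
  rewrite /c -!addrA ltr_wpDl// addr_gt0// ltr_wpDr//.
  by rewrite mulr_ge0// ltW.
have ec : 0 < e / c by rewrite divr_gt0.
pose eta := Num.min 1 (e / c).
have eta0 : 0 < eta by rewrite lt_min ltr01.
have [eta1 etac] : eta <= 1 /\ eta <= e / c by rewrite !ge_min !lexx orbT.
have [d d0 Hd] := level_curve fw eta0.
have [d' d'0 Hd'] := strict_diff oU Uy0 ((smooth_onP _ _).1 sF 1%N) eta0.
pose D := Num.min d (Num.min r d' / c).
have rd0 : 0 < Num.min r d' / c by rewrite divr_gt0// lt_min r0.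
have D0 : 0 < D by rewrite lt_min d0.
pose s := D / 2; have s0 : 0 < s by rewrite divr_gt0.
have sD : s < D by rewrite ltr_pdivrMr// ltr_pMr// ltr1n.
have ns : `|s| = s by rewrite gtr0_norm.
have sd : `|s| < d by rewrite ns; apply: lt_le_trans sD _; rewrite ge_min lexx.
have [u us fu] := Hd s sd; rewrite ns in us.
have uB : `|u *m B| <= K * (eta * s).
  by apply: le_trans (KB u) _; rewrite ler_wpM2l// ltW.
have uB1 : `|u *m B| <= K * s.
  by apply: le_trans uB _; rewrite ler_wpM2l ?(ltW K0)// ler_piMl// ltW.
have na : `|s *: w + u *m B| <= (`|w| + K) * s.
  apply: le_trans (ler_normD _ _) _; rewrite normrZ ns; nra.
have ls : `|s *: w + u *m B| < Num.min r d'.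
  apply: le_lt_trans na _; apply: (@le_lt_trans _ _ (c * s)).
    by rewrite ler_wpM2r ?(ltW s0)// /c; have := mulr_ge0 KF0 (ltW K0); lra.
  by rewrite mulrC -ltr_pdivlMr//; apply: lt_le_trans sD _; rewrite ge_min lexx orbT.
have := ls; rewrite lt_min => /andP[lr ld].
pose a := s *: w + u *m B + y0.
have ar : ball y0 r a by rewrite -ball_normE /ball_ /= /a opprD addrCA subrr addr0 normrN.
have ad : ball y0 d' a by rewrite -ball_normE /ball_ /= /a opprD addrCA subrr addr0 normrN.
have Fa : F a = 0 by exact: (Fr a ar fu).
have F0 : F y0 = 0 by exact: (Fr y0 (ballxx _ r0) erefl).
have := Hd' a y0 ad (ballxx _ d'0).
rewrite Fa F0 subrr sub0r -/(L (a - y0)) /a addrK LD normrN => h.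
have LB := LK (u *m B).
have h2 : s * `|L w| <= `|s * L w + L (u *m B)| + `|L (u *m B)|.
  rewrite -{1}ns -normrM; apply: le_trans (ler_normB _ _); rewrite addrK//.
have h3 : eta * `|s *: w + u *m B| <= eta * ((`|w| + K) * s) by rewrite ler_wpM2l// ltW.
have h4 : `|L (u *m B)| <= KF * (K * (eta * s)) by apply: le_trans LB _; rewrite ler_wpM2l.
have h5 : s * `|L w| <= s * (eta * c).
  by rewrite /c; have := mulr_gt0 s0 eta0; nra.
rewrite ler_pM2l// in h5; apply: le_trans h5 _.
by rewrite -ler_pdivlMr.
Qed.

End KernelOfSubmersion.

(** * Smooth functions and tangent vectors of manifolds *)

Section Charts.
Variables (R : realType) (m : nat) (M : manifold R m).
Implicit Types (c d : chart R M m) (p q : M) (f : M -> R).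

Lemma chart_continuous c p : dom c p -> {for p, continuous c}.
Proof.
move=> cp; have := @chart_map_continuous _ _ _ c.
by rewrite continuous_open_subspace; [apply; rewrite inE|exact: dom_open].
Qed.

Lemma chart_inv_cont c y : cod c y -> {for y, continuous (chart_inv c)}.
Proof.
move=> cy; have := @chart_inv_continuous _ _ _ c.
by rewrite continuous_open_subspace; [apply; rewrite inE|exact: cod_open].
Qed.

Lemma open_preimage_on (X Y : topologicalType) (h : X -> Y) (A : set X) (B : set Y) :
  open A -> open B -> (forall x, A x -> {for x, continuous h}) ->
  open [set x | A x /\ B (h x)].
Proof.
move=> oA oB ch; rewrite openE => x [Ax Bhx]; apply: filterI; first exact: open_nbhs_nbhs.
by apply: (ch x Ax); exact: open_nbhs_nbhs.
Qed.

Lemma open_chart_inv c (V : set M) : open V -> open [set y | cod c y /\ V (chart_inv c y)].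
Proof.
move=> oV; apply: open_preimage_on => //; first exact: cod_open.
by move=> y; exact: chart_inv_cont.
Qed.

Lemma near_chart_inv c p (P : M -> Prop) : dom c p -> (\forall q \near p, P q) ->
  \forall y \near c p, P (chart_inv c y).
Proof.
move=> cp nP; have := chart_inv_cont (chart_map_cod cp).
by rewrite /prop_for/continuous_at chart_mapK//; apply.
Qed.

Lemma near_chart c p (P : 'rV[R]_m -> Prop) : dom c p -> (\forall y \near c p, P y) ->
  \forall q \near p, P (c q).
Proof.
by move=> cp nP; have := chart_continuous cp; rewrite /prop_for/continuous_at; apply.
Qed.

Lemma near_dom c p : dom c p -> \forall q \near p, dom c q.
Proof. by move=> cp; apply: open_nbhs_nbhs; split=> //; exact: dom_open. Qed.

Lemma near_cod c y : cod c y -> \forall z \near y, cod c z.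
Proof. by move=> cp; apply: open_nbhs_nbhs; split=> //; exact: cod_open. Qed.

(** One chart about each point is enough: any other chart differs from it by a smooth transition
    map. *)
Lemma smooth_funP f :
  (forall p, exists c, [/\ atlas c, dom c p & exists2 W : set 'rV[R]_m, open_nbhs (c p) W &
     smooth_on W (fun y => f (chart_inv c y) : R^o)]) -> smooth_fun M f.
Proof.
move=> H d ad; apply: smooth_on_loc => y dy.
have [c [ac cp [W0 [oW0 W0p] sW0]]] := H (chart_inv d y).
pose W := [set z | W0 z /\ cod c z].
have oW : open W by apply: openI => //; exact: cod_open.
have sW := smooth_on_sub (fun x (h : W x) => proj1 h) sW0.
have Wp : W (c (chart_inv d y)) by split=> //; exact: chart_map_cod.
pose A := overlap d c.
have oA : open A by apply: open_chart_inv; exact: dom_open.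
have sA := atlas_smooth ad ac.
pose V := [set z | A z /\ W (c (chart_inv d z))].
have oV : open V.
  apply: (@open_preimage_on _ _ (c \o chart_inv d)); [exact: oA|exact: oW|].
  by move=> z Az; exact: smooth_on_continuous sA Az.
exists V; first by do !split=> //.
apply: (smooth_on_eq (f := (fun z => f (chart_inv c z)) \o (c \o chart_inv d))) => //.
  by move=> z [[_ dz] _] /=; rewrite chart_mapK.
apply: (smooth_on_comp oV oW) => //; first by move=> z [].
by apply: smooth_on_sub sA => z [].
Qed.

Lemma smooth_fun_local f :
  (forall p, exists2 F, smooth_fun M F & \forall q \near p, f q = F q) -> smooth_fun M f.
Proof.
move=> H; apply: smooth_funP => p; have [c ac cp] := atlas_cover p.
have [F sF nF] := H p; have : nbhs p [set q | f q = F q] := nF.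
rewrite nbhsE => -[V [oV Vp] VF].
exists c; split=> //; exists [set y | cod c y /\ V (chart_inv c y)].
  split; first exact: open_chart_inv.
  by split; [exact: chart_map_cod|rewrite chart_mapK].
apply: (smooth_on_eq (f := fun y => F (chart_inv c y) : R^o)).
- exact: open_chart_inv.
- by move=> y [_ Vy]; rewrite VF.
- by apply: smooth_on_sub (sF c ac) => y [].
Qed.

Lemma smooth_fun_cst (a : R) : smooth_fun M (fun=> a).
Proof. by move=> c ac; exact: (@smooth_on_cst _ _ _ (cod c) (a : R^o)). Qed.

Lemma smooth_funD f h : smooth_fun M f -> smooth_fun M h -> smooth_fun M (fun p => f p + h p).
Proof.
move=> sf sh c ac.
exact: (smooth_onD (@cod_open _ _ _ c) (sf c ac) (sh c ac)).
Qed.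

Lemma smooth_funM f h : smooth_fun M f -> smooth_fun M h -> smooth_fun M (fun p => f p * h p).
Proof.
move=> sf sh c ac.
exact: (smooth_onM (@cod_open _ _ _ c) (sf c ac) (sh c ac)).
Qed.

Lemma smooth_funV f : smooth_fun M f -> (forall p, f p != 0) -> smooth_fun M (fun p => (f p)^-1).
Proof.
move=> sf f0 c ac.
exact: (smooth_onV (@cod_open _ _ _ c) (fun y _ => f0 _) (sf c ac)).
Qed.

Lemma smooth_funZ (a : R) f : smooth_fun M f -> smooth_fun M (fun p => a * f p).
Proof. by move=> sf; apply: (@smooth_funM (fun=> a) f); [exact: smooth_fun_cst|exact: sf]. Qed.

Lemma smooth_funB f h : smooth_fun M f -> smooth_fun M h -> smooth_fun M (fun p => f p - h p).
Proof.
move=> sf sh; rewrite (_ : (fun _ => _) = fun p => f p + -1 * h p).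
  by apply: smooth_funD; [exact: sf|exact: smooth_funZ].
by apply/funext => p; rewrite mulN1r.
Qed.

Lemma smooth_fun_sum (I : Type) (r : seq I) (f : I -> M -> R) :
  (forall i, smooth_fun M (f i)) -> smooth_fun M (fun p => \sum_(i <- r) f i p).
Proof.
move=> sf; elim: r => [|i r IH].
  rewrite (_ : (fun _ => _) = fun=> 0); first exact: smooth_fun_cst.
  by apply/funext => x; rewrite big_nil.
rewrite (_ : (fun _ => _) = fun p => f i p + \sum_(j <- r) f j p).
  exact: smooth_funD (sf i) IH.
by apply/funext => x; rewrite big_cons.
Qed.

Definition extend0 c (k : 'rV[R]_m -> R) : M -> R :=
  fun q => if `[< dom c q >] then k (c q) else 0.

Lemma extend0E c k q : dom c q -> extend0 c k q = k (c q).
Proof. by move=> cq; rewrite /extend0 asboolT. Qed.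

(** At points outside the chart domain the Hausdorff property enters: the image of [K] is compact,
    hence closed, and the extension is 0 on its open complement. *)
Lemma smooth_extend0 c (K : set 'rV[R]_m) (k : 'rV[R]_m -> R^o) :
  atlas c -> compact K -> K `<=` cod c -> smooth_on (cod c) k ->
  (forall y, k y != 0 -> K y) -> smooth_fun M (extend0 c k).
Proof.
move=> ac cK Kc sk kK; apply: smooth_funP => p.
have [cp|ncp] := pselect (dom c p).
  exists c; split=> //; exists (cod c).
    by split; [exact: cod_open|exact: chart_map_cod].
  apply: (smooth_on_eq (f := k)) => //; first exact: cod_open.
  move=> y cy; rewrite /extend0 asboolT ?chart_invK//; exact: chart_inv_dom.
have cl : closed (chart_inv c @` K).
  apply: compact_closed; first exact: points_hausdorff.
  apply: continuous_compact => //; apply: continuous_subspaceW Kc _.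
  exact: chart_inv_continuous.
have [d ad dp] := atlas_cover p; exists d; split=> //.
have oV : open (~` (chart_inv c @` K)) by exact: closed_openC.
exists [set y | cod d y /\ (~` (chart_inv c @` K)) (chart_inv d y)].
  split; first exact: open_chart_inv.
  split; first exact: chart_map_cod.
  rewrite chart_mapK// => -[y Ky yp]; apply: ncp; rewrite -yp.
  by apply: chart_inv_dom; exact: Kc.
apply: (smooth_on_eq (f := cst (0 : R^o))); [exact: open_chart_inv| |exact: smooth_on_cst].
move=> y [dy nK]; rewrite /extend0; case: asboolP => // cy.
apply/esym/eqP/negPn/negP => k0; apply: nK.
by exists (c (chart_inv d y)); [exact: kK|rewrite chart_mapK].
Qed.

End Charts.

(** * The algebra of derivations *)

Section Tangent.
Variables (R : realType) (T : Type) (C : set (T -> R)).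
Implicit Types (p : T) (u v : tvec R T) (f h : T -> R).

Lemma tangent_eq p u v : tangent C p u -> tangent C p v ->
  (forall f, C f -> u f = v f) -> u = v.
Proof.
move=> [u0 _ _] [v0 _ _] uv; apply/funext => f.
by have [Cf|nCf] := pselect (C f); [exact: uv|rewrite u0 ?v0].
Qed.

Lemma tangent0 p : tangent C p 0.
Proof. by split=> // *; rewrite -![(0 : tvec R T) _]/(0 : R); ring. Qed.

Lemma tangent_comb p (a : R) u v : tangent C p u -> tangent C p v ->
  tangent C p (a *: u + v).
Proof.
move=> [u0 ul um] [v0 vl vm].
have E f : (a *: u + v) f = a * u f + v f by [].
split=> [f nf|b f h Cf Ch|f h Cf Ch]; rewrite !E.
- by rewrite u0// v0// mulr0 addr0.
- by rewrite ul// vl//; ring.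
- by rewrite um// vm//; ring.
Qed.

Lemma tangentD p u v : tangent C p u -> tangent C p v -> tangent C p (u + v).
Proof. by move=> tu tv; rewrite -[u]scale1r; exact: tangent_comb. Qed.

Lemma tangentZ p (a : R) u : tangent C p u -> tangent C p (a *: u).
Proof. by move=> tu; rewrite -[_ *: _]addr0; apply: tangent_comb => //; exact: tangent0. Qed.

Lemma tangentB p u v : tangent C p u -> tangent C p v -> tangent C p (u - v).
Proof. by move=> tu tv; apply: tangentD => //; rewrite -scaleN1r; exact: tangentZ. Qed.

Lemma tangent_sum p (I : Type) (r : seq I) (a : I -> R) (e : I -> tvec R T) :
  (forall i, tangent C p (e i)) -> tangent C p (\sum_(i <- r) a i *: e i).
Proof.
move=> te; elim: r => [|i r IH]; first by rewrite big_nil; exact: tangent0.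
by rewrite big_cons; exact: tangent_comb.
Qed.

Lemma sum_tvecE (I : Type) (r : seq I) (a : I -> R) (e : I -> tvec R T) f :
  (\sum_(i <- r) a i *: e i) f = \sum_(i <- r) a i * e i f.
Proof. by elim: r => [|i r IH]; rewrite ?big_nil// !big_cons -IH. Qed.

Hypothesis C1 : forall a : R, C (fun=> a).

Lemma tangent_cst p v (a : R) : tangent C p v -> v (fun=> a) = 0.
Proof.
move=> [_ vl vm].
have v00 : v (fun=> 0) = 0.
  have := vl 1 _ _ (C1 0) (C1 0); rewrite (_ : (fun _ => _) = fun=> 0).
    by rewrite mul1r => /eqP; rewrite -subr_eq0 opprD addNKr oppr_eq0 => /eqP.
  by apply/funext => q; rewrite mulr0 addr0.
have v1 : v (fun=> 1) = 0.
  have := vm _ _ (C1 1) (C1 1); rewrite (_ : (fun _ => _) = fun=> 1).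
    by rewrite mulr1 mul1r => /eqP; rewrite -subr_eq0 opprD addNKr oppr_eq0 => /eqP.
  by apply/funext => q; rewrite mulr1.
have := vl a _ _ (C1 1) (C1 0); rewrite v1 v00 mulr0 [0 + 0]addr0 => <-.
by congr v; apply/funext => q; rewrite mulr1 addr0.
Qed.

Lemma tangent_add p v f h : tangent C p v -> C f -> C h ->
  v (fun q => f q + h q) = v f + v h.
Proof.
move=> [_ vl _] Cf Ch; rewrite -[v f]mul1r -vl//.
by congr v; apply/funext => q; rewrite mul1r.
Qed.

Lemma tangent_scale p v (a : R) f : tangent C p v -> C f ->
  v (fun q => a * f q) = a * v f.
Proof.
move=> tv Cf; have [_ vl _] := tv; rewrite -[RHS]addr0 -(tangent_cst 0 tv) -vl//.
by congr v; apply/funext => q; rewrite addr0.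
Qed.

Lemma tangent_sub p v f h : tangent C p v -> C f -> C h ->
  v (fun q => f q - h q) = v f - v h.
Proof.
move=> [_ vl _] Cf Ch; rewrite addrC -mulN1r -vl//.
by congr v; apply/funext => q; rewrite mulN1r addrC.
Qed.

Lemma tangent_mul p v f h : tangent C p v -> C f -> C h ->
  v (fun q => f q * h q) = v f * h p + f p * v h.
Proof. by move=> [_ _ vm] Cf Ch; exact: vm. Qed.

Hypothesis CD : forall f h, C f -> C h -> C (fun q => f q + h q).

Lemma tangent_sumf p v (I : Type) (r : seq I) (f : I -> T -> R) :
  tangent C p v -> (forall i, C (f i)) ->
  v (fun q => \sum_(i <- r) f i q) = \sum_(i <- r) v (f i).
Proof.
move=> tv Cf.
suff [] : C (fun q => \sum_(i <- r) f i q) /\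
  v (fun q => \sum_(i <- r) f i q) = \sum_(i <- r) v (f i) by [].
elim: r => [|i r [IH1 IH2]].
  rewrite big_nil (_ : (fun _ => _) = fun=> 0).
    by split; [exact: C1|exact: tangent_cst tv].
  by apply/funext => q; rewrite big_nil.
rewrite big_cons (_ : (fun _ => _) = fun q => f i q + \sum_(j <- r) f j q).
  by split; [exact: CD|rewrite (tangent_add tv)// IH2].
by apply/funext => q; rewrite big_cons.
Qed.

Hypothesis CM : forall f h, C f -> C h -> C (fun q => f q * h q).

(** Resets a derivation to 0 outside [C], the normalization that makes equality of tangent vectors
    equality of functions. *)
Lemma tangent_extend p (D : (T -> R) -> R) :
  (forall a f h, C f -> C h -> D (fun q => a * f q + h q) = a * D f + D h) ->
  (forall f h, C f -> C h -> D (fun q => f q * h q) = D f * h p + f p * D h) ->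
  tangent C p (fun f => if `[< C f >] then D f else 0).
Proof.
move=> Dl Dm; split=> [f nCf|a f h Cf Ch|f h Cf Ch]; first by rewrite asboolF.
  have Caf : C (fun q => a * f q) by exact: (CM (C1 a) Cf).
  have Cs : C (fun q => a * f q + h q) by exact: (CD Caf Ch).
  by rewrite !asboolT// Dl.
by have Cs := CM Cf Ch; rewrite !asboolT// Dm.
Qed.

End Tangent.

(** * Locality of derivations and their expression in a chart *)

Section TangentManifold.
Variables (R : realType) (m : nat) (M : manifold R m).
Implicit Types (c d : chart R M m) (p q : M) (f h : M -> R) (v : tvec R M).
Notation C := (smooth_fun M).

(** The compact set [K] containing the support is kept explicit because extension by zero to the
    manifold depends on it. It is a closed ball of half the available radius, hence still inside the
    chart and inside [V]. *)
Lemma chart_cutoff c p (V : set M) : dom c p -> nbhs p V ->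
  exists b : 'rV[R]_m -> R^o, exists K : set 'rV[R]_m,
  [/\ smooth_on setT b, forall y, 0 <= b y <= 1, \forall y \near c p, b y = 1
    & [/\ compact K, K `<=` cod c, forall y, K y -> V (chart_inv c y)
      & forall y, b y != 0 -> K y]].
Proof.
move=> cp nV.
have : \forall y \near c p, cod c y /\ V (chart_inv c y).
  by apply: filterI; [apply: near_cod; exact: chart_map_cod|exact: near_chart_inv].
move=> /nbhs_ballP[r /= r0 rV].
have r20 : 0 < r / 2 by rewrite divr_gt0.
have [b [sb b01 b1 bK]] := smooth_bump (c p) r20.
pose K := [set y | `|c p - y| <= r / 2].
have Kr y : K y -> ball (c p) r y.
  rewrite /K /= -ball_normE /ball_ /= => h; apply: le_lt_trans h _.
  by rewrite ltr_pdivrMr// ltr_pMr// ltr1n.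
exists b, K; split=> //; first by apply/nbhs_ballP; exists (r / 2 / 2); [rewrite /= !divr_gt0|exact: b1].
split=> [|y /Kr/rV[]//|y /Kr/rV[]//|y /bK]; last by rewrite -ball_normE => /ltW.
apply: bounded_closed_compact.
  exists (`|c p| + r / 2); split; first exact: num_real.
  move=> x xr y; rewrite /K /= => h; apply: ltW; apply: le_lt_trans xr.
  rewrite -[y](subrK (c p)) addrC; apply: le_trans (ler_normD _ _) _.
  by rewrite lerD2l distrC.
apply: (closed_comp (f := fun y : 'rV[R]_m => `|c p - y|) (D := [set x | x <= r / 2])).
  move=> y _; apply: continuous_comp; last exact: norm_continuous.
  by apply: (@continuousB _ _ _ (fun=> c p) id); [exact: cst_continuous|move=> ?; exact: cvg_id].
exact: closed_le.
Qed.

Lemma smooth_on_subT (E F : normedModType R) (U : set E) (f : E -> F) :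
  smooth_on setT f -> smooth_on U f.
Proof. exact: smooth_on_sub. Qed.

Lemma bump_fun p (V : set M) : nbhs p V -> exists chi : M -> R,
  [/\ C chi, forall q, 0 <= chi q <= 1, \forall q \near p, chi q = 1
    & forall q, chi q != 0 -> V q].
Proof.
move=> nV; have [c ac cp] := atlas_cover p.
have [b [K [sb b01 b1 [cK Kc KV bK]]]] := chart_cutoff cp nV.
exists (extend0 c b); split.
- by apply: smooth_extend0 bK => //; exact: smooth_on_subT.
- by move=> q; rewrite /extend0; case: asboolP => // _; rewrite lexx ler01.
- have cb : \forall q \near p, b (c q) = 1 by exact: (near_chart (P := fun y => b y = 1) cp b1).
  near=> q.
  rewrite extend0E; first by near: q; exact: cb.
  by near: q; exact: near_dom.
- move=> q; rewrite /extend0; case: asboolP => [cq /bK/KV|_]; last by rewrite eqxx.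
  by rewrite chart_mapK.
Unshelve. all: by end_near. Qed.

(** Multiply [f - h] by a bump supported where the two agree: the product is 0, and the Leibniz rule
    at [p] leaves only [v] of [f - h]. *)
Lemma tangent_local p v f h : tangent C p v -> C f -> C h ->
  (\forall q \near p, f q = h q) -> v f = v h.
Proof.
move=> tv Cf Ch fh; have [chi [Cchi _ chi1 chiV]] := bump_fun fh.
apply/eqP; rewrite -subr_eq0 -(tangent_sub tv)//.
have Cfh := smooth_funB Cf Ch.
have := tangent_mul tv Cfh Cchi.
rewrite (nbhs_singleton chi1) mulr1 (nbhs_singleton fh) subrr mul0r addr0 => <-.
rewrite (_ : (fun _ => _) = fun=> 0); first by rewrite (tangent_cst (@smooth_fun_cst _ _ M) 0 tv).
apply/funext => q; have [->|/chiV ->] := eqVneq (chi q) 0; first by rewrite mulr0.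
by rewrite subrr mul0r.
Qed.

(* By Hadamard's lemma a smooth function is, near p, a constant plus a combination of
   the coordinates centered at p with smooth coefficients; derive both sides by v. *)
Lemma tangent_chart c p v (b : 'rV[R]_m -> R^o) (K : set 'rV[R]_m) :
  atlas c -> dom c p -> tangent C p v -> smooth_on setT b ->
  (\forall y \near c p, b y = 1) -> compact K -> K `<=` cod c ->
  (forall y, b y != 0 -> K y) ->
  forall f, C f -> v f =
    'D_(\row_i v (extend0 c (fun y => b y * y 0 i))) (fun y => f (chart_inv c y) : R^o) (c p).
Proof.
move=> ac cp tv sb b1 cK Kc bK f Cf.
have oT := @openT 'rV[R]_m.
have sk (k : 'rV[R]_m -> R^o) : smooth_on setT k -> C (extend0 c (fun y => b y * k y)).
  move=> sk; apply: (smooth_extend0 (k := (fun y => b y * k y : R^o)) ac cK Kc).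
    by apply: smooth_on_subT; exact: smooth_onM.
  by move=> y; rewrite mulf_eq0 negb_or => /andP[/bK].
have cc P := @near_chart _ _ _ c p P cp.
have ne (k : 'rV[R]_m -> R^o) : \forall q \near p, extend0 c (fun y => b y * k y) q = k (c q).
  near=> q; rewrite extend0E; last by near: q; exact: near_dom.
  suff -> : b (c q) = 1 by rewrite mul1r.
  by near: q; exact: (cc (fun y => b y = 1) b1).
pose x i := extend0 c (fun y : 'rV[R]_m => b y * y 0 i).
have Cx i : C (x i) by exact: (sk (fun y => y 0 i) (smooth_on_linear i oT)).
(* Hadamard's lemma is for functions on the whole vector space, so [f] read in the chart is cut off
   by [b] and extended by 0. *)
pose F y : R^o := if `[< cod c y >] then b y * f (chart_inv c y) else 0.
have sF : smooth_on setT F.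
  apply: smooth_on_loc => y _; have [cy|ncy] := pselect (cod c y).
    exists (cod c) => //.
    apply: (smooth_on_eq (f := fun y => b y * f (chart_inv c y) : R^o)).
    - exact: cod_open.
    - by move=> z cz; rewrite /F asboolT.
    - exact: (smooth_onM (@cod_open _ _ _ c) (smooth_on_subT (U := cod c) sb) (Cf c ac)).
  have oK : open (~` K) by apply: closed_openC; exact: (compact_closed (@norm_hausdorff R 'rV[R]_m) cK).
  exists (~` K); first by move/Kc.
  apply: (smooth_on_eq (f := cst (0 : R^o))); [exact: oK| |exact: smooth_on_cst].
  move=> z nKz; rewrite /F; case: asboolP => // _.
  by have [->|/bK//] := eqVneq (b z) 0; rewrite mul0r.
have [g [sg gD FE]] := hadamard (c p) sF.
pose G i := extend0 c (fun y => b y * g i y).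
have CG i : C (G i) by exact: (sk (g i) (sg i)).
have Fnear : \forall y \near c p, F y = f (chart_inv c y).
  near=> y; rewrite /F asboolT; last by near: y; apply: near_cod; exact: chart_map_cod.
  suff -> : b y = 1 by rewrite mul1r.
  by near: y.
have cpc : cod c (c p) by exact: chart_map_cod.
have xp i : x i p = (c p) 0 i by exact: (nbhs_singleton (ne (fun y => y 0 i))).
have Gp i : G i p = 'D_(delta_mx 0 i) F (c p).
  by rewrite -gD; exact: (nbhs_singleton (ne (g i))).
pose H q := F (c p) + \sum_i (x i q - (c p) 0 i) * G i q.
have Cxc i : C (fun q => x i q - (c p) 0 i) by apply: smooth_funB; [exact: Cx|exact: smooth_fun_cst].
have CxG i : C (fun q => (x i q - (c p) 0 i) * G i q) by exact: (smooth_funM (Cxc i) (CG i)).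
have nx : \forall q \near p, forall i, x i q = c q 0 i.
  by apply: filter_forall => i; exact: (ne (fun y => y 0 i)).
have nG : \forall q \near p, forall i, G i q = g i (c q).
  by apply: filter_forall => i; exact: (ne (g i)).
have fH : \forall q \near p, f q = H q.
  near=> q.
  have xq : forall i, x i q = c q 0 i by near: q; exact: nx.
  have Gq : forall i, G i q = g i (c q) by near: q; exact: nG.
  have cq : dom c q by near: q; exact: near_dom.
  have Fq : F (c q) = f (chart_inv c (c q)).
    by near: q; exact: (cc (fun y => F y = f (chart_inv c y)) Fnear).
  have -> : f q = F (c q) by rewrite Fq chart_mapK.
  by rewrite FE /H; congr (_ + _); apply: eq_bigr => i _; rewrite xq Gq.
have CS : C (fun q => \sum_i (x i q - (c p) 0 i) * G i q) by exact: (smooth_fun_sum _ CxG).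
have CH : C H by exact: (smooth_funD (@smooth_fun_cst _ _ M _) CS).
rewrite (tangent_local tv Cf CH fH) (tangent_add tv (@smooth_fun_cst _ _ M _) CS).
rewrite (tangent_cst (@smooth_fun_cst _ _ M) _ tv) add0r.
rewrite (tangent_sumf (@smooth_fun_cst _ _ M) (@smooth_funD _ _ M) _ tv CxG).
rewrite (derive_dirE _ (@cod_open _ _ _ c) cpc (Cf c ac)).
apply: eq_bigr => i _; rewrite (tangent_mul tv (Cxc i) (CG i)) xp subrr mul0r addr0 mxE.
rewrite (tangent_sub tv (Cx i) (@smooth_fun_cst _ _ M _)).
rewrite (tangent_cst (@smooth_fun_cst _ _ M) _ tv) subr0 Gp; congr (_ * _).
exact: near_eq_derive.
Unshelve. all: by end_near. Qed.

End TangentManifold.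

(** * Coordinates and coordinate fields cut off to the whole manifold *)

Section Frame.
Variables (R : realType) (m : nat) (M : manifold R m).
Implicit Types (c d : chart R M m) (p q : M) (f h : M -> R) (v : tvec R M).
Notation C := (smooth_fun M).

(** The factor [a] will be the value at [q] of the cutoff of a coordinate field. *)
Lemma tangent_derive c q (w : 'rV[R]_m) (a : R) : atlas c -> dom c q ->
  tangent C q (fun f => if `[< C f >] then a * 'D_w (fun y => f (chart_inv c y) : R^o) (c q) else 0).
Proof.
move=> ac cq; have df f : C f -> derivable (fun y => f (chart_inv c y) : R^o) (c q) w.
  by move=> Cf; exact: (smooth_on_derivable (Cf c ac) (chart_map_cod cq)).
apply: (tangent_extend (@smooth_fun_cst _ _ M) (@smooth_funD _ _ M) (@smooth_funM _ _ M)).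
  move=> b f h Cf Ch.
  have := @deriveD _ _ _ (b *: (fun y => f (chart_inv c y) : R^o))
    (fun y => h (chart_inv c y) : R^o) (c q) w (derivableZ (df f Cf)) (df h Ch).
  rewrite (deriveZ b (df f Cf)) => e.
  transitivity (a * (b *: 'D_w (fun y => f (chart_inv c y) : R^o) (c q) +
    'D_w (fun y => h (chart_inv c y) : R^o) (c q))); first by rewrite -e.
  by rewrite mulrDr; congr (_ + _); rewrite -[_ *: _]/(_ * _) mulrCA.
move=> f h Cf Ch.
have := @deriveM _ _ (fun y => f (chart_inv c y) : R^o)
    (fun y => h (chart_inv c y) : R^o) (c q) w (df f Cf) (df h Ch).
rewrite chart_mapK// => e.
transitivity (a * (f q * 'D_w (fun y => h (chart_inv c y) : R^o) (c q) +
  h q * 'D_w (fun y => f (chart_inv c y) : R^o) (c q))); first by rewrite -e.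
ring.
Qed.

(** Coordinates and partial derivatives are multiplied by a cutoff [b] to become global objects;
    they are dual to each other only near [p0], where [b = 1]. *)
Lemma local_frame c p0 : atlas c -> dom c p0 ->
  exists x : 'I_m -> M -> R, exists E : 'I_m -> vfield R M,
  [/\ forall i, C (x i), forall i, vector_field C (E i),
      \forall q \near p0, forall i, x i q = c q 0 i &
      \forall q \near p0, [/\ dom c q,
        forall v, tangent C q v -> v = \sum_i v (x i) *: E i q,
        forall i j, E i q (x j) = (i == j)%:R
      & forall i f, C f -> E i q f =
          'D_(delta_mx 0 i) (fun y => f (chart_inv c y) : R^o) (c q)]].
Proof.
move=> ac cp; have oT := @openT 'rV[R]_m.
have nT : nbhs p0 setT by exact: filterT.
have [b [K [sb b01 b1 [cK Kc KV bK]]]] := chart_cutoff cp nT.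
have sk (k : 'rV[R]_m -> R^o) : smooth_on (cod c) k -> C (extend0 c (fun y => b y * k y)).
  move=> sk; apply: (smooth_extend0 (k := (fun y => b y * k y : R^o)) ac cK Kc).
    exact: (smooth_onM (@cod_open _ _ _ c) (smooth_on_subT (U := cod c) sb) sk).
  by move=> y; rewrite mulf_eq0 negb_or => /andP[/bK].
pose x i := extend0 c (fun y : 'rV[R]_m => b y * y 0 i).
pose D i f y := 'D_(delta_mx 0 i) (fun y => f (chart_inv c y) : R^o) y.
pose E (i : 'I_m) (q : M) f : R := if `[< C f >] then extend0 c (fun y => b y * D i f y) q else 0.
have Cx i : C (x i).
  exact: (sk (fun y => y 0 i) (smooth_on_linear i (@cod_open _ _ _ c))).
have sD i f : C f -> smooth_on (cod c) (D i f).
  by move=> Cf; exact: (smooth_on_derive (delta_mx 0 i) (Cf c ac)).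
exists x, E.
have xnear q : dom c q -> (\forall y \near c q, b y = 1) ->
    forall i, \forall y \near c q, x i (chart_inv c y) = y 0 i.
  move=> cq b1q i; near=> y.
  have cy : cod c y by near: y; apply: near_cod; exact: chart_map_cod.
  rewrite /x extend0E; last exact: chart_inv_dom.
  rewrite chart_invK//; suff -> : b y = 1 by rewrite mul1r.
  by near: y.
have En q : dom c q -> (\forall y \near c q, b y = 1) -> forall i f, C f -> E i q f = D i f (c q).
  move=> cq b1q i f Cf; rewrite /E asboolT// extend0E//.
  by rewrite (nbhs_singleton b1q) mul1r.
split; first exact: Cx.
- move=> i; split=> [q|f Cf]; last first.
    by rewrite (_ : (fun _ => _) = extend0 c (fun y => b y * D i f y));
      [exact: (sk _ (sD i f Cf))|apply/funext => q; rewrite /E asboolT].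
  have [cq|ncq] := pselect (dom c q).
    have := tangent_derive (delta_mx 0 i) (b (c q)) ac cq.
    rewrite (_ : (fun _ => _) = E i q)//; apply/funext => f.
    by rewrite /E; case: asboolP => // _; rewrite extend0E.
  rewrite (_ : E i q = 0); first exact: tangent0.
  by apply/funext => f; rewrite /E /extend0 (asboolF ncq); case: ifP.
- apply: filter_forall => i; near=> q.
  rewrite /x extend0E; last by near: q; exact: near_dom.
  suff -> : b (c q) = 1 by rewrite mul1r.
  by near: q; exact: (near_chart (P := fun y => b y = 1) cp b1).
- near=> q.
  have cq : dom c q by near: q; exact: near_dom.
  (* Differentiating at [c q] requires [b = 1] around [c q] and not just at it, hence the iterated
     neighborhood. *)
  have b1q : \forall y \near c q, b y = 1.
    near: q; apply: (near_chart (P := fun z => \forall y \near z, b y = 1) cp).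
    exact: (near_join b1).
  split; first exact: cq.
  + move=> v tv; apply: (tangent_eq (C := C) tv).
      apply: tangent_sum => i; rewrite (_ : E i q =
        (fun f => if `[< C f >] then b (c q) * 'D_(delta_mx 0 i) (fun y => f (chart_inv c y) : R^o) (c q) else 0)).
        exact: tangent_derive.
      by apply/funext => f; rewrite /E; case: asboolP => // _; rewrite extend0E.
    move=> f Cf; rewrite (tangent_chart ac cq tv sb b1q cK Kc bK Cf) sum_tvecE.
    rewrite (derive_dirE _ (@cod_open _ _ _ c) (chart_map_cod cq) (Cf c ac)).
    by apply: eq_bigr => i _; rewrite mxE (En q cq b1q i f Cf).
  + move=> i j; rewrite (En q cq b1q i (x j) (Cx j)) /D.
    rewrite (near_eq_derive (g := fun y : 'rV[R]_m => y 0 j : R^o) _ (xnear q cq b1q j)).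
    by rewrite derive_coordE mxE eqxx /= eq_sym.
  + by move=> i f Cf; rewrite (En q cq b1q i f Cf).
Unshelve. all: by end_near. Qed.

End Frame.

(** * Pullbacks, differentials and vertical vectors *)

Section SmoothMap.
Variables (R : realType) (m n : nat) (M : manifold R m) (N : manifold R n) (pi : M -> N).
Hypothesis spi : smooth_map pi.
Notation dpi := (differential (smooth_fun N) pi).

Lemma smooth_map_open (c : chart R M m) (d : chart R N n) :
  open [set y | cod c y /\ dom d (pi (chart_inv c y))].
Proof.
apply: (@open_preimage_on _ _ (pi \o chart_inv c)); [exact: cod_open|exact: dom_open|].
move=> y cy; apply: continuous_comp; first exact: chart_inv_cont.
by case: spi => + _; apply.
Qed.

Lemma smooth_fun_pullback (h : N -> R) : smooth_fun N h -> smooth_fun M (h \o pi).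
Proof.
move=> Ch; apply: smooth_funP => p.
have [c ac cp] := atlas_cover p; have [d ad dp] := atlas_cover (pi p).
have oW := @smooth_map_open c d.
exists c; split=> //; exists [set y | cod c y /\ dom d (pi (chart_inv c y))].
  by split=> //; split; [exact: chart_map_cod|rewrite chart_mapK].
apply: (smooth_on_eq (f := (fun z => h (chart_inv d z)) \o (d \o pi \o chart_inv c))) => //.
  by move=> y [cy dy] /=; rewrite chart_mapK.
apply: (smooth_on_comp oW (@cod_open _ _ _ d)); last exact: (Ch d ad).
  by move=> y [cy dy]; exact: chart_map_cod.
by case: spi => _; apply.
Qed.

Lemma differentialE (v : tvec R M) h : smooth_fun N h -> dpi v h = v (h \o pi).
Proof. by move=> Ch; rewrite /differential asboolT. Qed.

Lemma tangent_differential p (v : tvec R M) : tangent (smooth_fun M) p v ->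
  tangent (smooth_fun N) (pi p) (dpi v).
Proof.
move=> [_ vl vm]; apply: (tangent_extend (C := smooth_fun N) (@smooth_fun_cst _ _ N) (@smooth_funD _ _ N)
  (@smooth_funM _ _ N) (D := fun h => v (h \o pi))).
  move=> a f h /smooth_fun_pullback Cf /smooth_fun_pullback Ch; exact: (vl a _ _ Cf Ch).
by move=> f h /smooth_fun_pullback Cf /smooth_fun_pullback Ch; exact: (vm _ _ Cf Ch).
Qed.

Lemma differential_comb (a : R) (u v : tvec R M) : dpi (a *: u + v) = a *: dpi u + dpi v.
Proof.
apply/funext => h; rewrite -[RHS]/(a * dpi u h + dpi v h) /differential.
by case: asboolP => // _; rewrite mulr0 addr0.
Qed.

Lemma differential0 : dpi 0 = 0.
Proof. by apply/funext => h; rewrite /differential; case: asboolP. Qed.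

Lemma differential_sum (I : Type) (r : seq I) (a : I -> R) (e : I -> tvec R M) :
  dpi (\sum_(i <- r) a i *: e i) = \sum_(i <- r) a i *: dpi (e i).
Proof.
elim: r => [|i r IH]; first by rewrite !big_nil differential0.
by rewrite !big_cons differential_comb IH.
Qed.

Lemma vertical_pullback p v h : vertical pi p v -> smooth_fun N h -> v (h \o pi) = 0.
Proof. by move=> [_ dv] Ch; rewrite -differentialE// dv. Qed.

Lemma verticalP p v : tangent (smooth_fun M) p v ->
  (forall h, smooth_fun N h -> v (h \o pi) = 0) -> vertical pi p v.
Proof.
move=> tv H; split=> //; apply/funext => h; rewrite /differential.
by case: asboolP => // Ch; rewrite H.
Qed.

End SmoothMap.

Lemma unitmx_inj (R : fieldType) (n : nat) (A : 'M[R]_n) :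
  (forall u : 'rV[R]_n, u *m A = 0 -> u = 0) -> A \in unitmx.
Proof.
move=> H; rewrite -row_free_unit -kermx_eq0; apply/rowV0P => v /sub_kermxP; exact: H.
Qed.

(** * Points where the differential has full rank *)

Section Rank.
Variables (R : realType) (m n : nat) (M : manifold R m) (N : manifold R n) (pi : M -> N).
Hypothesis spi : smooth_map pi.
Variable p : M.
Hypothesis rk : has_rank (smooth_fun M) (smooth_fun N) pi p n.
Notation dpi := (differential (smooth_fun N) pi).

(** The matrix is that of the vectors [dpi (e i)] in the coordinates [x]. They are [n] independent
    vectors in a space of dimension [n], so it is invertible. *)
Lemma rank_matrix (d : chart R N n) : atlas d -> dom d (pi p) ->
  exists e : 'I_n -> tvec R M, exists x : 'I_n -> N -> R,
  [/\ forall i, tangent (smooth_fun M) p (e i), forall j, smooth_fun N (x j),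
      \forall q \near pi p, forall j, x j q = d q 0 j,
      forall u v, tangent (smooth_fun N) (pi p) u -> tangent (smooth_fun N) (pi p) v ->
        (forall j, u (x j) = v (x j)) -> u = v
    & (\matrix_(i, j) e i (x j \o pi)) \in unitmx].
Proof.
move=> ad dp; have [x [E [Cx vE xd fr]]] := local_frame ad dp.
have [_ frE _ _] := nbhs_singleton fr.
have [e [te li _]] := rk; exists e, x.
have uniq : forall u v, tangent (smooth_fun N) (pi p) u -> tangent (smooth_fun N) (pi p) v ->
    (forall j, u (x j) = v (x j)) -> u = v.
  by move=> u v tu tv uv; rewrite (frE u tu) (frE v tv); apply: eq_bigr => j _; rewrite uv.
split; [exact: te|exact: Cx|exact: xd|exact: uniq|].
apply: unitmx_inj => u uA; apply/rowP => i; rewrite [RHS]mxE.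
apply: (li (fun i => u 0 i)); rewrite -differential_sum.
apply: (uniq); last 1 first.
- move=> j; rewrite (differentialE _ _ (Cx j)) sum_tvecE.
  have /rowP/(_ j) := uA; rewrite !mxE => h; rewrite [RHS]/=.
  by rewrite -[RHS]h; apply: eq_bigr => k _; rewrite mxE.
- by apply: tangent_differential => //; exact: tangent_sum.
- exact: tangent0.
Qed.

Lemma differential_surj (w : tvec R N) : tangent (smooth_fun N) (pi p) w ->
  exists2 v, tangent (smooth_fun M) p v & dpi v = w.
Proof.
move=> tw; have [d ad dp] := atlas_cover (pi p).
have [e [x [te Cx _ uniq Au]]] := rank_matrix ad dp.
set A := (\matrix_(_, _) _) in Au.
pose a : 'rV[R]_n := (\row_j w (x j)) *m invmx A.
have tv : tangent (smooth_fun M) p (\sum_i a 0 i *: e i) by exact: tangent_sum.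
exists (\sum_i a 0 i *: e i) => //.
apply: uniq => //; first exact: tangent_differential.
move=> j; rewrite (differentialE _ _ (Cx j)) sum_tvecE.
transitivity ((a *m A) 0 j); first by rewrite [RHS]mxE; apply: eq_bigr => k _; rewrite [A k j]mxE.
by rewrite /a mulmxKV// mxE.
Qed.

(* In other words, a vertical vector is tangent to the fiber. *)
Lemma vertical_fiber v (F : M -> R) : vertical pi p v -> smooth_fun M F ->
  (\forall q \near p, pi q = pi p -> F q = 0) -> v F = 0.
Proof.
move=> vv CF nF; have [tv _] := vv.
have [d ad dp] := atlas_cover (pi p); have [c ac cp] := atlas_cover p.
have [e [x [te Cx xd uniq Au]]] := rank_matrix ad dp.
set A := (\matrix_(_, _) _) in Au.
have nT : nbhs p setT by exact: filterT.
have [b [K [sb b01 b1 [cK Kc _ bK]]]] := chart_cutoff cp nT.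
pose w (u : tvec R M) : 'rV[R]_m := \row_i u (extend0 c (fun y => b y * y 0 i)).
have wE u : tangent (smooth_fun M) p u -> forall f, smooth_fun M f ->
    u f = 'D_(w u) (fun y => f (chart_inv c y) : R^o) (c p).
  by move=> tu f Cf; exact: (tangent_chart ac cp tu sb b1 cK Kc bK Cf).
pose U := [set y | cod c y /\ dom d (pi (chart_inv c y))].
have oU : open U by exact: smooth_map_open.
have Up : U (c p) by split; [exact: chart_map_cod|rewrite chart_mapK].
pose phi := d \o pi \o chart_inv c.
have sphi : smooth_on U phi by case: spi => _; apply.
have xphi j : \forall y \near c p, (x j \o pi) (chart_inv c y) = phi y 0 j.
  near=> y; rewrite /phi /=.
  suff : forall j, x j (pi (chart_inv c y)) = d (pi (chart_inv c y)) 0 j by [].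
  near: y; apply: (near_chart_inv (P := fun q => forall j, x j (pi q) = d (pi q) 0 j) cp).
  by case: spi => cpi _; have /(_ _ xd) := cpi p; exact.
have Dphi u : tangent (smooth_fun M) p u -> 'D_(w u) phi (c p) = \row_j u (x j \o pi).
  move=> tu; apply/rowP => j; rewrite mxE (wE u tu _ (smooth_fun_pullback spi (Cx j))).
  rewrite -derive_coord; last exact: (smooth_on_derivable sphi Up).
  by apply/esym; apply: near_eq_derive; exact: xphi.
(* The rows are the chart components of the [e i]; the differential of [phi] sends them to the rows
   of [A]. *)
pose W := \matrix_i w (e i).
have DW (u : 'rV[R]_n) : 'D_(u *m W) phi (c p) = u *m A.
  pose J := \matrix_(k, j) ('D_(delta_mx 0 k) phi (c p)) 0 j.
  have DJ z : 'D_z phi (c p) = z *m J.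
    apply/rowP => j; rewrite !mxE -derive_coord; last exact: (smooth_on_derivable sphi Up).
    rewrite (derive_dirE _ oU Up); last exact: smooth_on_coord.
    apply: eq_bigr => k _; rewrite [in RHS]mxE derive_coord//.
    exact: (smooth_on_derivable sphi Up).
  rewrite DJ -mulmxA; congr (_ *m _); apply/row_matrixP => i.
  rewrite row_mul rowK -DJ Dphi//; apply/rowP => j; rewrite !mxE//.
(* The linear right inverse of the differential needed to move along the level set of [phi]. *)
have phiB (u : 'rV[R]_n) : 'D_(u *m (invmx A *m W)) phi (c p) = u.
  by rewrite mulmxA DW mulmxKV.
rewrite (wE v tv F CF).
apply: (derive_kernel_eq0 oU Up sphi phiB).
- by apply: smooth_on_sub (CF c ac) => y [].
- by rewrite Dphi//; apply/rowP => j; rewrite !mxE; exact: (vertical_pullback vv (Cx j)).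
- near=> y => phiy.
  have dy : dom d (pi (chart_inv c y)).
    suff [] : U y by [].
    by near: y; exact: open_nbhs_nbhs.
  have piy : pi (chart_inv c y) = pi p.
    rewrite -(chart_mapK dy) -(chart_mapK dp); congr (chart_inv d _).
    by move: phiy; rewrite /phi /= chart_mapK.
  move: piy; near: y.
  exact: (near_chart_inv (P := fun q => pi q = pi p -> F q = 0) cp nF).
Unshelve. all: by end_near. Qed.

End Rank.

(* What the tensor calculus below needs to know about the smooth functions of an
   m-manifold; [sa_frame] says that there are local coordinates x with dual frame E. *)
Record smooth_algebra (R : realType) (T : topologicalType) (C : set (T -> R)) (m : nat) :
    Prop := SmoothAlgebra {
  sa_cst : forall a : R, C (fun=> a);
  sa_add : forall f h, C f -> C h -> C (fun q => f q + h q);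
  sa_mul : forall f h, C f -> C h -> C (fun q => f q * h q);
  sa_inv : forall f, C f -> (forall q, f q != 0) -> C (fun q => (f q)^-1);
  sa_neq0 : forall f (p : T), C f -> f p != 0 -> \forall q \near p, f q != 0;
  sa_local : forall f, (forall p : T, exists2 F, C F & \forall q \near p, f q = F q) -> C f;
  sa_bump : forall (p : T) (V : set T), nbhs p V -> exists chi : T -> R,
    [/\ C chi, forall q, 0 <= chi q <= 1, \forall q \near p, chi q = 1
      & forall q, chi q != 0 -> V q];
  sa_frame : forall p0 : T, exists x : 'I_m -> T -> R, exists E : 'I_m -> vfield R T,
    [/\ forall i, C (x i), forall i, vector_field C (E i) & \forall q \near p0,
      (forall v, tangent C q v -> v = \sum_i v (x i) *: E i q) /\
      forall i j, E i q (x j) = (i == j)%:R]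
}.

Lemma manifold_smooth_algebra (R : realType) (m : nat) (M : manifold R m) :
  smooth_algebra (smooth_fun M) m.
Proof.
split; [exact: smooth_fun_cst|exact: smooth_funD|exact: smooth_funM|exact: smooth_funV| |
  exact: smooth_fun_local|exact: bump_fun|].
- move=> f p Cf fp; have [c ac cp] := atlas_cover p.
  have fc := smooth_on_continuous (Cf c ac) (chart_map_cod cp).
  have n0 : \forall y \near c p, f (chart_inv c y) != 0.
    have /(_ [set z | z != 0]) := fc; apply; apply: open_nbhs_nbhs; split.
      exact: open_neq.
    by rewrite /= chart_mapK.
  have := near_chart (P := fun y => f (chart_inv c y) != 0) cp n0.
  move=> n1; near=> q.
  have cq : dom c q by near: q; exact: near_dom.
  suff : f (chart_inv c (c q)) != 0 by rewrite chart_mapK.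
  by near: q.
- move=> p0; have [c ac cp] := atlas_cover p0.
  have [x [E [Cx vE _ fr]]] := local_frame ac cp; exists x, E; split; [exact: Cx|exact: vE|].
  by apply: filterS fr => q [].
Unshelve. all: by end_near. Qed.

(** * Vector fields over an algebra of smooth functions *)

Section SmoothAlgebra.
Variables (R : realType) (T : topologicalType) (C : set (T -> R)) (m : nat).
Hypothesis A : smooth_algebra C m.
Implicit Types (p q : T) (f h : T -> R) (u v w : tvec R T) (X Y Z W : vfield R T).

Let C1 := sa_cst A. Let CD := sa_add A. Let CM := sa_mul A.

Lemma sa_sub f h : C f -> C h -> C (fun q => f q - h q).
Proof.
move=> Cf Ch; have := CD Cf (CM (C1 (-1)) Ch).
by rewrite (_ : (fun _ => _) = fun q => f q - h q)//; apply/funext => q; rewrite mulN1r.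
Qed.

Lemma sa_sum (I : Type) (r : seq I) (f : I -> T -> R) :
  (forall i, C (f i)) -> C (fun p => \sum_(i <- r) f i p).
Proof.
move=> sf; elim: r => [|i r IH].
  by rewrite (_ : (fun _ => _) = fun=> 0)//; apply/funext => x; rewrite big_nil.
rewrite (_ : (fun _ => _) = fun p => f i p + \sum_(j <- r) f j p); first exact: CD.
by apply/funext => x; rewrite big_cons.
Qed.

Lemma sa_prod (I : Type) (r : seq I) (f : I -> T -> R) :
  (forall i, C (f i)) -> C (fun p => \prod_(i <- r) f i p).
Proof.
move=> sf; elim: r => [|i r IH].
  by rewrite (_ : (fun _ => _) = fun=> 1)//; apply/funext => x; rewrite big_nil.
rewrite (_ : (fun _ => _) = fun p => f i p * \prod_(j <- r) f j p); first exact: CM.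
by apply/funext => x; rewrite big_cons.
Qed.

Lemma sa_det n (G : T -> 'M[R]_n) : (forall i j, C (fun q => G q i j)) ->
  C (fun q => \det (G q)).
Proof.
move=> CG; rewrite /determinant; apply: sa_sum => s; apply: CM; first exact: C1.
by apply: sa_prod => i; exact: CG.
Qed.

Lemma sa_adj n (G : T -> 'M[R]_n) i j : (forall i j, C (fun q => G q i j)) ->
  C (fun q => (\adj (G q)) i j).
Proof.
move=> CG; rewrite (_ : (fun _ => _) =
  fun q => (-1) ^+ (j + i) * \det (row' j (col' i (G q)))); last first.
  by apply/funext => q; rewrite mxE.
apply: CM; first exact: C1.
apply: sa_det => k l; rewrite (_ : (fun _ => _) = fun q => G q (lift j k) (lift i l))//.
by apply/funext => q; rewrite !mxE.
Qed.

(** The denominator [D], equal to [f ^ 2 + (1 - chi)], is positive everywhere: [chi] is supported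
    where [f] does not vanish. Near [p] it is [f ^ 2], so [f / D] is the reciprocal there. *)
Lemma recip_near f p : C f -> f p != 0 ->
  exists2 h, C h & \forall q \near p, h q * f q = 1.
Proof.
move=> Cf fp; have [chi [Cchi chi01 chi1 chi0]] := sa_bump A (sa_neq0 A Cf fp).
pose D q := f q * f q + (1 - chi q).
have CDn : C D by apply: CD; [exact: CM|apply: sa_sub].
have D0 q : D q != 0.
  have /andP[c0 c1] := chi01 q; rewrite gt_eqF// /D.
  case: (eqVneq (chi q) 0) => [->|/chi0 fq].
    by rewrite subr0 ltr_wpDl// -expr2 sqr_ge0.
  by rewrite ltr_pwDl ?subr_ge0// -expr2 lt0r sqr_ge0 expf_neq0.
exists (fun q => f q * (D q)^-1); first by apply: CM => //; exact: (sa_inv A).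
near=> q; have chiq : chi q = 1 by near: q.
have fq : f q != 0 by apply: chi0; rewrite chiq oner_eq0.
by rewrite /D chiq subrr addr0 invfM mulrA divff// mul1r mulVf.
Unshelve. all: by end_near. Qed.

Lemma vf_tangent X p : vector_field C X -> tangent C p (X p).
Proof. by case. Qed.

Lemma vf_C X f : vector_field C X -> C f -> C (fun q => X q f).
Proof. by case=> _; exact. Qed.

Lemma vf0 : vector_field C 0.
Proof. by split=> [p|f _]; [exact: tangent0|exact: C1]. Qed.

Lemma vf_comb f X Y : C f -> vector_field C X -> vector_field C Y ->
  vector_field C (fun q => f q *: X q + Y q).
Proof.
move=> Cf vX vY; split=> [p|h Ch]; first by apply: tangent_comb; exact: vf_tangent.
by apply: CD; [apply: CM => //; exact: vf_C|exact: vf_C].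
Qed.

Lemma vfZ f X : C f -> vector_field C X -> vector_field C (fun q => f q *: X q).
Proof.
move=> Cf vX; have := vf_comb Cf vX vf0.
by rewrite (_ : (fun _ => _) = fun q => f q *: X q)//; apply/funext => q; rewrite addr0.
Qed.

Lemma vfD X Y : vector_field C X -> vector_field C Y -> vector_field C (fun q => X q + Y q).
Proof.
move=> vX vY; have := vf_comb (C1 1) vX vY.
by rewrite (_ : (fun _ => _) = fun q => X q + Y q)//; apply/funext => q; rewrite scale1r.
Qed.

Lemma vfB X Y : vector_field C X -> vector_field C Y -> vector_field C (fun q => X q - Y q).
Proof.
move=> vX vY; have := vfD vX (vfZ (C1 (-1)) vY).
by rewrite (_ : (fun _ => _) = fun q => X q - Y q)//; apply/funext => q; rewrite scaleN1r.
Qed.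

Lemma vf_sum (I : Type) (r : seq I) (f : I -> T -> R) (X : I -> vfield R T) :
  (forall i, C (f i)) -> (forall i, vector_field C (X i)) ->
  vector_field C (fun q => \sum_(i <- r) f i q *: X i q).
Proof.
move=> Cf vX; elim: r => [|i r IH].
  by rewrite (_ : (fun _ => _) = 0); [exact: vf0|apply/funext => q; rewrite big_nil].
rewrite (_ : (fun _ => _) = fun q => f i q *: X i q + \sum_(j <- r) f j q *: X j q).
  exact: vf_comb.
by apply/funext => q; rewrite big_cons.
Qed.

Lemma vf_local X : (forall p, tangent C p (X p)) ->
  (forall p, exists2 Y, vector_field C Y & \forall q \near p, X q = Y q) -> vector_field C X.
Proof.
move=> tX H; split=> // f Cf; apply: (sa_local A) => p; have [Y vY XY] := H p.
by exists (fun q => Y q f); [exact: vf_C|apply: filterS XY => q ->].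
Qed.

Lemma tangent_field p v : tangent C p v -> exists2 X, vector_field C X & X p = v.
Proof.
move=> tv; have [x [E [Cx vE /nbhs_singleton[fr _]]]] := sa_frame A p.
exists (fun q => \sum_i v (x i) *: E i q); last by rewrite -fr.
by apply: (vf_sum _ (f := fun i => fun=> v (x i))).
Qed.

Lemma vf_lie X Y : vector_field C X -> vector_field C Y -> vector_field C (lie_bracket X Y).
Proof.
move=> vX vY; split=> [p|f Cf]; last by apply: sa_sub; apply: vf_C => //; exact: vf_C.
have tX := vf_tangent p vX; have tY := vf_tangent p vY.
split=> [f nCf|a f h Cf Ch|f h Cf Ch]; rewrite /lie_bracket.
- rewrite (_ : (fun q => Y q f) = fun=> 0); last first.
    by apply/funext => q; have [-> //] := vf_tangent q vY.
  rewrite (_ : (fun q => X q f) = fun=> 0); last first.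
    by apply/funext => q; have [-> //] := vf_tangent q vX.
  by rewrite (tangent_cst C1 0 tX) (tangent_cst C1 0 tY) subrr.
- have E W : vector_field C W ->
    (fun q => W q (fun q0 => a * f q0 + h q0)) = fun q => a * W q f + W q h.
    by move=> vW; apply/funext => q; have [_ -> //] := vf_tangent q vW.
  rewrite (E _ vX) (E _ vY); have [_ lX _] := tX; have [_ lY _] := tY.
  rewrite lX; [|exact: vf_C|exact: vf_C]; rewrite lY; [|exact: vf_C|exact: vf_C]; ring.
- have E W : vector_field C W ->
    (fun q => W q (fun q0 => f q0 * h q0)) = fun q => W q f * h q + f q * W q h.
    by move=> vW; apply/funext => q; exact: tangent_mul (vf_tangent q vW) _ _.
  have CX k : C k -> C (fun q => X q k) by exact: vf_C.
  have CY k : C k -> C (fun q => Y q k) by exact: vf_C.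
  rewrite (E _ vX) (E _ vY).
  rewrite (tangent_add tX (CM (CY _ Cf) Ch) (CM Cf (CY _ Ch))).
  rewrite (tangent_add tY (CM (CX _ Cf) Ch) (CM Cf (CX _ Ch))).
  rewrite (tangent_mul tX (CY _ Cf) Ch) (tangent_mul tX Cf (CY _ Ch)).
  rewrite (tangent_mul tY (CX _ Cf) Ch) (tangent_mul tY Cf (CX _ Ch)).
  ring.
Qed.

Lemma lieC X Y p : lie_bracket X Y p = - lie_bracket Y X p.
Proof. by apply/funext => f; rewrite /lie_bracket -[RHS]/(- (_ - _)) opprB. Qed.

Lemma lie_combl f X W Y p : C f -> vector_field C X -> vector_field C W -> vector_field C Y ->
  lie_bracket (fun q => f q *: X q + W q) Y p =
  f p *: lie_bracket X Y p - Y p f *: X p + lie_bracket W Y p.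
Proof.
move=> Cf vX vW vY; have vfX := vf_comb Cf vX vW.
have tY := vf_tangent p vY.
apply: (tangent_eq (C := C) (p := p)).
- exact: vf_tangent (vf_lie vfX vY).
- apply: tangentD; last exact: vf_tangent (vf_lie vW vY).
  by apply: tangentB; apply: tangentZ; [exact: vf_tangent (vf_lie vX vY)|exact: vf_tangent].
move=> h Ch; rewrite /lie_bracket.
rewrite -[RHS]/(f p * (X p (fun q => Y q h) - Y p (fun q => X q h)) - Y p f * X p h +
  (W p (fun q => Y q h) - Y p (fun q => W q h))).
rewrite -[X in X - _]/(f p * X p (fun q => Y q h) + W p (fun q => Y q h)).
have -> : Y p (fun q => (f q *: X q + W q) h) =
    Y p f * X p h + f p * Y p (fun q => X q h) + Y p (fun q => W q h).
  rewrite -(tangent_mul tY Cf (vf_C vX Ch)) -(tangent_add tY)//.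
  - by apply: CM => //; exact: vf_C.
  - exact: vf_C.
ring.
Qed.

End SmoothAlgebra.

(** * Gradients and Levi-Civita connections *)

Section Metric.
Variables (R : realType) (T : topologicalType) (C : set (T -> R)) (m : nat).
Hypothesis A : smooth_algebra C m.
Variable g : mtensor R T.
Hypothesis hg : riemannian_metric C g.
Implicit Types (p q : T) (f h : T -> R) (u v w : tvec R T) (X Y Z W : vfield R T).

Let C1 := sa_cst A. Let CD := sa_add A. Let CM := sa_mul A.

Lemma metric_sym p u v : tangent C p u -> tangent C p v -> g p u v = g p v u.
Proof. by case: hg => H _ _ _; exact: H. Qed.

Lemma metric_combl p a u v w : tangent C p u -> tangent C p v -> tangent C p w ->
  g p (a *: u + v) w = a * g p u w + g p v w.
Proof. by case: hg => _ H _ _; exact: H. Qed.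

Lemma metric_combr p a u v w : tangent C p u -> tangent C p v -> tangent C p w ->
  g p w (a *: u + v) = a * g p w u + g p w v.
Proof.
move=> tu tv tw; rewrite (metric_sym tw (tangent_comb a tu tv)) metric_combl//.
by rewrite (metric_sym tu tw) (metric_sym tv tw).
Qed.

Lemma metric_0l p w : tangent C p w -> g p 0 w = 0.
Proof.
move=> tw; have t0 := tangent0 C p.
by have := metric_combl (-1) t0 t0 tw; rewrite scaler0 add0r mulN1r addNr.
Qed.

Lemma metric_Zl p a u w : tangent C p u -> tangent C p w -> g p (a *: u) w = a * g p u w.
Proof.
move=> tu tw; have t0 := tangent0 C p.
by have := metric_combl a tu t0 tw; rewrite metric_0l// !addr0.
Qed.

Lemma metric_Dl p u v w : tangent C p u -> tangent C p v -> tangent C p w ->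
  g p (u + v) w = g p u w + g p v w.
Proof. by move=> tu tv tw; have := metric_combl 1 tu tv tw; rewrite scale1r mul1r. Qed.

Lemma metric_Bl p u v w : tangent C p u -> tangent C p v -> tangent C p w ->
  g p (u - v) w = g p u w - g p v w.
Proof.
move=> tu tv tw; have := metric_combl (-1) tv tu tw.
by rewrite scaleN1r mulN1r addrC => ->; rewrite addrC.
Qed.

Lemma metric_Nl p u w : tangent C p u -> tangent C p w -> g p (- u) w = - g p u w.
Proof. by move=> tu tw; rewrite -scaleN1r metric_Zl// mulN1r. Qed.

Lemma metric_suml p (I : Type) (r : seq I) (a : I -> R) (e : I -> tvec R T) w :
  (forall i, tangent C p (e i)) -> tangent C p w ->
  g p (\sum_(i <- r) a i *: e i) w = \sum_(i <- r) a i * g p (e i) w.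
Proof.
move=> te tw; elim: r => [|i r IH]; first by rewrite !big_nil metric_0l.
by rewrite !big_cons metric_combl ?IH//; exact: tangent_sum.
Qed.

Lemma metric_eq0 p u : tangent C p u -> g p u u = 0 -> u = 0.
Proof.
move=> tu gu; apply: contrapT => u0; case: hg => _ _ pos _.
by have := pos p u tu u0; rewrite gu ltxx.
Qed.

Lemma metric_nondegenerate p u v : tangent C p u -> tangent C p v ->
  (forall w, tangent C p w -> g p u w = g p v w) -> u = v.
Proof.
move=> tu tv H; apply/eqP; rewrite -subr_eq0; apply/eqP.
have tuv := tangentB tu tv.
by apply: (metric_eq0 tuv); rewrite (metric_Bl tu tv tuv) (H _ tuv) subrr.
Qed.

Lemma metric_nondegenerate_field p u v : tangent C p u -> tangent C p v ->
  (forall X, vector_field C X -> g p u (X p) = g p v (X p)) -> u = v.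
Proof.
move=> tu tv H; apply: (@metric_nondegenerate p) => // w tw.
by have [X vX <-] := tangent_field A tw; exact: H.
Qed.

Definition gfun X Y : T -> R := fun q => g q (X q) (Y q).

Lemma C_gfun X Y : vector_field C X -> vector_field C Y -> C (gfun X Y).
Proof. by case: hg => _ _ _ H; exact: H. Qed.

Lemma gfunC X Y : vector_field C X -> vector_field C Y -> gfun X Y = gfun Y X.
Proof. by move=> vX vY; apply/funext => q; apply: metric_sym; exact: vf_tangent. Qed.

(** * Representation of [C]-linear forms by the metric *)

Section Riesz.
Variable alpha : vfield R T -> T -> R.
Hypothesis alphaC : forall X, vector_field C X -> C (alpha X).
Hypothesis alpha_comb : forall f X Y, C f -> vector_field C X -> vector_field C Y ->
  forall p, alpha (fun q => f q *: X q + Y q) p = f p * alpha X p + alpha Y p.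

Lemma tensorial0 p : alpha 0 p = 0.
Proof.
have := alpha_comb (C1 (-1)) (vf0 A) (vf0 A) p.
rewrite (_ : (fun _ => _) = 0); first by rewrite mulN1r addNr.
by apply/funext => q; rewrite scaler0 addr0.
Qed.

Lemma tensorialB X Y p : vector_field C X -> vector_field C Y ->
  alpha (fun q => X q - Y q) p = alpha X p - alpha Y p.
Proof.
move=> vX vY; have := alpha_comb (C1 (-1)) vY vX p.
rewrite (_ : (fun _ => _) = fun q => X q - Y q); first by move=> ->; rewrite mulN1r addrC.
by apply/funext => q; rewrite scaleN1r addrC.
Qed.

(** The form acts on global fields only; its locality follows from linearity over [C], applied to a
    bump times [X - Y], which is the zero field. *)
Lemma tensorial_near X Y p : vector_field C X -> vector_field C Y ->
  (\forall q \near p, X q = Y q) -> alpha X p = alpha Y p.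
Proof.
move=> vX vY XY; have [chi [Cchi _ chi1 chiV]] := sa_bump A XY.
apply/eqP; rewrite -subr_eq0 -tensorialB//.
have vXY := vfB A vX vY.
have := alpha_comb Cchi vXY (vf0 A) p.
rewrite (_ : (fun _ => _) = 0); last first.
  apply/funext => q; have [->|/chiV ->] := eqVneq (chi q) 0; first by rewrite scale0r addr0.
  by rewrite subrr scaler0 addr0.
by rewrite tensorial0 addr0 (nbhs_singleton chi1) mul1r => <-.
Qed.

Lemma tensorial_sum (I : Type) (r : seq I) (f : I -> T -> R) (X : I -> vfield R T) p :
  (forall i, C (f i)) -> (forall i, vector_field C (X i)) ->
  alpha (fun q => \sum_(i <- r) f i q *: X i q) p = \sum_(i <- r) f i p * alpha (X i) p.
Proof.
move=> Cf vX; elim: r => [|i r IH].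
  rewrite big_nil (_ : (fun _ => _) = 0) ?tensorial0//.
  by apply/funext => q; rewrite big_nil.
rewrite big_cons (_ : (fun _ => _) = fun q => f i q *: X i q + \sum_(j <- r) f j q *: X j q).
  by rewrite alpha_comb ?IH//; exact: (vf_sum A).
by apply/funext => q; rewrite big_cons.
Qed.

(** Solves the Gram system of a local frame. The Gram matrix is invertible because [g] is
    definite. *)
Lemma riesz_local p0 : exists2 W, vector_field C W &
  \forall q \near p0, forall Y, vector_field C Y -> g q (W q) (Y q) = alpha Y q.
Proof.
have [x [E [Cx vE fr]]] := sa_frame A p0.
pose G q := \matrix_(i, j) gfun (E i) (E j) q.
have CG i j : C (fun q => G q i j).
  rewrite (_ : (fun _ => _) = gfun (E i) (E j)); first exact: C_gfun.
  by apply/funext => q; rewrite mxE.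
have Gu q : (forall i j, E i q (x j) = (i == j)%:R) -> G q \in unitmx.
  move=> Ex; apply: unitmx_inj => u uG.
  have tE i : tangent C q (E i q) by exact: vf_tangent.
  have tw : tangent C q (\sum_i u 0 i *: E i q) by exact: tangent_sum.
  have w0 : \sum_i u 0 i *: E i q = 0.
    apply: (metric_eq0 tw); rewrite metric_suml//; apply: big1 => i _.
    rewrite metric_sym// metric_suml//; have /rowP/(_ i) := uG; rewrite !mxE => h.
    rewrite (_ : \sum_(_ <- _) _ = 0) ?mulr0//.
    by rewrite -[RHS]h; apply: eq_bigr => j _; rewrite mxE.
  apply/rowP => j; rewrite mxE.
  have := congr1 (fun v => v (x j)) w0; rewrite sum_tvecE (bigD1 j)//= Ex eqxx mulr1.
  by rewrite big1 ?addr0// => i ij; rewrite Ex (negbTE ij) mulr0.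
have [_ Ex0] := nbhs_singleton fr.
have d0 : \det (G p0) != 0 by have := Gu p0 Ex0; rewrite unitmxE unitfE.
have [h Ch hd] := recip_near A (sa_det A CG) d0.
(* Cramer's rule: adjugate times a local reciprocal of the determinant, so that the coefficients are
   smooth on all of [T]. *)
pose c j q := \sum_i alpha (E i) q * (h q * (\adj (G q)) i j).
have Cc j : C (c j).
  apply: (sa_sum A) => i; apply: CM; first exact: alphaC.
  by apply: CM => //; exact: (sa_adj A).
exists (fun q => \sum_j c j q *: E j q); first exact: (vf_sum A).
(* The frame expansion of [Y] has to hold around [q], because [alpha] at [q] is only known to depend
   on the germ of its argument. *)
have fr2 := near_join fr; near=> q => Y vY.
have [frq Exq] : (forall v, tangent C q v -> v = \sum_i v (x i) *: E i q) /\
  forall i j, E i q (x j) = (i == j)%:R by near: q.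
have hdq : h q * \det (G q) = 1 by near: q.
have frz : \forall z \near q, (forall v, tangent C z v -> v = \sum_i v (x i) *: E i z) /\
  forall i j, E i z (x j) = (i == j)%:R by near: q.
have tE i : tangent C q (E i q) by exact: vf_tangent.
have gWE k : g q (\sum_j c j q *: E j q) (E k q) = alpha (E k) q.
  rewrite metric_suml//.
  have -> : \sum_j c j q * g q (E j q) (E k q) =
      ((\row_i alpha (E i) q) *m ((h q *: \adj (G q)) *m G q)) 0 k.
    rewrite mulmxA mxE; apply: eq_bigr => j _; rewrite !mxE; congr (_ * _).
    by apply: eq_bigr => i _; rewrite !mxE.
  by rewrite -scalemxAl mul_adj_mx scale_scalar_mx hdq mulmx1 mxE.
have tW : tangent C q (\sum_j c j q *: E j q) by exact: tangent_sum.
have YE : \forall z \near q, Y z = \sum_i Y z (x i) *: E i z.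
  apply: filterS frz => z [frz _].
  by apply: frz; exact: vf_tangent.
have CYx i : C (fun z => Y z (x i)) by exact: (vf_C vY (Cx i)).
rewrite (tensorial_near vY (vf_sum A (index_enum _) CYx vE) YE) tensorial_sum//.
rewrite (metric_sym tW (vf_tangent q vY)) {1}(nbhs_singleton YE) metric_suml//.
by apply: eq_bigr => i _; rewrite (metric_sym (tE i) tW) gWE.
Unshelve. all: by end_near. Qed.

(** Nondegeneracy makes the representing vector unique at each point, so the pointwise choice
    coincides near every point with the local solution and is smooth. *)
Lemma riesz : exists2 W, vector_field C W &
  forall p Y, vector_field C Y -> g p (W p) (Y p) = alpha Y p.
Proof.
have /choice[W HW] : forall p, exists w, tangent C p w /\
    forall Y, vector_field C Y -> g p w (Y p) = alpha Y p.
  move=> p; have [W vW /nbhs_singleton HW] := riesz_local p.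
  by exists (W p); split; [exact: vf_tangent|].
exists W; last by move=> p; case: (HW p).
apply: (vf_local A) => p; first by case: (HW p).
have [W' vW' HW'] := riesz_local p; exists W' => //.
apply: filterS HW' => q HW'; have [tW gW] := HW q.
apply: (@metric_nondegenerate_field q) => //; first exact: vf_tangent.
by move=> X vX; rewrite gW// HW'.
Qed.

End Riesz.

Lemma gradient f : C f -> exists2 Z, vector_field C Z &
  forall p v, tangent C p v -> g p (Z p) v = v f.
Proof.
move=> Cf; have [||Z vZ HZ] := @riesz (fun X p => X p f).
- by move=> X vX; exact: (vf_C vX Cf).
- by [].
exists Z => // p v tv; have [X vX <-] := tangent_field A tv; exact: HZ.
Qed.

End Metric.

(** * Existence of the Levi-Civita connection *)

Section LeviCivita.
Variables (R : realType) (T : topologicalType) (C : set (T -> R)) (m : nat).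
Hypothesis A : smooth_algebra C m.
Variable g : mtensor R T.
Hypothesis hg : riemannian_metric C g.
Implicit Types (p q : T) (f h : T -> R) (u v w : tvec R T) (X Y Z W : vfield R T).
Notation vf := (vector_field C).

Lemma derive_gfun_combl p v f X W Y : tangent C p v -> C f -> vf X -> vf W -> vf Y ->
  v (gfun g (fun q => f q *: X q + W q) Y) =
  v f * g p (X p) (Y p) + f p * v (gfun g X Y) + v (gfun g W Y).
Proof.
move=> tv Cf vX vW vY.
have CX := C_gfun hg vX vY; have CW := C_gfun hg vW vY.
rewrite -[g p (X p) (Y p)]/(gfun g X Y p).
rewrite -(tangent_mul tv Cf CX) -(tangent_add tv (sa_mul A Cf CX) CW); congr v.
by apply/funext => q; apply: (metric_combl hg); exact: vf_tangent.
Qed.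

Lemma derive_gfun_combr p v f X W Y : tangent C p v -> C f -> vf X -> vf W -> vf Y ->
  v (gfun g Y (fun q => f q *: X q + W q)) =
  v f * g p (Y p) (X p) + f p * v (gfun g Y X) + v (gfun g Y W).
Proof.
move=> tv Cf vX vW vY; have vXW := vf_comb A Cf vX vW.
rewrite (gfunC hg vY vXW) (gfunC hg vY vX) (gfunC hg vY vW) (derive_gfun_combl tv Cf vX vW vY).
by rewrite (metric_sym hg (vf_tangent p vX) (vf_tangent p vY)).
Qed.

Lemma g_lie_combl p f X W Y Z : C f -> vf X -> vf W -> vf Y -> vf Z ->
  g p (lie_bracket (fun q => f q *: X q + W q) Y p) (Z p) =
  f p * g p (lie_bracket X Y p) (Z p) - Y p f * g p (X p) (Z p) + g p (lie_bracket W Y p) (Z p).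
Proof.
move=> Cf vX vW vY vZ; rewrite (lie_combl A)//.
have tXY := vf_tangent p (vf_lie A vX vY); have tWY := vf_tangent p (vf_lie A vW vY).
have tX := vf_tangent p vX; have tZ := vf_tangent p vZ.
have t1 := tangentZ (f p) tXY; have t2 := tangentZ (Y p f) tX.
by rewrite (metric_Dl hg (tangentB t1 t2) tWY tZ) (metric_Bl hg t1 t2 tZ) !(metric_Zl hg).
Qed.

Lemma g_lie_combr p f X W Y Z : C f -> vf X -> vf W -> vf Y -> vf Z ->
  g p (lie_bracket Y (fun q => f q *: X q + W q) p) (Z p) =
  f p * g p (lie_bracket Y X p) (Z p) + Y p f * g p (X p) (Z p) + g p (lie_bracket Y W p) (Z p).
Proof.
move=> Cf vX vW vY vZ; have vXW := vf_comb A Cf vX vW.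
have tZ := vf_tangent p vZ.
rewrite lieC (metric_Nl hg (vf_tangent p (vf_lie A vXW vY)) tZ) g_lie_combl//.
rewrite (lieC Y X) (lieC Y W) (metric_Nl hg (vf_tangent p (vf_lie A vX vY)) tZ).
rewrite (metric_Nl hg (vf_tangent p (vf_lie A vW vY)) tZ); ring.
Qed.

(** The value that vanishing torsion and compatibility with [g] force upon g(nabla_X Y, Z). *)
Definition koszul X Y Z p : R := 2^-1 *
  (X p (gfun g Y Z) + Y p (gfun g Z X) - Z p (gfun g X Y) + g p (lie_bracket X Y p) (Z p)
   - g p (lie_bracket Y Z p) (X p) + g p (lie_bracket Z X p) (Y p)).

Lemma C_koszul X Y Z : vf X -> vf Y -> vf Z -> C (koszul X Y Z).
Proof.
move=> vX vY vZ.
have CD := sa_add A; have CM := sa_mul A; have CN := sa_sub A.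
have C2 : C (fun=> 2^-1) by exact: (sa_cst A).
have CL U V W : vf U -> vf V -> vf W -> C (fun p => g p (lie_bracket U V p) (W p)).
  by move=> vU vV vW; exact: (C_gfun hg (vf_lie A vU vV) vW).
have CG U V W : vf U -> vf V -> vf W -> C (fun p => U p (gfun g V W)).
  by move=> vU vV vW; exact: (vf_C vU (C_gfun hg vV vW)).
exact: (CM _ _ C2 (CD _ _ (CN _ _ (CD _ _ (CN _ _ (CD _ _ (CG _ _ _ vX vY vZ) (CG _ _ _ vY vZ vX))
  (CG _ _ _ vZ vX vY)) (CL _ _ _ vX vY vZ)) (CL _ _ _ vY vZ vX)) (CL _ _ _ vZ vX vY))).
Qed.

(** The derivatives of [f] from the metric terms cancel against those from the brackets. Linearity
    over [C] in the last argument is what allows a vector field to represent the form. *)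
Lemma koszul_combr X Y f Z W p : C f -> vf X -> vf Y -> vf Z -> vf W ->
  koszul X Y (fun q => f q *: Z q + W q) p = f p * koszul X Y Z p + koszul X Y W p.
Proof.
move=> Cf vX vY vZ vW; rewrite /koszul.
have tX := vf_tangent p vX; have tY := vf_tangent p vY.
rewrite (derive_gfun_combr tX Cf vZ vW vY) (derive_gfun_combl tY Cf vZ vW vX).
rewrite (g_lie_combr _ Cf vZ vW vY vX) (g_lie_combl _ Cf vZ vW vX vY).
rewrite (metric_combr hg (f p) (vf_tangent p vZ) (vf_tangent p vW) (vf_tangent p (vf_lie A vX vY))).
rewrite (metric_sym hg tY (vf_tangent p vZ)).
rewrite -[(f p *: Z p + W p) (gfun g X Y)]/(f p * Z p (gfun g X Y) + W p (gfun g X Y)).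
ring.
Qed.

Lemma koszul_combl X Y f W Z p : C f -> vf X -> vf Y -> vf Z -> vf W ->
  koszul (fun q => f q *: X q + W q) Y Z p = f p * koszul X Y Z p + koszul W Y Z p.
Proof.
move=> Cf vX vY vZ vW; rewrite /koszul.
have tX := vf_tangent p vX; have tY := vf_tangent p vY; have tZ := vf_tangent p vZ.
rewrite (derive_gfun_combr tY Cf vX vW vZ) (derive_gfun_combl tZ Cf vX vW vY).
rewrite (g_lie_combl _ Cf vX vW vY vZ) (g_lie_combr _ Cf vX vW vZ vY).
rewrite (metric_combr hg (f p) tX (vf_tangent p vW) (vf_tangent p (vf_lie A vY vZ))).
rewrite (metric_sym hg tZ tX).
rewrite -[(f p *: X p + W p) (gfun g Y Z)]/(f p * X p (gfun g Y Z) + W p (gfun g Y Z)).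
ring.
Qed.

(** Here the derivatives of [f] along [X] add up instead, to twice the Leibniz term. *)
Lemma koszul_combm X Y f W Z p : C f -> vf X -> vf Y -> vf Z -> vf W ->
  koszul X (fun q => f q *: Y q + W q) Z p =
  f p * koszul X Y Z p + X p f * g p (Y p) (Z p) + koszul X W Z p.
Proof.
move=> Cf vX vY vZ vW; rewrite /koszul.
have tX := vf_tangent p vX; have tY := vf_tangent p vY; have tZ := vf_tangent p vZ.
rewrite (derive_gfun_combl tX Cf vY vW vZ) (derive_gfun_combr tZ Cf vY vW vX).
rewrite (g_lie_combr _ Cf vY vW vX vZ) (g_lie_combl _ Cf vY vW vZ vX).
rewrite (metric_combr hg (f p) tY (vf_tangent p vW) (vf_tangent p (vf_lie A vZ vX))).
rewrite (metric_sym hg tX tY).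
rewrite -[(f p *: Y p + W p) (gfun g Z X)]/(f p * Y p (gfun g Z X) + W p (gfun g Z X)).
by field; rewrite ?pnatr_eq0.
Qed.

Lemma koszul_torsion X Y Z p : vf X -> vf Y -> vf Z ->
  koszul X Y Z p - koszul Y X Z p = g p (lie_bracket X Y p) (Z p).
Proof.
move=> vX vY vZ; rewrite /koszul.
rewrite (gfunC hg vZ vX) (gfunC hg vZ vY) (gfunC hg vY vX).
have tX := vf_tangent p vX; have tY := vf_tangent p vY; have tZ := vf_tangent p vZ.
rewrite (lieC Y X) (metric_Nl hg (vf_tangent p (vf_lie A vX vY)) tZ).
rewrite (lieC Y Z) (metric_Nl hg (vf_tangent p (vf_lie A vZ vY)) tX).
rewrite (lieC X Z) (metric_Nl hg (vf_tangent p (vf_lie A vZ vX)) tY).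
by field; rewrite ?pnatr_eq0.
Qed.

Lemma koszul_metric X Y Z p : vf X -> vf Y -> vf Z ->
  koszul X Y Z p + koszul X Z Y p = X p (gfun g Y Z).
Proof.
move=> vX vY vZ; rewrite /koszul.
rewrite (gfunC hg vZ vX) (gfunC hg vY vX) (gfunC hg vZ vY).
have tX := vf_tangent p vX; have tY := vf_tangent p vY; have tZ := vf_tangent p vZ.
rewrite (lieC Y X) (metric_Nl hg (vf_tangent p (vf_lie A vX vY)) tZ).
rewrite (lieC Y Z) (metric_Nl hg (vf_tangent p (vf_lie A vZ vY)) tX).
rewrite (lieC X Z) (metric_Nl hg (vf_tangent p (vf_lie A vZ vX)) tY).
by field; rewrite ?pnatr_eq0.
Qed.

(** The connection represents the Koszul form; by nondegeneracy each axiom may be tested by pairing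
    with a field, where it becomes an identity of that form. *)
Lemma levi_civita_exists : exists nabla, levi_civita C g nabla.
Proof.
(* The choice ranges over all pairs of maps; pairs that are not vector fields get the value 0. *)
have /choice[N HN] : forall XY : vfield R T * vfield R T, exists W, vf XY.1 -> vf XY.2 ->
    vf W /\ forall p Z, vf Z -> g p (W p) (Z p) = koszul XY.1 XY.2 Z p.
  move=> [X Y] /=; have [[vX vY]|nXY] := pselect (vf X /\ vf Y); last first.
    by exists 0 => vX vY; case: nXY.
  have [||W vW HW] := @riesz _ _ _ _ A _ hg (koszul X Y).
  - by move=> Z vZ; exact: C_koszul.
  - by move=> f Z W Cf vZ vW p; exact: koszul_combr.
  by exists W => _ _.
have vN X Y : vf X -> vf Y -> vf (N (X, Y)) by move=> vX vY; case: (HN (X, Y)).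
have gN X Y Z p : vf X -> vf Y -> vf Z -> g p (N (X, Y) p) (Z p) = koszul X Y Z p.
  by move=> vX vY vZ; case: (HN (X, Y)) => // _; apply.
have tN X Y p : vf X -> vf Y -> tangent C p (N (X, Y) p).
  by move=> vX vY; exact: vf_tangent (vN _ _ vX vY).
have Cf1 : C (fun=> 1) by exact: (sa_cst A).
exists (fun X Y => N (X, Y)); split.
- split=> //.
  + move=> f X Y Z Cf vX vY vZ p; have vXY := vf_comb A Cf vX vY.
    apply: (metric_nondegenerate_field A hg (p := p)); [exact: tN|by apply: tangent_comb; exact: tN|].
    move=> W vW; rewrite (metric_combl hg) ?gN//; [exact: koszul_combl|exact: tN|exact: tN|exact: vf_tangent].
  + move=> X Y Z vX vY vZ p; have vYZ := vfD A vY vZ.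
    apply: (metric_nondegenerate_field A hg (p := p)); [exact: tN|by apply: tangentD; exact: tN|].
    move=> W vW; rewrite (metric_Dl hg) ?gN//; [|exact: tN|exact: tN|exact: vf_tangent].
    rewrite (_ : (fun q => Y q + Z q) = (fun q => 1 *: Y q + Z q)); last first.
      by apply/funext => q; rewrite scale1r.
    rewrite (koszul_combm _ Cf1 vX vY vW vZ).
    by rewrite (tangent_cst (sa_cst A) 1 (vf_tangent p vX)) mul1r mul0r addr0.
  + move=> f X Y Cf vX vY p; have vfY := vfZ A Cf vY; have v0 := vf0 A.
    have tY := vf_tangent p vY.
    apply: (metric_nondegenerate_field A hg (p := p)); [exact: tN| |].
      by apply: tangentD; apply: tangentZ => //; exact: tN.
    move=> W vW; have tW := vf_tangent p vW.
    rewrite (metric_Dl hg) ?(metric_Zl hg) ?gN//; [|exact: tN|exact: tangentZ|apply: tangentZ; exact: tN].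
    rewrite (_ : (fun q => f q *: Y q) = (fun q => f q *: Y q + (0 : vfield R T) q)); last first.
      by apply/funext => q; rewrite addr0.
    rewrite (koszul_combm _ Cf vX vY vW v0) -(gN X 0 W)//.
    (* The Leibniz rule is extracted from the combined identity with zero second summand, which
       leaves the derivative of the zero field to be removed. *)
    have -> : N (X, 0) p = 0.
      apply: (metric_nondegenerate_field A hg (p := p)); [exact: tN|exact: tangent0|].
      move=> V vV; rewrite gN// (metric_0l hg); last exact: vf_tangent.
      have := koszul_combm p (sa_cst A (-1)) vX v0 vV v0.
      rewrite (_ : (fun q => -1 *: (0 : vfield R T) q + (0 : vfield R T) q) = 0); last first.
        apply/funext => q; rewrite -[LHS]/(-1 *: (0 : tvec R T) + 0).
        by rewrite scaler0 addr0.
      rewrite (metric_0l hg); last exact: vf_tangent.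
      by rewrite mulr0 addr0 mulN1r addNr.
    by rewrite (metric_0l hg tW) addr0 addrC.
- move=> X Y vX vY p.
  apply: (metric_nondegenerate_field A hg (p := p)); [by apply: tangentB; exact: tN| |].
    exact: vf_tangent (vf_lie A vX vY).
  move=> Z vZ; rewrite (metric_Bl hg) ?gN//; [exact: koszul_torsion|exact: tN|exact: tN|exact: vf_tangent].
- move=> X Y Z vX vY vZ p; rewrite gN// (metric_sym hg (vf_tangent p vY) (tN X Z p vX vZ)) gN//.
  by rewrite koszul_metric.
Qed.

End LeviCivita.

(** * Riemannian submersions *)

Definition is_gradient (R : realType) (T : Type) (C : set (T -> R)) (g : mtensor R T)
    (f : T -> R) (Z : vfield R T) : Prop :=
  vector_field C Z /\ forall p v, tangent C p v -> g p (Z p) v = v f.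

Section Submersion.
Variables (R : realType) (m n : nat) (M : manifold R m) (N : manifold R n) (pi : M -> N).
Variable gN : mtensor R N.
Hypothesis hgN : riemannian_metric (smooth_fun N) gN.
Implicit Types (p q : M) (v w : tvec R M) (X Y Z W : vfield R M) (g : mtensor R M).
Notation CM := (smooth_fun M).
Notation CN := (smooth_fun N).
Notation dpi := (differential CN pi).
Notation vf := (vector_field CM).
Let AM := manifold_smooth_algebra M.
Let AN := manifold_smooth_algebra N.

(** * Gradients of functions pulled back from the base *)

Section OneMetric.
Variable g : mtensor R M.
Hypothesis hg : riemannian_metric CM g.
Hypothesis sub : riemannian_submersion pi g gN.
Let spi : smooth_map pi. Proof. by case: sub. Qed.
Let rk p : has_rank CM CN pi p n. Proof. by case: sub => _ + _; apply. Qed.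

Lemma gradient_horizontal h Z p : CN h -> is_gradient CM g (h \o pi) Z ->
  horizontal pi g p (Z p).
Proof.
move=> Ch [vZ gZ]; split; first exact: vf_tangent.
by move=> w vw; have [tw _] := vw; rewrite gZ//; exact: (vertical_pullback vw Ch).
Qed.

(** Pulled back coordinates of [N] give a local frame of the horizontal spaces by gradients, and
    they detect verticality since they determine the projected vector. *)
Lemma gram_frame p0 : exists x : 'I_n -> N -> R, exists Z : 'I_n -> vfield R M,
  [/\ forall i, CN (x i), forall i, is_gradient CM g (x i \o pi) (Z i) &
    \forall q \near p0, (\matrix_(i, j) g q (Z i q) (Z j q)) \in unitmx /\
      forall v, tangent CM q v -> (forall j, v (x j \o pi) = 0) -> vertical pi q v].
Proof.
have [x [E [Cx vE fr]]] := sa_frame AN (pi p0).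
have /choice[Z HZ] : forall i, exists Z, is_gradient CM g (x i \o pi) Z.
  move=> i; have [Z vZ gZ] := gradient AM hg (smooth_fun_pullback spi (Cx i)).
  by exists Z.
exists x, Z; split; [exact: Cx|exact: HZ|].
have fr' : \forall q \near p0,
    (forall v : tvec R N, tangent CN (pi q) v -> v = \sum_i v (x i) *: E i (pi q)) /\
    forall i j, E i (pi q) (x j) = (i == j)%:R.
  by have [cpi _] := spi; have /(_ _ fr) := cpi p0; exact.
apply: filterS fr' => q [frq Exq]; split; last first.
  move=> v tv vx; split=> //; rewrite (frq _ (tangent_differential spi tv)).
  by apply: big1 => i _; rewrite (differentialE _ _ (Cx i)) vx scale0r.
apply: unitmx_inj => u uB; apply/rowP => j; rewrite [RHS]mxE.
have tZ i : tangent CM q (Z i q) by apply: vf_tangent; case: (HZ i).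
have tw : tangent CM q (\sum_i u 0 i *: Z i q) by exact: tangent_sum.
have w0 : \sum_i u 0 i *: Z i q = 0.
  apply: (metric_eq0 hg tw); rewrite (metric_suml hg)//; apply: big1 => i _.
  rewrite (metric_sym hg)// (metric_suml hg)//; have /rowP/(_ i) := uB; rewrite !mxE => h.
  rewrite (_ : \sum_(_ <- _) _ = 0) ?mulr0//.
  by rewrite -[RHS]h; apply: eq_bigr => k _; rewrite mxE.
(* A lift of the j-th coordinate vector pairs to 1 with [Z j] and to 0 with the others, so it
   isolates the coefficient [u 0 j]. *)
have [v tv dv] := differential_surj spi (rk q) (vf_tangent (pi q) (vE j)).
have := metric_suml hg (index_enum _) (fun i => u 0 i) tZ tv.
rewrite w0 (metric_0l hg tv) => /esym; rewrite (bigD1 j)//=.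
have gZv i : g q (Z i q) v = (j == i)%:R.
  by have [_ ->] := HZ i; rewrite // -differentialE// dv Exq.
rewrite gZv eqxx mulr1 big1 ?addr0// => i ij.
by rewrite gZv eq_sym (negbTE ij) mulr0.
Qed.

(** The function [f] is a combination of coordinates with constant coefficients, depending on [p]
    and [v] and found by inverting the Gram matrix at [p] alone. *)
Lemma gradient_decomposition p v : tangent CM p v -> exists f, exists Z,
  [/\ CN f, is_gradient CM g (f \o pi) Z & vertical pi p (v - Z p)].
Proof.
move=> tv; have [x [Z [Cx HZ /nbhs_singleton[Bu Hv]]]] := gram_frame p.
set B := (\matrix_(_, _) _) in Bu.
pose a := (\row_j v (x j \o pi)) *m invmx B.
have tZ i q : tangent CM q (Z i q) by apply: vf_tangent; case: (HZ i).
have Cxp i := smooth_fun_pullback spi (Cx i).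
have Cax i : CN (fun z : N => a 0 i * x i z) by exact: (smooth_funZ (a 0 i) (Cx i)).
exists (fun z : N => \sum_i a 0 i * x i z), (fun q => \sum_i a 0 i *: Z i q); split.
- exact: (smooth_fun_sum _ Cax).
- split.
    apply: (vf_sum AM _ (f := fun i => fun=> a 0 i)); first by move=> i; exact: (sa_cst AM).
    by move=> i; case: (HZ i).
  move=> q w tw; rewrite (metric_suml hg)//.
  rewrite (tangent_sumf (sa_cst AM) (sa_add AM) _ tw (f := fun i q => a 0 i * x i (pi q))).
    apply: eq_bigr => i _; have [_ ->] := HZ i; last exact: tw.
    by rewrite -(tangent_scale (sa_cst AM) _ tw (Cxp i)).
  by move=> i; exact: (smooth_funZ (a 0 i) (Cxp i)).
- have ts : tangent CM p (\sum_i a 0 i *: Z i p) by exact: tangent_sum.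
  apply: Hv; first exact: tangentB.
  move=> j; rewrite -[LHS]/(v (x j \o pi) - (\sum_i a 0 i *: Z i p) (x j \o pi)).
  rewrite sum_tvecE; apply/eqP; rewrite subr_eq0; apply/eqP.
  transitivity ((a *m B) 0 j); first by rewrite /a mulmxKV// mxE.
  rewrite mxE; apply: eq_bigr => i _; rewrite [B i j]mxE.
  have [_ gZ] := HZ j; rewrite -(gZ p _ (tZ i p)).
  by rewrite (metric_sym hg (tZ i p) (tZ j p)).
Qed.

(** Every [u] is the image of a horizontal vector that is itself the value of a gradient; the
    isometry condition transfers the pairing from [M] to [N]. *)
Lemma gradient_project h Z p u : CN h -> is_gradient CM g (h \o pi) Z ->
  tangent CN (pi p) u -> gN (pi p) (dpi (Z p)) u = u h.
Proof.
move=> Ch HZ tu; have [v tv dv] := differential_surj spi (rk p) tu.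
have [f [Z' [Cf HZ' [_ vZ]]]] := gradient_decomposition tv.
have dZ' : dpi (Z' p) = u.
  have := vZ; rewrite (_ : v - Z' p = -1 *: Z' p + v); last by rewrite scaleN1r addrC.
  by rewrite differential_comb dv scaleN1r => /eqP; rewrite addrC subr_eq0 => /eqP.
have [_ _ iso] := sub.
rewrite -{1}dZ' -(iso _ _ _ (gradient_horizontal p Ch HZ) (gradient_horizontal p Cf HZ')).
have [_ gZ] := HZ; rewrite gZ; last by apply: vf_tangent; case: HZ'.
by rewrite -differentialE// dZ'.
Qed.

Lemma gradient_fiber h Z p q : CN h -> is_gradient CM g (h \o pi) Z -> pi p = pi q ->
  dpi (Z p) = dpi (Z q).
Proof.
move=> Ch HZ pq.
have tp := tangent_differential spi (vf_tangent p HZ.1).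
have tq := tangent_differential spi (vf_tangent q HZ.1).
apply: (metric_nondegenerate hgN tp); first by rewrite pq.
move=> u tu; have tu' : tangent CN (pi q) u by rewrite -pq.
by rewrite (gradient_project Ch HZ tu) pq (gradient_project Ch HZ tu').
Qed.

(** Along a fiber [Z (k o pi)] keeps its value, because the projected gradient does; minus that
    constant it vanishes on the fiber, and [vertical_fiber] applies. *)
Lemma vertical_derive_gradient h k Z p v : CN h -> CN k -> is_gradient CM g (h \o pi) Z ->
  vertical pi p v -> v (fun q => Z q (k \o pi)) = 0.
Proof.
move=> Ch Ck HZ vv; have [tv _] := vv.
have CZ := vf_C HZ.1 (smooth_fun_pullback spi Ck).
have Cc : CM (fun=> Z p (k \o pi)) by exact: (sa_cst AM).
suff : v (fun q => Z q (k \o pi) - Z p (k \o pi)) = 0.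
  by rewrite (tangent_sub tv CZ Cc) (tangent_cst (sa_cst AM) _ tv) subr0.
apply: (vertical_fiber spi (rk p) vv); first exact: (sa_sub AM CZ Cc).
near=> q => pq; apply/eqP; rewrite subr_eq0 -!(differentialE pi _ Ck).
by rewrite (gradient_fiber Ch HZ pq).
Unshelve. all: by end_near. Qed.

Lemma vertical_field_pullback X h : vertical_field pi X -> CN h ->
  (fun q => X q (h \o pi)) = fun=> 0.
Proof. by move=> [_ vX] Ch; apply/funext => q; exact: (vertical_pullback (vX q) Ch). Qed.

(** Applied to [k o pi], both terms of the bracket vanish: [X] annihilates [k o pi], and
    [Z (k o pi)] is constant on the fibers. *)
Lemma vertical_lie_gradient h X Z : CN h -> is_gradient CM g (h \o pi) Z ->
  vertical_field pi X -> vertical_field pi (lie_bracket Z X).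
Proof.
move=> Ch HZ vX; have vZX := vf_lie AM HZ.1 vX.1; split=> // p.
apply: verticalP; first exact: vf_tangent.
move=> k Ck; rewrite /lie_bracket (vertical_field_pullback vX Ck).
rewrite (tangent_cst (sa_cst AM) 0 (vf_tangent p HZ.1)).
by rewrite (vertical_derive_gradient Ch Ck HZ (vX.2 p)) subrr.
Qed.

Lemma vertical_lie X Y : vertical_field pi X -> vertical_field pi Y ->
  vertical_field pi (lie_bracket X Y).
Proof.
move=> vX vY; have vXY := vf_lie AM vX.1 vY.1; split=> // p.
apply: verticalP; first exact: vf_tangent.
move=> k Ck; rewrite /lie_bracket (vertical_field_pullback vX Ck) (vertical_field_pullback vY Ck).
rewrite (tangent_cst (sa_cst AM) 0 (vf_tangent p vX.1)).
by rewrite (tangent_cst (sa_cst AM) 0 (vf_tangent p vY.1)) subrr.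
Qed.

(** The Killing equation tested on vertical fields only. It applies both to horizontal gradients and
    to vertical fields; for the latter it expresses the Killing condition on every fiber by fields
    on [M]. *)
Definition vertical_killing Z : Prop :=
  forall X Y, vertical_field pi X -> vertical_field pi Y -> forall p,
    Z p (gfun g X Y) = g p (lie_bracket Z X p) (Y p) + g p (X p) (lie_bracket Z Y p).

Lemma gradient_vertical h Y Z : CN h -> is_gradient CM g (h \o pi) Z ->
  vertical_field pi Y -> gfun g Y Z = fun=> 0.
Proof.
move=> Ch [vZ gZ] vY; rewrite (gfunC hg vY.1 vZ) -(vertical_field_pullback vY Ch).
by apply/funext => q; rewrite /gfun gZ//; exact: vf_tangent vY.1.
Qed.

Lemma totally_geodesic_gradient h Z : totally_geodesic_fibers pi g -> CN h ->
  is_gradient CM g (h \o pi) Z -> vertical_killing Z.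
Proof.
move=> [nabla [[vn _ _ _] tors metr] tg] Ch HZ X Y vX vY p.
have vZ := HZ.1; have [vX1 vY1] := (vX.1, vY.1).
(* Differentiate g(V, Z) = 0 along [U]; the remaining term pairs [Z] with the vertical nabla_U V.
   Once brackets are written as differences of covariant derivatives, these terms drop and metric
   compatibility along [Z] is left. *)
have sff U V : vertical_field pi U -> vertical_field pi V -> g p (V p) (nabla U Z p) = 0.
  move=> vU vV; have := metr U V Z vU.1 vV.1 vZ p.
  rewrite -/(gfun g V Z) (gradient_vertical Ch HZ vV).
  rewrite (tangent_cst (sa_cst AM) 0 (vf_tangent p vU.1)).
  have [_] := tg U V vU vV p; rewrite subr0 => vUV.
  have tUV := vf_tangent p (vn _ _ vU.1 vV.1).
  rewrite (metric_sym hg tUV (vf_tangent p vZ)) HZ.2// (vertical_pullback vUV Ch) add0r.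
  by move=> <-.
rewrite -(tors Z X vZ vX1) -(tors Z Y vZ vY1) metr//.
have tn U V : vf U -> vf V -> tangent CM p (nabla U V p).
  by move=> vU vV; exact: vf_tangent (vn _ _ vU vV).
have tX := vf_tangent p vX1; have tY := vf_tangent p vY1.
have tXZ := tn _ _ vX1 vZ; have tYZ := tn _ _ vY1 vZ.
have tZX := tn _ _ vZ vX1; have tZY := tn _ _ vZ vY1.
rewrite (metric_Bl hg tZX tXZ tY) (metric_sym hg tXZ tY) (sff X Y vX vY) subr0.
rewrite (metric_sym hg tX (tangentB tZY tYZ)) (metric_Bl hg tZY tYZ tX).
by rewrite (metric_sym hg tYZ tX) (sff Y X vY vX) subr0 (metric_sym hg tZY tX).
Qed.

Lemma gradient_totally_geodesic :
  (forall h Z, CN h -> is_gradient CM g (h \o pi) Z -> vertical_killing Z) ->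
  totally_geodesic_fibers pi g.
Proof.
move=> H; have [nabla lc] := levi_civita_exists AM hg; exists nabla => // X Y vX vY p.
have [[vn _ _ _] tors metr] := lc.
have [vX1 vY1] := (vX.1, vY.1).
have tn U V : vf U -> vf V -> tangent CM p (nabla U V p).
  by move=> vU vV; exact: vf_tangent (vn _ _ vU vV).
have t0 := tangent0 CM p.
split.
  by split=> // w [tw _]; rewrite (metric_0l hg).
rewrite subr0; apply: verticalP; first exact: tn.
move=> h Ch; have [Z vZ gZ] := gradient AM hg (smooth_fun_pullback spi Ch).
have HZ : is_gradient CM g (h \o pi) Z by [].
have tX := vf_tangent p vX1; have tY := vf_tangent p vY1; have tZ := vf_tangent p vZ.
have tXZ := tn _ _ vX1 vZ; have tYZ := tn _ _ vY1 vZ.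
have tZX := tn _ _ vZ vX1; have tZY := tn _ _ vZ vY1.
have tXY := tn _ _ vX1 vY1; have tYX := tn _ _ vY1 vX1.
have e1 U V : vertical_field pi U -> vertical_field pi V ->
    g p (nabla U V p) (Z p) = - g p (V p) (nabla U Z p).
  move=> vU vV; have := metr U V Z vU.1 vV.1 vZ p.
  rewrite -/(gfun g V Z) (gradient_vertical Ch HZ vV).
  rewrite (tangent_cst (sa_cst AM) 0 (vf_tangent p vU.1)) => /esym/eqP.
  by rewrite addr_eq0 => /eqP.
have e2 := H h Z Ch HZ X Y vX vY p.
move: e2; rewrite -(tors Z X vZ vX1) -(tors Z Y vZ vY1) metr//.
rewrite (metric_Bl hg tZX tXZ tY) (metric_sym hg tXZ tY).
rewrite (metric_sym hg tX (tangentB tZY tYZ)) (metric_Bl hg tZY tYZ tX).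
rewrite (metric_sym hg tYZ tX) (metric_sym hg tZY tX) => e2.
(* The second fundamental form is symmetric because the bracket of vertical fields is vertical.
   Since [e2] says that its symmetrization pairs to 0 with [Z], so does the form itself. *)
have e3 : g p (nabla X Y p - nabla Y X p) (Z p) = 0.
  have [_ vXY] := vertical_lie vX vY.
  rewrite (tors X Y vX1 vY1) (metric_sym hg (vXY p).1 tZ) gZ; last exact: (vXY p).1.
  exact: (vertical_pullback (vXY p) Ch).
rewrite (metric_Bl hg tXY tYX tZ) (e1 X Y vX vY) (e1 Y X vY vX) in e3.
rewrite -(gZ p _ tXY) (metric_sym hg tZ tXY) (e1 X Y vX vY); lra.
Qed.

End OneMetric.

(** * Comparison of two metrics that agree on vertical vectors *)

Section TwoMetrics.
Variables g g' : mtensor R M.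
Hypotheses (hg : riemannian_metric CM g) (hg' : riemannian_metric CM g').
Hypotheses (sub : riemannian_submersion pi g gN) (sub' : riemannian_submersion pi g' gN).
Hypothesis gg' : forall p v w, vertical pi p v -> vertical pi p w -> g p v w = g' p v w.

Lemma gradient_difference_vertical h Z Z' : CN h -> is_gradient CM g (h \o pi) Z ->
  is_gradient CM g' (h \o pi) Z' -> vertical_field pi (fun q => Z' q - Z q).
Proof.
move=> Ch HZ HZ'; have [spi _ _] := sub.
have vB := vfB AM HZ'.1 HZ.1; split=> // p.
split; first exact: vf_tangent vB.
have tp := tangent_differential spi (vf_tangent p HZ.1).
have tp' := tangent_differential spi (vf_tangent p HZ'.1).
have -> : Z' p - Z p = -1 *: Z p + Z' p by rewrite scaleN1r addrC.
rewrite differential_comb scaleN1r addrC.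
apply/eqP; rewrite subr_eq0; apply/eqP; apply: (metric_nondegenerate hgN tp' tp) => u tu.
by rewrite (gradient_project hg sub Ch HZ tu) (gradient_project hg' sub' Ch HZ' tu).
Qed.

Lemma gradient_difference_killing h Z Z' : totally_geodesic_fibers pi g ->
  totally_geodesic_fibers pi g' -> CN h -> is_gradient CM g (h \o pi) Z ->
  is_gradient CM g' (h \o pi) Z' -> vertical_killing g (fun q => Z' q - Z q).
Proof.
move=> tg tg' Ch HZ HZ' X Y vX vY p.
have e := totally_geodesic_gradient hg tg Ch HZ vX vY p.
have e' := totally_geodesic_gradient hg' tg' Ch HZ' vX vY p.
have gE : gfun g X Y = gfun g' X Y.
  by apply/funext => q; apply: gg'; [exact: vX.2|exact: vY.2].
rewrite -[LHS]/(Z' p (gfun g X Y) - Z p (gfun g X Y)) {1}gE e e'.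
have [vZ vZ'] := (HZ.1, HZ'.1).
have lieE W : vertical_field pi W -> lie_bracket (fun q => Z' q - Z q) W p =
    lie_bracket Z' W p - lie_bracket Z W p.
  move=> vW; have := lie_combl AM p (sa_cst AM (-1)) vZ vZ' vW.1.
  rewrite (tangent_cst (sa_cst AM) (-1) (vf_tangent p vW.1)) scale0r subr0 scaleN1r addrC => <-.
  by congr lie_bracket; apply/funext => q; rewrite scaleN1r addrC.
have [vZX vZX'] := (vertical_lie_gradient hg sub Ch HZ vX, vertical_lie_gradient hg' sub' Ch HZ' vX).
have [vZY vZY'] := (vertical_lie_gradient hg sub Ch HZ vY, vertical_lie_gradient hg' sub' Ch HZ' vY).
rewrite (lieE X vX) (lieE Y vY).
have [tX tY] := (vf_tangent p vX.1, vf_tangent p vY.1).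
rewrite (metric_Bl hg (vZX'.2 p).1 (vZX.2 p).1 tY).
rewrite (metric_sym hg tX (tangentB (vZY'.2 p).1 (vZY.2 p).1)) (metric_Bl hg (vZY'.2 p).1 (vZY.2 p).1 tX).
rewrite (metric_sym hg (vZY'.2 p).1 tX) (metric_sym hg (vZY.2 p).1 tX).
rewrite (gg' (vZX'.2 p) (vY.2 p)) (gg' (vX.2 p) (vZY'.2 p)); ring.
Qed.

(* The gradients of pulled back functions span the horizontal spaces. *)
Lemma same_gradients_same_metric :
  (forall h Z Z', CN h -> is_gradient CM g (h \o pi) Z -> is_gradient CM g' (h \o pi) Z' ->
    forall p, Z' p = Z p) -> same_metric g g'.
Proof.
move=> H p v w tv tw; have [spi _ _] := sub.
(* The component [b] is a gradient value common to both metrics, so either metric pairs it with [z]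
   to the same number [z (f o pi)]. *)
have hor u : tangent CM p u -> exists a, exists b, [/\ u = a + b, vertical pi p a, tangent CM p b,
    forall z, tangent CM p z -> g p b z = g' p b z & forall z, vertical pi p z -> g p b z = 0].
  move=> tu; have [f [Z [Cf HZ vu]]] := gradient_decomposition hg sub tu.
  have [Z' vZ' gZ'] := gradient AM hg' (smooth_fun_pullback spi Cf).
  exists (u - Z p), (Z p); split; [by rewrite subrK|exact: vu|exact: vf_tangent HZ.1| |].
    by move=> z tz; rewrite HZ.2// -(H f Z Z' Cf HZ)// gZ'.
  by move=> z vz; rewrite HZ.2; [exact: (vertical_pullback vz Cf)|case: vz].
have [a [b [vE va tb gb gb0]]] := hor v tv; have [c [d [wE vc td gd gd0]]] := hor w tw.
have [ta tc] := (va.1, vc.1).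
have tcd : tangent CM p (c + d) by exact: tangentD.
rewrite vE wE (metric_Dl hg ta tb tcd) (metric_Dl hg' ta tb tcd) (gb _ tcd); congr (_ + _).
rewrite (metric_sym hg ta tcd) (metric_sym hg' ta tcd) (metric_Dl hg tc td ta) (metric_Dl hg' tc td ta).
by rewrite (gg' vc va) (gd _ ta).
Qed.

End TwoMetrics.
End Submersion.

(** * Vector fields on the fibers *)

Section Fiber.
Variables (R : realType) (m n : nat) (M : manifold R m) (N : manifold R n) (pi : M -> N).
Variable gN : mtensor R N.
Variable g : mtensor R M.
Hypothesis hg : riemannian_metric (smooth_fun M) g.
Hypothesis sub : riemannian_submersion pi g gN.
Implicit Types (p q : M).
Notation CM := (smooth_fun M).
Notation CN := (smooth_fun N).
Notation vf := (vector_field CM).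
Let AM := manifold_smooth_algebra M.
Let spi : smooth_map pi. Proof. by case: sub. Qed.
Let rk p : has_rank CM CN pi p n. Proof. by case: sub => _ + _; apply. Qed.

(** Subtracts from [W] its orthogonal projection to the gradients of [gram_frame], then cuts off
    where these may cease to be independent. It repairs extensions of fiber fields that are vertical
    on that fiber only. *)
Lemma vertical_projection p0 (W : vfield R M) : vf W -> exists2 W', vertical_field pi W' &
  \forall q \near p0, vertical pi q (W q) -> W' q = W q.
Proof.
move=> vW; have [x [Z [Cx HZ fr]]] := gram_frame hg sub p0.
pose B q := \matrix_(i, j) g q (Z i q) (Z j q).
have vZ i : vf (Z i) by case: (HZ i).
have CB' i j : CM (fun q => B q i j).
  have -> : (fun q => B q i j) = gfun g (Z i) (Z j) by apply/funext => q; rewrite mxE.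
  exact: (C_gfun hg (vZ i) (vZ j)).
have d0 : \det (B p0) != 0.
  by have [+ _] := nbhs_singleton fr; rewrite unitmxE unitfE.
have [h Ch hd] := recip_near AM (sa_det AM CB') d0.
pose P q := (forall v : tvec R M, tangent CM q v -> (forall j, v (x j \o pi) = 0) -> vertical pi q v)
  /\ h q * \det (B q) = 1.
have nP : \forall q \near p0, P q.
  near=> q; split; last by near: q; exact: hd.
  have [] // : B q \in unitmx /\ forall v : tvec R M, tangent CM q v ->
    (forall j, v (x j \o pi) = 0) -> vertical pi q v by near: q; exact: fr.
have [chi [Cchi _ chi1 chiP]] := sa_bump AM nP.
have Cxp i := smooth_fun_pullback spi (Cx i).
pose c j q := \sum_i W q (x i \o pi) * (h q * (\adj (B q)) i j).
have Cc j : CM (c j).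
  apply: (sa_sum AM) => i; apply: (sa_mul AM); first exact: (vf_C vW (Cxp i)).
  by apply: (sa_mul AM); [exact: Ch|exact: (sa_adj AM)].
have vS : vf (fun q => W q - \sum_j c j q *: Z j q) by exact: (vfB AM vW (vf_sum AM _ Cc vZ)).
exists (fun q => chi q *: (W q - \sum_j c j q *: Z j q)).
  split; first exact: (vfZ AM Cchi vS).
  move=> q; have [->|/chiP[Pv hdq]] := eqVneq (chi q) 0.
    by rewrite scale0r; split; [exact: tangent0|exact: differential0].
  apply: Pv; first exact: tangentZ (vf_tangent q vS).
  move=> k; rewrite -[LHS]/(chi q * (W q (x k \o pi) - (\sum_j c j q *: Z j q) (x k \o pi))).
  rewrite sum_tvecE; apply/eqP; rewrite mulf_eq0; apply/orP; right.
  rewrite subr_eq0; apply/eqP.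
  transitivity (((\row_i W q (x i \o pi)) *m ((h q *: \adj (B q)) *m B q)) 0 k).
    by rewrite -scalemxAl mul_adj_mx scale_scalar_mx hdq mulmx1 mxE.
  rewrite mulmxA mxE; apply: eq_bigr => j _; rewrite !mxE; congr (_ * _).
    by apply: eq_bigr => i _; rewrite !mxE.
  have [tj tk] := (vf_tangent q (vZ j), vf_tangent q (vZ k)).
  by rewrite (metric_sym hg tj tk); have [_ ->] := HZ k.
(* Where [W] is already vertical, it annihilates the pulled back coordinates, and nothing is
   subtracted. *)
near=> q => vWq; have -> : chi q = 1 by near: q.
rewrite scale1r big1 ?subr0// => j _; rewrite /c big1 ?scale0r// => i _.
by rewrite (vertical_pullback vWq (Cx i)) mul0r.
Unshelve. all: by end_near. Qed.

(** * Functions and derivations on one fiber *)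

Variable x : N.
Notation Fx := (fiber pi x).
Notation CF := (@fiber_smooth_fun R m n M N pi x).
Notation push := (@fiber_push R m n M N pi x).
Implicit Types (z : Fx) (f : Fx -> R) (F : M -> R).

Definition fiber_extension z f F :=
  CM F /\ \forall q \near (sval z : M), forall z' : Fx, sval z' = q -> f z' = F q.

Lemma fiber_smooth_restrict F : CM F -> CF (fun z => F (sval z)).
Proof. by move=> CMF z; exists F => //; apply: nearW => q z' ->. Qed.

Lemma fiber_extension_restrict z F : CM F -> fiber_extension z (fun z => F (sval z)) F.
Proof. by move=> CMF; split=> //; apply: nearW => q z' ->. Qed.

Lemma fiber_extension_exists z f : CF f -> exists F, fiber_extension z f F.
Proof. by move=> /(_ z)[F CMF H]; exists F. Qed.

Lemma fiber_smoothP f : (forall z, exists F, fiber_extension z f F) -> CF f.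
Proof. by move=> H z; have [F [CMF nF]] := H z; exists F. Qed.

Lemma fiber_extensionE z f F : fiber_extension z f F -> f z = F (sval z).
Proof. by move=> [_ /nbhs_singleton]; apply. Qed.

Lemma fiber_extension_comb (a : R) z f F f' F' : fiber_extension z f F ->
  fiber_extension z f' F' ->
  fiber_extension z (fun z => a * f z + f' z) (fun q => a * F q + F' q).
Proof.
move=> [CMF nF] [CMF' nF']; split.
  apply: (sa_add AM); last exact: CMF'.
  by apply: (sa_mul AM); [exact: (sa_cst AM)|exact: CMF].
near=> q => z' zq.
have -> : f z' = F q by move: z' zq; near: q.
by have -> : f' z' = F' q by move: z' zq; near: q.
Unshelve. all: by end_near. Qed.

Lemma fiber_extension_mul z f F f' F' : fiber_extension z f F ->
  fiber_extension z f' F' -> fiber_extension z (fun z => f z * f' z) (fun q => F q * F' q).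
Proof.
move=> [CMF nF] [CMF' nF']; split; first by apply: (sa_mul AM); [exact: CMF|exact: CMF'].
near=> q => z' zq.
have -> : f z' = F q by move: z' zq; near: q.
by have -> : f' z' = F' q by move: z' zq; near: q.
Unshelve. all: by end_near. Qed.

Lemma fiber_smooth_cst (a : R) : CF (fun=> a).
Proof. exact: (fiber_smooth_restrict (sa_cst AM a)). Qed.

Lemma fiber_smooth_comb (a : R) f f' : CF f -> CF f' -> CF (fun z => a * f z + f' z).
Proof.
move=> Cf Cf'; apply: fiber_smoothP => z.
have [F eF] := fiber_extension_exists z Cf; have [F' eF'] := fiber_extension_exists z Cf'.
by exists (fun q => a * F q + F' q); exact: fiber_extension_comb.
Qed.

Lemma fiber_smooth_mul f f' : CF f -> CF f' -> CF (fun z => f z * f' z).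
Proof.
move=> Cf Cf'; apply: fiber_smoothP => z.
have [F eF] := fiber_extension_exists z Cf; have [F' eF'] := fiber_extension_exists z Cf'.
by exists (fun q => F q * F' q); exact: fiber_extension_mul.
Qed.

Lemma fiber_pushE (v : tvec R Fx) F : CM F -> push v F = v (fun z => F (sval z)).
Proof. by move=> CMF; rewrite /fiber_push /differential asboolT. Qed.

Lemma fiber_push_vertical z v : tangent CF z v -> vertical pi (sval z) (push v).
Proof.
move=> tv; have [_ vl vm] := tv; apply: verticalP.
  apply: (tangent_extend (sa_cst AM) (sa_add AM) (sa_mul AM)).
    by move=> a F F' /fiber_smooth_restrict CMF /fiber_smooth_restrict CMF'; exact: vl.
  by move=> F F' /fiber_smooth_restrict CMF /fiber_smooth_restrict CMF'; exact: vm.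
move=> h Ch; rewrite (fiber_pushE _ (smooth_fun_pullback spi Ch)) /=.
rewrite (_ : (fun _ => _) = fun=> h x); first exact: (tangent_cst fiber_smooth_cst _ tv).
by apply/funext => z'; rewrite (svalP z').
Qed.

(** Locality of derivations on the fiber; the cutoff is the restriction of a bump function of [M]
    supported where [F] extends [f]. *)
Lemma fiber_tangent_extension z v f F : tangent CF z v -> CF f -> fiber_extension z f F ->
  v f = push v F.
Proof.
move=> tv Cf [CMF nF]; rewrite (fiber_pushE _ CMF).
have [chi [Cchi _ chi1 chiV]] := sa_bump AM nF.
have CFF := fiber_smooth_restrict CMF; have Cch := fiber_smooth_restrict Cchi.
have Cd : CF (fun z => f z - F (sval z)).
  have := fiber_smooth_comb (-1) CFF Cf.
  by rewrite (_ : (fun _ => _) = fun z => f z - F (sval z))//; apply/funext => z'; ring.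
apply/eqP; rewrite -subr_eq0 -(tangent_sub tv Cf CFF).
have := tangent_mul tv Cd Cch; rewrite (nbhs_singleton chi1) mulr1.
rewrite (nbhs_singleton nF z erefl) subrr mul0r addr0 => <-.
rewrite (_ : (fun _ => _) = fun=> 0); first by rewrite (tangent_cst fiber_smooth_cst 0 tv).
apply/funext => z'; have [->|/chiV H] := eqVneq (chi (sval z')) 0; first by rewrite mulr0.
by rewrite (H z' erefl) subrr mul0r.
Qed.

(** Brackets of related fields are related. Relatedness near [z] suffices: [W' F] extends [W] of the
    restriction of [F] there, and derivations at [z] see no more. *)
Lemma fiber_lie_push z (X Y : vfield R Fx) (X' Y' : vfield R M) :
  vector_field CF X -> vector_field CF Y -> vf X' -> vf Y' ->
  (\forall q \near (sval z : M), forall z' : Fx, sval z' = q -> push (X z') = X' q) ->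
  (\forall q \near (sval z : M), forall z' : Fx, sval z' = q -> push (Y z') = Y' q) ->
  push (lie_bracket X Y z) = lie_bracket X' Y' (sval z).
Proof.
move=> vX vY vX' vY' nX nY; apply/funext => F.
have [CMF|nCMF] := pselect (CM F); last first.
  rewrite /fiber_push /differential asboolF// /lie_bracket.
  have E W : vf W -> (fun q => W q F) = fun=> 0.
    by move=> vW; apply/funext => q; have [-> //] := vf_tangent q vW.
  rewrite (E _ vX') (E _ vY') (tangent_cst (sa_cst AM) 0 (vf_tangent _ vX')).
  by rewrite (tangent_cst (sa_cst AM) 0 (vf_tangent _ vY')) subrr.
rewrite (fiber_pushE _ CMF) /lie_bracket.
have CFF := fiber_smooth_restrict CMF.
have key (U W : vfield R Fx) (U' W' : vfield R M) : vector_field CF U -> vector_field CF W ->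
    vf W' ->
    (\forall q \near (sval z : M), forall z' : Fx, sval z' = q -> push (U z') = U' q) ->
    (\forall q \near (sval z : M), forall z' : Fx, sval z' = q -> push (W z') = W' q) ->
    U z (fun z' => W z' (fun z => F (sval z))) = U' (sval z) (fun q => W' q F).
  move=> vU vW vW' nU nW; rewrite -(nbhs_singleton nU z erefl).
  apply: (fiber_tangent_extension (vU.1 z) (vW.2 _ CFF)).
  split; first exact: vf_C vW' CMF.
  near=> q => z' zq; rewrite -(fiber_pushE _ CMF).
  suff -> : push (W z') = W' q by [].
  by move: z' zq; near: q.
by rewrite (key X Y X' Y' vX vY vY' nX nY) (key Y X Y' X' vY vX vX' nY nX).
Unshelve. all: by end_near. Qed.

(** The components in a local frame of [M] are smooth on the fiber and extend. Their combination is
    vertical on the fiber only, and [vertical_projection] makes it vertical everywhere without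
    changing it on the fiber near [z0]. *)
Lemma fiber_field_extension z0 (X : vfield R Fx) : vector_field CF X ->
  exists2 X' : vfield R M, vertical_field pi X' &
    \forall q \near (sval z0 : M), forall z' : Fx, sval z' = q -> push (X z') = X' q.
Proof.
move=> vX; have [y [E [Cy vE fr]]] := sa_frame AM (sval z0).
have /choice[G HG] : forall i, exists G, fiber_extension z0 (fun z => X z (fun z' => y i (sval z'))) G.
  by move=> i; apply: fiber_extension_exists; exact: (vX.2 _ (fiber_smooth_restrict (Cy i))).
have CG i : CM (G i) by case: (HG i).
have vW : vf (fun q => \sum_i G i q *: E i q) by exact: (vf_sum AM _ CG vE).
have [X' vX' nX'] := vertical_projection (sval z0) vW.
have nG : \forall q \near (sval z0 : M), forall i, forall z' : Fx, sval z' = q ->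
    X z' (fun z' => y i (sval z')) = G i q.
  by apply: filter_forall => i; case: (HG i).
exists X' => //; near=> q => z' zq.
have [frq _] : (forall v, tangent CM q v -> v = \sum_i v (y i) *: E i q) /\
  forall i j, E i q (y j) = (i == j)%:R by near: q.
have Gq : forall i, forall z' : Fx, sval z' = q -> X z' (fun z' => y i (sval z')) = G i q.
  by near: q.
have vq : vertical pi q (push (X z')).
  by rewrite -zq; exact: (fiber_push_vertical (vX.1 z')).
have WE : push (X z') = \sum_i G i q *: E i q.
  rewrite [LHS]frq; last by case: vq.
  by apply: eq_bigr => i _; rewrite (fiber_pushE _ (Cy i)) Gq.
have H : vertical pi q (\sum_i G i q *: E i q) -> X' q = \sum_i G i q *: E i q by near: q.
by rewrite WE; apply/esym; apply: H; rewrite -WE.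
Unshelve. all: by end_near. Qed.

(** The vector acts on [f] through an arbitrarily chosen local extension; the default of [xget] is
    never reached, since every function in [CF] has an extension at [z]. *)
Definition fiber_restrict (w : tvec R M) z : tvec R Fx :=
  fun f => if `[< CF f >] then w (xget (fun=> 0) [set F | fiber_extension z f F]) else 0.

(** Two extensions differ by a function vanishing on the fiber near [z], which a vertical vector
    annihilates. *)
Lemma fiber_restrictE w z f F : vertical pi (sval z) w -> CF f -> fiber_extension z f F ->
  fiber_restrict w z f = w F.
Proof.
move=> vw Cf eF; rewrite /fiber_restrict asboolT//.
set G := xget _ _; have [CMG nG] : fiber_extension z f G.
  exact: (xgetPex _ (fiber_extension_exists z Cf)).
have [CMF nF] := eF; have tw := vw.1.
apply/eqP; rewrite -subr_eq0 -(tangent_sub tw CMG CMF); apply/eqP.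
apply: (vertical_fiber spi (rk (sval z)) vw); first exact: (sa_sub AM CMG CMF).
near=> q => pq; rewrite (svalP z) in pq; pose z' : Fx := exist _ q pq.
have <- : f z' = G q.
  suff : forall z' : Fx, sval z' = q -> f z' = G q by apply.
  by near: q.
have <- : f z' = F q.
  suff : forall z' : Fx, sval z' = q -> f z' = F q by apply.
  by near: q.
by rewrite subrr.
Unshelve. all: by end_near. Qed.

Lemma fiber_restrict_tangent w z : vertical pi (sval z) w -> tangent CF z (fiber_restrict w z).
Proof.
move=> vw; have tw := vw.1; have [_ wl wm] := tw.
split=> [f nCf|a f f' Cf Cf'|f f' Cf Cf']; first by rewrite /fiber_restrict asboolF.
  have [F eF] := fiber_extension_exists z Cf; have [F' eF'] := fiber_extension_exists z Cf'.
  rewrite (fiber_restrictE vw Cf eF) (fiber_restrictE vw Cf' eF').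
  rewrite (fiber_restrictE vw (fiber_smooth_comb a Cf Cf') (fiber_extension_comb a eF eF')).
  exact: wl eF.1 eF'.1.
have [F eF] := fiber_extension_exists z Cf; have [F' eF'] := fiber_extension_exists z Cf'.
rewrite (fiber_restrictE vw Cf eF) (fiber_restrictE vw Cf' eF').
rewrite (fiber_restrictE vw (fiber_smooth_mul Cf Cf') (fiber_extension_mul eF eF')).
by rewrite (fiber_extensionE eF) (fiber_extensionE eF'); exact: wm eF.1 eF'.1.
Qed.

Lemma fiber_push_restrict w z : vertical pi (sval z) w -> push (fiber_restrict w z) = w.
Proof.
move=> vw; have [[w0 _ _] _] := vw; apply/funext => F.
have [CMF|nCMF] := pselect (CM F); last by rewrite /fiber_push /differential asboolF// w0.
rewrite (fiber_pushE _ CMF).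
exact: (fiber_restrictE vw (fiber_smooth_restrict CMF) (fiber_extension_restrict z CMF)).
Qed.

Lemma fiber_restrict_field (X : vfield R M) : vertical_field pi X ->
  vector_field CF (fun z => fiber_restrict (X (sval z)) z).
Proof.
move=> vX; split=> [z|f Cf]; first exact: fiber_restrict_tangent (vX.2 _).
apply: fiber_smoothP => z; have [F [CMF nF]] := fiber_extension_exists z Cf.
exists (fun q => X q F); split; first exact: vf_C vX.1 CMF.
near=> q => z' zq; rewrite -zq; apply: fiber_restrictE; [exact: vX.2|exact: Cf|].
(* An extension at [z] is also one at all nearby points of the fiber, so a single [F] serves around
   [z]. *)
split=> //; rewrite zq; near: q; exact: (near_join nF).
Unshelve. all: by end_near. Qed.

Lemma killing_on_fiber_of_vertical (xi : vfield R M) : vertical_field pi xi ->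
  vertical_killing pi g xi -> killing_on_fiber pi g xi x.
Proof.
move=> vxi kxi; exists (fun z => fiber_restrict (xi (sval z)) z).
  by move=> z; exact: fiber_push_restrict (vxi.2 _).
have veta := fiber_restrict_field vxi; split=> // X Y vX vY z.
have [X' vX' nX] := fiber_field_extension z vX; have [Y' vY' nY] := fiber_field_extension z vY.
have nxi : \forall q \near (sval z : M), forall z' : Fx, sval z' = q ->
    push (fiber_restrict (xi (sval z')) z') = xi q.
  by apply: nearW => q z' <-; exact: fiber_push_restrict (vxi.2 _).
rewrite /fiber_metric.
rewrite (fiber_lie_push veta vX vxi.1 vX'.1 nxi nX) (fiber_lie_push veta vY vxi.1 vY'.1 nxi nY).
rewrite (nbhs_singleton nX z erefl) (nbhs_singleton nY z erefl) -(kxi X' Y' vX' vY').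
(* Membership in [CF] is to be shown at every point of the fiber, while [X'] and [Y'] extend the
   fields near [z] only; so both are extended anew about each [z1]. *)
have ext z1 : exists F, fiber_extension z1 (fun z => g (sval z) (push (X z)) (push (Y z))) F.
  have [X1 vX1 nX1] := fiber_field_extension z1 vX.
  have [Y1 vY1 nY1] := fiber_field_extension z1 vY.
  exists (gfun g X1 Y1); split; first exact: (C_gfun hg vX1.1 vY1.1).
  near=> q => z' zq.
  have -> : push (X z') = X1 q by move: z' zq; near: q.
  have -> : push (Y z') = Y1 q by move: z' zq; near: q.
  by rewrite zq.
apply: (fiber_restrictE (vxi.2 _)); first exact: fiber_smoothP.
split; first exact: (C_gfun hg vX'.1 vY'.1).
near=> q => z' zq.
have -> : push (X z') = X' q by move: z' zq; near: q.
have -> : push (Y z') = Y' q by move: z' zq; near: q.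
by rewrite zq.
Unshelve. all: by end_near. Qed.

(** Restrict [X] and [Y] to the fiber, use the Killing equation of [eta] there, and push it forward.
    Only the relation of [eta] to [xi] matters. *)
Lemma vertical_killing_at_fiber (xi X Y : vfield R M) p : vertical_field pi xi ->
  killing_on_fiber pi g xi x -> pi p = x -> vertical_field pi X -> vertical_field pi Y ->
  xi p (gfun g X Y) = g p (lie_bracket xi X p) (Y p) + g p (X p) (lie_bracket xi Y p).
Proof.
move=> vxi [eta etaE [veta keta]] px vX vY.
pose z : Fx := exist _ p px.
have rX := fiber_restrict_field vX; have rY := fiber_restrict_field vY.
have pX z' : push (fiber_restrict (X (sval z')) z') = X (sval z').
  exact: fiber_push_restrict (vX.2 _).
have pY z' : push (fiber_restrict (Y (sval z')) z') = Y (sval z').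
  exact: fiber_push_restrict (vY.2 _).
have := keta _ _ rX rY z; rewrite /fiber_metric.
have neta : \forall q \near (sval z : M), forall z' : Fx, sval z' = q -> push (eta z') = xi q.
  by apply: nearW => q z' <-.
have nX : \forall q \near (sval z : M), forall z' : Fx, sval z' = q ->
    push (fiber_restrict (X (sval z')) z') = X q by apply: nearW => q z' <-.
have nY : \forall q \near (sval z : M), forall z' : Fx, sval z' = q ->
    push (fiber_restrict (Y (sval z')) z') = Y q by apply: nearW => q z' <-.
rewrite (fiber_lie_push veta rX vxi.1 vX.1 neta nX) (fiber_lie_push veta rY vxi.1 vY.1 neta nY).
rewrite pX pY -[sval z]/p => <-.
rewrite -(etaE z) (fiber_pushE _ (C_gfun hg vX.1 vY.1)); congr (eta z _).
by apply/funext => z'; rewrite pX pY.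
Qed.

End Fiber.

(** * Deformation along a vertical Killing field *)

Lemma open_snd (R : realType) (E F : normedModType R) (U : set F) :
  open U -> open [set z : E * F | U z.2].
Proof. by move=> oU; apply: (@open_comp _ _ snd) => // z _; exact: cvg_snd. Qed.

(** The difference quotients on both sides are convertible. *)
Lemma derive_snd (R : realType) (E F G : normedModType R) (f : F -> G) (z w : E * F) :
  'D_w (fun z => f z.2) z = 'D_(w.2) f z.2 /\
  (derivable f z.2 w.2 -> derivable (fun z : E * F => f z.2) z w).
Proof. by []. Qed.

Lemma smooth_on_snd (R : realType) (E F G : normedModType R) (U : set F) (f : F -> G) :
  open U -> smooth_on U f -> smooth_on [set z : E * F | U z.2] (fun z => f z.2).
Proof.
move=> oU /smooth_onP sf; apply/smooth_onP => k.
elim: k f sf => [|k IH] f sf; split=> //.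
- move=> z Uz; apply: continuous_comp; first exact: cvg_snd.
  exact: class_C_continuous (sf 0%N) Uz.
- move=> z Uz; apply: continuous_comp; first exact: cvg_snd.
  exact: class_C_continuous (sf 0%N) Uz.
split=> [z v Uz|v]; first by apply: (derive_snd f z v).2; exact: (sf 1%N).2.1.
by apply: (IH ('D_(v.2) f)) => j; exact: (sf j.+1).2.2.
Qed.

Lemma smooth_on_fst (R : realType) (E F : normedModType R) (U : set (E * F)) :
  open U -> smooth_on U (fun z => z.1).
Proof.
move=> oU; apply/smooth_onP => -[|k].
  by split; [move=> z _; exact: cvg_fst|].
have d (z v : E * F) : is_derive z v (fun z : E * F => z.1) v.1.
  by split; [exact: (@derivable_id R E z.1 v.1)|exact: (@derive_id R E z.1 v.1)].
split; first by move=> z _; exact: cvg_fst.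
split=> [z v _|v]; first by have [] := d z v.
apply: (@class_C_eq _ _ _ _ _ (cst v.1)); [exact: oU| |exact: class_C_cst].
by move=> z _; have [_ ->] := d z v.
Qed.

(** * The sheared metrics *)

Section Deformation.
Variables (R : realType) (m n : nat) (M : manifold R m) (N : manifold R n) (pi : M -> N).
Variables (g0 : mtensor R M) (gN : mtensor R N).
Notation CM := (smooth_fun M).
Notation CN := (smooth_fun N).
Notation dpi := (differential CN pi).
Notation vf := (vector_field CM).
Hypothesis hg0 : riemannian_metric CM g0.
Hypothesis hgN : riemannian_metric CN gN.
Hypothesis sub0 : riemannian_submersion pi g0 gN.
Hypothesis geo0 : totally_geodesic_fibers pi g0.
Variables (xi : vfield R M) (f : N -> R).
Hypothesis vxi : vertical_field pi xi.
Hypothesis kxi : vertical_killing pi g0 xi.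
Hypothesis Cf : CN f.
Let AM := manifold_smooth_algebra M.
Let spi : smooth_map pi. Proof. by case: sub0. Qed.
Let phi := f \o pi.
Let Cphi : CM phi. Proof. exact: smooth_fun_pullback. Qed.
Implicit Types (t : R) (p : M) (u v w : tvec R M).

(* The horizontal spaces of [sheared_metric t] are the images under [shear (- t)] of
   those of g0, that is, the horizontal lift of Z becomes Z - t df(Z) xi. *)
Definition shear t p v : tvec R M := (t * v phi) *: xi p + v.

Definition sheared_metric t : mtensor R M := fun p u v => g0 p (shear t p u) (shear t p v).

Let xiphi p : xi p phi = 0. Proof. exact: (vertical_pullback (vxi.2 p) Cf). Qed.
Let txi p : tangent CM p (xi p). Proof. exact: vf_tangent vxi.1. Qed.

Lemma tangent_shear t p v : tangent CM p v -> tangent CM p (shear t p v).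
Proof. by move=> tv; exact: tangent_comb (txi p) tv. Qed.

Lemma shear_comb t p a u v : shear t p (a *: u + v) = a *: shear t p u + shear t p v.
Proof.
apply/funext => h; rewrite /shear.
rewrite -[LHS]/(t * (a * u phi + v phi) * xi p h + (a * u h + v h)).
rewrite -[RHS]/(a * (t * u phi * xi p h + u h) + (t * v phi * xi p h + v h)); ring.
Qed.

Lemma shear_vertical t p v : vertical pi p v -> shear t p v = v.
Proof. by move=> vv; rewrite /shear (vertical_pullback vv Cf) mulr0 scale0r add0r. Qed.

(** The endomorphism v |-> (v phi) xi has square zero, since the vertical [xi] annihilates [phi]. *)
Lemma shearK t p v : shear t p (shear (- t) p v) = v.
Proof.
apply/funext => h.
rewrite -[LHS]/(t * (- t * v phi * xi p phi + v phi) * xi p h + (- t * v phi * xi p h + v h)).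
rewrite xiphi; ring.
Qed.

Lemma differential_shear t p v : dpi (shear t p v) = dpi v.
Proof. by rewrite differential_comb (vxi.2 p).2 scaler0 add0r. Qed.

Lemma shear_field t X : vf X -> vf (fun p => shear t p (X p)).
Proof.
move=> vX; apply: (vf_comb AM _ vxi.1 vX).
by apply: (sa_mul AM); [exact: (sa_cst AM)|exact: vf_C vX Cphi].
Qed.

Lemma sheared_metric_riemannian t : riemannian_metric CM (sheared_metric t).
Proof.
split.
- by move=> p u v tu tv; apply: (metric_sym hg0); exact: tangent_shear.
- move=> p a u v w tu tv tw; rewrite /sheared_metric shear_comb.
  exact: (metric_combl hg0 a (tangent_shear t tu) (tangent_shear t tv) (tangent_shear t tw)).
- move=> p v tv v0; case: hg0 => _ _ pos _; apply: pos; first exact: tangent_shear.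
  move=> s0; apply: v0; have := shearK (- t) p v; rewrite opprK s0 => <-.
  by rewrite /shear addr0 -[(0 : tvec R M) phi]/(0 : R) mulr0 scale0r.
- by move=> X Y vX vY; exact: (C_gfun hg0 (shear_field t vX) (shear_field t vY)).
Qed.

Lemma sheared_metric_vertical t p v w : vertical pi p v -> vertical pi p w ->
  sheared_metric t p v w = g0 p v w.
Proof. by move=> vv vw; rewrite /sheared_metric !shear_vertical. Qed.

Lemma sheared_metric_submersion t : riemannian_submersion pi (sheared_metric t) gN.
Proof.
have [_ rk iso] := sub0; split; [exact: spi|exact: rk|].
have hs p v : horizontal pi (sheared_metric t) p v -> horizontal pi g0 p (shear t p v).
  move=> [tv hv]; split; first exact: tangent_shear.
  by move=> w vw; rewrite -(hv w vw) /sheared_metric (shear_vertical t vw).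
move=> p v w /hs hv /hs hw.
by rewrite /sheared_metric (iso _ _ _ hv hw) !differential_shear.
Qed.

Lemma sheared_metric_geodesic t : totally_geodesic_fibers pi (sheared_metric t).
Proof.
have hgt := sheared_metric_riemannian t; have subt := sheared_metric_submersion t.
apply: (gradient_totally_geodesic hgt subt) => h Z Ch HZ X Y vX vY p.
have Chp := smooth_fun_pullback spi Ch.
have [Z0 vZ0 gZ0] := gradient AM hg0 Chp.
have HZ0 : is_gradient CM g0 (h \o pi) Z0 by [].
pose a q := - t * Z0 q phi.
have Ca : CM a by apply: (sa_mul AM); [exact: (sa_cst AM)|exact: vf_C vZ0 Cphi].
(* The right side is [shear (- t)] of [Z0]; in the sheared pairing the two shears cancel, and the
   one left on [w] does not change [w (h o pi)] because [xi] annihilates [h o pi]. *)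
have ZE : Z = fun q => a q *: xi q + Z0 q.
  apply/funext => q; apply: (metric_nondegenerate hgt (p := q)).
  - exact: vf_tangent HZ.1.
  - by apply: tangent_comb; [exact: txi|exact: vf_tangent vZ0].
  move=> w tw; rewrite HZ.2// /sheared_metric.
  rewrite -[a q *: xi q + Z0 q]/(shear (- t) q (Z0 q)) shearK gZ0; last exact: tangent_shear.
  rewrite -[RHS]/(t * w phi * xi q (h \o pi) + w (h \o pi)).
  by rewrite (vertical_pullback (vxi.2 q) Ch) mulr0 add0r.
(* In the bracket of a xi with [W] this derivative multiplies [xi]. Without it the Lie derivative
   along [Z] is [a] times that along [xi] plus that along [Z0], and both vanish on vertical
   fields. *)
have da W : vertical_field pi W -> W p a = 0.
  move=> vW; rewrite (tangent_scale (sa_cst AM) _ (vf_tangent p vW.1) (vf_C vZ0 Cphi)).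
  by rewrite (vertical_derive_gradient hgN hg0 sub0 Ch Cf HZ0 (vW.2 p)) mulr0.
have lieE W : vertical_field pi W ->
    lie_bracket Z W p = a p *: lie_bracket xi W p + lie_bracket Z0 W p.
  by move=> vW; rewrite ZE (lie_combl AM p Ca vxi.1 vZ0 vW.1) da// scale0r subr0.
have vZX := vertical_lie_gradient hgN hgt subt Ch HZ vX.
have vZY := vertical_lie_gradient hgN hgt subt Ch HZ vY.
rewrite (sheared_metric_vertical t (vZX.2 p) (vY.2 p)).
rewrite (sheared_metric_vertical t (vX.2 p) (vZY.2 p)) (lieE X vX) (lieE Y vY).
have -> : gfun (sheared_metric t) X Y = gfun g0 X Y.
  by apply/funext => q; exact: sheared_metric_vertical (vX.2 q) (vY.2 q).
have tX := vf_tangent p vX.1; have tY := vf_tangent p vY.1.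
have tl U V : vf U -> vf V -> tangent CM p (lie_bracket U V p).
  by move=> vU vV; exact: vf_tangent (vf_lie AM vU vV).
have txX := tl _ _ vxi.1 vX.1; have txY := tl _ _ vxi.1 vY.1.
have tZX := tl _ _ vZ0 vX.1; have tZY := tl _ _ vZ0 vY.1.
rewrite (metric_combl hg0 (a p) txX tZX tY) (metric_combr hg0 (a p) txY tZY tX).
have e0 := totally_geodesic_gradient hg0 geo0 Ch HZ0 vX vY p.
have e1 := kxi vX vY p.
rewrite ZE -[LHS]/(a p * xi p (gfun g0 X Y) + Z0 p (gfun g0 X Y)) e0 e1; ring.
Qed.

(** A polynomial in [t] whose coefficients are smooth on [M] when [u] and [v] vary as vector fields:
    this gives joint smoothness, and the linear coefficient shows that the metric changes. *)
Lemma sheared_metricE t p u v : tangent CM p u -> tangent CM p v ->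
  sheared_metric t p u v = g0 p u v + t * (u phi * g0 p (xi p) v + v phi * g0 p u (xi p)) +
    t * t * (u phi * v phi * g0 p (xi p) (xi p)).
Proof.
move=> tu tv; have tsv : tangent CM p ((t * v phi) *: xi p + v) by exact: tangent_comb (txi p) tv.
rewrite /sheared_metric /shear (metric_combl hg0 _ (txi p) tu tsv).
rewrite (metric_combr hg0 _ (txi p) tv (txi p)) (metric_combr hg0 _ (txi p) tv tu); ring.
Qed.

Lemma sheared_metric_variation (eps : R) : 0 < eps ->
  metric_variation pi g0 eps sheared_metric.
Proof.
move=> eps0; split; first exact: eps0.
- move=> t _; split; first exact: sheared_metric_riemannian.
  by move=> p v w vv vw; exact: sheared_metric_vertical.
- move=> X Y vX vY c ac.
  pose U := [set ty : R^o * 'rV[R]_m | - eps < ty.1 < eps /\ cod c ty.2].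
  have oI : open [set ty : R^o * 'rV[R]_m | - eps < ty.1 < eps].
    rewrite (_ : [set ty | _] = fst @^-1` [set` `]- eps, eps[ : interval R^o]).
      by apply: open_comp; [move=> z _; exact: cvg_fst|exact: interval_open].
    by apply/funext => ty; rewrite /= in_itv.
  have oU : open U by exact: openI oI (open_snd (@cod_open _ _ _ c)).
  have lift (F : M -> R) : CM F -> smooth_on U (fun ty => F (chart_inv c ty.2) : R^o).
    move=> CF; apply: (smooth_on_sub (U := [set z : R^o * 'rV[R]_m | cod c z.2])).
      by move=> ty [].
    exact: (smooth_on_snd (@cod_open _ _ _ c) (CF c ac)).
  have st : smooth_on U (fun ty => ty.1) by exact: smooth_on_fst.
  have CX := vf_C vX Cphi; have CY := vf_C vY Cphi.
  have Ca := C_gfun hg0 vX vY.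
  have Cb := sa_add AM (sa_mul AM CX (C_gfun hg0 vxi.1 vY)) (sa_mul AM CY (C_gfun hg0 vX vxi.1)).
  have Cc := sa_mul AM (sa_mul AM CX CY) (C_gfun hg0 vxi.1 vxi.1).
  have sE := smooth_onD oU (smooth_onD oU (lift _ Ca) (smooth_onM oU st (lift _ Cb)))
    (smooth_onM oU (smooth_onM oU st st) (lift _ Cc)).
  apply: (smooth_on_eq oU _ sE) => ty _ /=.
  by apply/esym; apply: sheared_metricE; [exact: vf_tangent vX|exact: vf_tangent vY].
- move=> p v w tv tw; rewrite /sheared_metric /shear !mul0r !scale0r.
  by rewrite ![_ + _]add0r.
Qed.

End Deformation.

(** * From variations to Killing fields and back *)

Lemma killing_field_of_variation (R : realType) (m n : nat)
  (M : manifold R m) (N : manifold R n) (pi : M -> N)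
  (g0 g : mtensor R M) (gN : mtensor R N) :
  riemannian_metric (smooth_fun M) g0 -> riemannian_metric (smooth_fun N) gN ->
  riemannian_submersion pi g0 gN -> totally_geodesic_fibers pi g0 ->
  Riem pi g0 g -> riemannian_submersion pi g gN -> totally_geodesic_fibers pi g ->
  ~ same_metric g g0 ->
  exists xi : vfield R M,
     [/\ vertical_field pi xi, nontrivial_field xi
       & forall x : N, killing_on_fiber pi g0 xi x].
Proof.
move=> hg0 hgN sub0 geo0 [hg gV] sub geo nsame.
have gg p v w : vertical pi p v -> vertical pi p w -> g0 p v w = g p v w.
  by move=> vv vw; rewrite gV.
(* If no such field exists, every difference of gradients must vanish, and then the two metrics
   coincide. *)
apply: contrapT => none; apply: nsame => p v w tv tw; apply/esym.
apply: (same_gradients_same_metric hg0 hg sub0 gg) => // h Z Z' Ch HZ HZ' q.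
apply: contrapT => ZZ'; apply: none; exists (fun q => Z' q - Z q).
have vxi := gradient_difference_vertical hgN hg0 hg sub0 sub Ch HZ HZ'.
split; [exact: vxi| |move=> x].
  by exists q => /eqP; rewrite subr_eq0 => /eqP.
apply: (killing_on_fiber_of_vertical hg0 sub0 x vxi).
exact: (gradient_difference_killing hgN hg0 hg sub0 sub gg geo0 geo Ch HZ HZ').
Qed.

Lemma variation_of_killing_field (R : realType) (m n : nat)
  (M : manifold R m) (N : manifold R n) (pi : M -> N)
  (g0 : mtensor R M) (gN : mtensor R N) (xi : vfield R M) :
  riemannian_metric (smooth_fun M) g0 -> riemannian_metric (smooth_fun N) gN ->
  riemannian_submersion pi g0 gN -> totally_geodesic_fibers pi g0 ->
  (0 < n)%N -> vertical_field pi xi -> nontrivial_field xi ->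
  (forall x : N, killing_on_fiber pi g0 xi x) ->
  exists g : R -> mtensor R M, nontrivial_variation pi g0 1 g /\
     (forall t : R, riemannian_submersion pi (g t) gN /\ totally_geodesic_fibers pi (g t)).
Proof.
move=> hg0 hgN sub0 geo0 n0 vxi [p xip] kill.
have kxi : vertical_killing pi g0 xi.
  by move=> X Y vX vY q; exact: (vertical_killing_at_fiber hg0 sub0 vxi (kill (pi q)) erefl vX vY).
have [spi rk _] := sub0.
have [e [te li _]] := rk p; pose i0 := Ordinal n0.
(* Since [n] is positive there is a first vector [e i0]; if all pulled back functions had zero
   derivative along it, [dpi (e i0)] would vanish, against independence. *)
have [f Cf ef] : exists2 f, smooth_fun N f & e i0 (f \o pi) != 0.
  apply: contrapT => nf; have de0 : differential (smooth_fun N) pi (e i0) = 0.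
    have [] // := verticalP (te i0) (_ : forall h, smooth_fun N h -> e i0 (h \o pi) = 0).
    by move=> h Ch; apply/eqP/negPn/negP => eh; apply: nf; exists h.
  have l0 : \sum_(i < n) (i == i0)%:R *: differential (smooth_fun N) pi (e i) = 0.
    by apply: big1 => i _; case: eqVneq => [->|_]; rewrite ?de0 ?scaler0 ?scale0r.
  by have /eqP := li _ l0 i0; rewrite eqxx oner_eq0.
have Cphi := smooth_fun_pullback spi Cf.
have txi : tangent (smooth_fun M) p (xi p) by exact: (vxi.2 p).1.
exists (sheared_metric pi g0 xi f); split; last first.
  move=> t; split; first exact: sheared_metric_submersion.
  exact: (sheared_metric_geodesic hg0 hgN sub0 geo0 vxi kxi Cf).
split; first exact: (sheared_metric_variation hg0 sub0 vxi Cf ltr01).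
(* Any nonzero parameter in the interval would do. *)
exists 2^-1; first by lra.
(* On the pair [e i0], [xi p] the change of metric is [t] times [e i0 (f o pi)] times the squared
   length of [xi p]; the quadratic term drops because [xi] annihilates [f o pi]. *)
move=> /(_ p (e i0) (xi p) (te i0) txi).
rewrite (sheared_metricE hg0 f vxi _ (te i0) txi) (vertical_pullback (vxi.2 p) Cf) /=.
rewrite mul0r addr0 mulr0 mul0r mulr0 addr0 => /eqP.
rewrite -subr_eq0 addrAC subrr add0r.
rewrite !mulf_eq0 invr_eq0 pnatr_eq0 (negbTE ef) /= => /eqP gxi.
by apply: xip; exact: (metric_eq0 hg0 txi).
Qed.

Theorem theorem3p12 (R : realType) (m n : nat)
  (M : manifold R m) (N : manifold R n) (pi : M -> N)
  (g0 : mtensor R M) (gN : mtensor R N)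
  (hg0 : riemannian_metric (smooth_fun M) g0)
  (hgN : riemannian_metric (smooth_fun N) gN)
  (hpi : riemannian_submersion pi g0 gN)
  (hgeo : totally_geodesic_fibers pi g0) :
  ((exists (eps : R) (g : R -> mtensor R M),
      nontrivial_variation pi g0 eps g /\
      (forall t : R, - eps < t < eps ->
         riemannian_submersion pi (g t) gN /\
         totally_geodesic_fibers pi (g t))) ->
   exists xi : vfield R M,
     [/\ vertical_field pi xi, nontrivial_field xi
       & forall x : N, killing_on_fiber pi g0 xi x])
  /\
  ((0 < n)%N ->
   (exists xi : vfield R M,
      [/\ vertical_field pi xi, nontrivial_field xi, bounded_field g0 xi
        & forall x : N, killing_on_fiber pi g0 xi x]) ->
   exists (eps : R) (g : R -> mtensor R M),
     nontrivial_variation pi g0 eps g /\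
     (forall t : R, - eps < t < eps ->
        riemannian_submersion pi (g t) gN /\
        totally_geodesic_fibers pi (g t))).
Proof.
split.
  move=> [eps [g [[[_ gRiem _ _] [t teps nsame]] gsub]]].
  have [subt geot] := gsub t teps.
  exact: (killing_field_of_variation hg0 hgN hpi hgeo (gRiem t teps) subt geot nsame).
move=> n0 [xi [vxi nxi _ kxi]].
have [g [nvar gsub]] := variation_of_killing_field hg0 hgN hpi hgeo n0 vxi nxi kxi.
by exists 1, g; split=> // t _; exact: gsub.
Qed.
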